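(* Consider the Cauchy problem for the Zakharov system on $\mathbb{T}$, $$i\partial_tu+\partial_x^2u=Nu,\qquad \partial_t^2N-\partial_x^2N=\partial_x^2(|u|^2),\qquad (u,N)(t,x):[0,T]\times\mathbb{T}\to\mathbb{C}\times\mathbb{R},$$ $$(u,N,\partial_tN)|_{t=0}=(u_0,N_0,N_1)\in H^{1/2}(\mathbb{T};\mathbb{C})\times L^2(\mathbb{T};\mathbb{R})\times H^{-1}(\mathbb{T};\mathbb{R}).$$ For any $T>0$ and any such initial data, the solution (in the sense of distribution) is unique in the class $$(u,N)\in C([0,T];H^{1/2}(\mathbb{T};\mathbb{C}))\times\big[C([0,T];L^2(\mathbb{T};\mathbb{R}))\cap C^1([0,T];H^{-1}(\mathbb{T};\mathbb{R}))\big];$$ i.e., there is at most one solution in this class.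
   Context: $\mathbb{T}=\mathbb{R}/2\pi\mathbb{Z}$; $H^\sigma(\mathbb{T})$ denotes the usual $L^2$-based Sobolev space. Solutions satisfy the equations in $\mathcal{D}'((0,T)\times\mathbb{T})$ and attain the initial data at $t=0$. *)

(* Defs.v *)
From HB Require Import structures.
From mathcomp Require Import all_boot all_order all_algebra.
From mathcomp Require Import all_classical all_reals all_analysis.
From mathcomp.real_closed Require Import complex.

Set Implicit Arguments.
Unset Strict Implicit.
Unset Printing Implicit Defensive.

Import Order.TTheory GRing.Theory Num.Theory.
Import numFieldNormedType.Exports.

Local Open Scope classical_set_scope.
Local Open Scope ring_scope.
Local Open Scope complex_scope.

Section CalculusForComplexValues.
Context {R : realType}.

Definition cintegral d (X : measurableType d) (mu : {measure set X -> \bar R})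
    (D : set X) (f : X -> R[i]) : R[i] :=
  (\int[mu]_(x in D) complex.Re (f x)) +i* (\int[mu]_(x in D) complex.Im (f x)).

Definition cderive (V : normedModType R) (v : V) (f : V -> R[i]) : V -> R[i] :=
  fun p => ('D_v (fun q => complex.Re (f q)) p) +i* ('D_v (fun q => complex.Im (f q)) p).

(* C^oo: all iterated directional derivatives exist and are continuous *)
Definition smooth (V : normedModType R) (f : V -> R[i]) : Prop :=
  forall (vs : seq V) (p : V),
    let g := foldr (@cderive V) f vs in
    [/\ {for p, continuous (fun q => complex.Re (g q))},
        {for p, continuous (fun q => complex.Im (g q))},
        forall w, derivable (fun q => complex.Re (g q)) p w &
        forall w, derivable (fun q => complex.Im (g q)) p w].

End CalculusForComplexValues.

(* A function on T = R / 2 pi Z is a 2 pi-periodic function on R; it is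
   integrated over the fundamental domain [0, 2 pi]. *)
Section Torus.
Context {R : realType}.

Definition torus_dom : set R := `[0, pi *+ 2].

Lemma measurable_torus_dom : measurable torus_dom.
Proof. exact: measurable_itv. Qed.

Definition torus_measure : {measure set (measurableTypeR R) -> \bar R} :=
  mrestr lebesgue_measure measurable_torus_dom.

Definition L2 (f : R -> R) : Prop :=
  periodic f (pi *+ 2) /\ f \in Lfun torus_measure 2%:E.

Definition L1C (f : R -> R[i]) : Prop :=
  [/\ periodic f (pi *+ 2),
      (fun x => complex.Re (f x)) \in Lfun torus_measure 1%:E &
      (fun x => complex.Im (f x)) \in Lfun torus_measure 1%:E].

Definition ae_eqT (Y : Type) (f g : R -> Y) : Prop :=
  {ae torus_measure, forall x, f x = g x}.

Definition testT (phi : R -> R[i]) : Prop :=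
  periodic phi (pi *+ 2) /\ smooth phi.

(* Only the values of a functional on test functions are meaningful. *)
Definition functionalT := (R -> R[i]) -> R[i].

Definition eq_distT (f g : functionalT) : Prop :=
  forall phi, testT phi -> f phi = g phi.

(* The last clause is continuity for the C^oo topology: for some c and m,
   |f phi| <= c * max_{j <= m} sup |phi^(j)|. *)
Definition distributionT (f : functionalT) : Prop :=
  [/\ forall phi psi, testT phi -> testT psi ->
        f (fun x => phi x + psi x) = f phi + f psi,
      forall (a : R[i]) phi, testT phi -> f (fun x => a * phi x) = a * f phi &
      exists (c : R) (m : nat), forall phi (B : R), testT phi ->
        (forall (j : nat) (x : R), (j <= m)%N ->
           `|iter j (cderive (1 : R)) phi x| <= B%:C) ->
        `|f phi| <= (c * B)%:C].

Definition real_distT (f : functionalT) : Prop :=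
  forall phi, testT phi -> (forall x, complex.Im (phi x) = 0) -> complex.Im (f phi) = 0.

Definition dist_of (f : R -> R[i]) : functionalT :=
  fun phi => cintegral torus_measure setT (fun x => f x * phi x).

Definition fourier_coef (f : functionalT) (k : int) : R[i] :=
  ((pi *+ 2)^-1)%:C * f (fun x => cos (k%:~R * x) -i* sin (k%:~R * x)).

(* (sum_k (1 + k^2)^s |f^(k)|^2)^(1/2), possibly +oo *)
Definition Hnorm (s : R) (f : functionalT) : \bar R :=
  ((\esum_(k in [set: int])
      ((1 + (k%:~R : R) ^+ 2) `^ s
        * ComplexField.Normc.normc (fourier_coef f k) ^+ 2)%R%:E) `^ 2^-1)%E.

Definition Hdist (s : R) (f : functionalT) (g : functionalT) : \bar R :=
  Hnorm s (fun phi => f phi - g phi).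

Definition Hs (s : R) (f : functionalT) : Prop :=
  distributionT f /\ (Hnorm s f < +oo)%E.

(* for s >= 0, elements of H^s are functions *)
Definition Hs_fun (s : R) (f : R -> R[i]) : Prop := L1C f /\ Hs s (dist_of f).

Definition HsR (s : R) (f : functionalT) : Prop := Hs s f /\ real_distT f.

Definition continuous_L2 (T : R) (N : R -> R -> R) : Prop :=
  (forall t : R, `[0, T]%classic t -> L2 (N t)) /\
  forall t : R, `[0, T]%classic t ->
    ('N[torus_measure]_2%:E [(fun x => (N t' x - N t x)%:E)])%E
      @[t' --> within `[0, T]%classic (nbhs t)] --> 0%E.

Definition continuous_Hs_fun (s T : R) (u : R -> R -> R[i]) : Prop :=
  (forall t : R, `[0, T]%classic t -> Hs_fun s (u t)) /\
  forall t : R, `[0, T]%classic t ->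
    Hdist s (dist_of (u t')) (dist_of (u t))
      @[t' --> within `[0, T]%classic (nbhs t)] --> 0%E.

Definition continuous_HsR (s T : R) (F : R -> functionalT) : Prop :=
  (forall t : R, `[0, T]%classic t -> HsR s (F t)) /\
  forall t : R, `[0, T]%classic t ->
    Hdist s (F t') (F t) @[t' --> within `[0, T]%classic (nbhs t)] --> 0%E.

(* F' is the derivative of F : [0, T] -> H^s (one-sided at 0 and T) *)
Definition derivative_Hs (s T : R) (F F' : R -> functionalT) : Prop :=
  forall t : R, `[0, T]%classic t ->
    Hdist s (fun phi => ((t' - t)^-1)%:C * (F t' phi - F t phi)) (F' t)
      @[t' --> within (`[0, T]%classic `\ t) (nbhs t)] --> 0%E.

Definition C1_HsR (s T : R) (F F' : R -> functionalT) : Prop :=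
  [/\ continuous_HsR s T F, continuous_HsR s T F' & derivative_Hs s T F F'].

End Torus.

Section SpaceTime.
Context {R : realType}.

(* test functions on (0, T) x T *)
Definition testST (T : R) (phi : R * R -> R[i]) : Prop :=
  [/\ smooth phi,
      forall t, periodic (fun x => phi (t, x)) (pi *+ 2) &
      exists a b : R, [/\ 0 < a, b < T &
        forall t x, ~ (a <= t <= b) -> phi (t, x) = 0]].

Definition functionalST := (R * R -> R[i]) -> R[i].

Definition dt (f : functionalST) : functionalST :=
  fun phi => - f (cderive ((1, 0) : R * R) phi).

Definition dx (f : functionalST) : functionalST :=
  fun phi => - f (cderive ((0, 1) : R * R) phi).

(* The integral is iterated because u : [0, T] -> L^1 is continuous as a map
   into a space of classes: its representatives u t need not be jointly
   measurable in (t, x), but the inner integral is continuous in t. *)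
Definition distST_of (T : R) (u : R -> R -> R[i]) : functionalST :=
  fun phi => cintegral (@lebesgue_measure R) `[0, T]
    (fun t => dist_of (u t) (fun x => phi (t, x))).

Definition eq_distST (T : R) (f g : functionalST) : Prop :=
  forall phi, testST T phi -> f phi = g phi.

End SpaceTime.

Section Zakharov.
Context {R : realType}.

Definition to_complex (N : R -> R) : R -> R[i] := fun x => (N x)%:C.

Definition schrodinger_eq (T : R) (u : R -> R -> R[i]) (N : R -> R -> R) :=
  let U := distST_of T u in
  eq_distST T (fun phi => 'i%C * dt U phi + dx (dx U) phi)
              (distST_of T (fun t x => (N t x)%:C * u t x)).

Definition wave_eq (T : R) (u : R -> R -> R[i]) (N : R -> R -> R) :=
  let M := distST_of T (fun t => to_complex (N t)) in
  eq_distST T (fun phi => dt (dt M) phi - dx (dx M) phi)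
    (dx (dx (distST_of T
       (fun t x => (ComplexField.Normc.normc (u t x) ^+ 2)%:C)))).

(* Nt is the continuous H^-1-valued time derivative of N. *)
Definition zakharov_solution (T : R) (u0 : R -> R[i]) (N0 : R -> R)
    (N1 : functionalT) (u : R -> R -> R[i]) (N : R -> R -> R) : Prop :=
  [/\ continuous_Hs_fun 2^-1 T u,
      continuous_L2 T N,
      exists Nt : R -> functionalT,
        C1_HsR (- 1) T (fun t => dist_of (to_complex (N t))) Nt /\
        eq_distT (Nt 0) N1,
      ae_eqT (u 0) u0 /\ ae_eqT (N 0) N0 &
      schrodinger_eq T u N /\ wave_eq T u N].

End Zakharov.

(* Main.v *)
Require Import Defs.
From HB Require Import structures.
From mathcomp Require Import all_boot all_order all_algebra.
From mathcomp Require Import all_classical all_reals all_analysis.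
From mathcomp.real_closed Require Import complex.
From mathcomp Require Import measurable_realfun zify ring lra.

Import Order.TTheory GRing.Theory Num.Theory.
Import numFieldNormedType.Exports.

Local Open Scope classical_set_scope.
Local Open Scope ring_scope.

Set Implicit Arguments.
Unset Strict Implicit.
Unset Printing Implicit Defensive.

(** With the half-waves [a_sg = N + sg (i/k) N_t] (sg = 1, -1) the system becomes, mode by mode,
    [u_k' = - i k^2 u_k - i (N u)_k] and [a_k' = - i sg k a_k - i sg k (|u|^2)_k], while the zero
    mode of [N] is affine in time.  The difference of two solutions lies in
    [h^(1/2) x l^2 x l^2], where the quadratic terms lose half a derivative, resp. one.
    Differentiation by parts recovers this loss: away from [|k + j - sg| <= K] the resonance
    function [(k - j)(k + j - sg)] is large, so the quadratic terms are the time derivative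
    of boundary terms that are small for large [K], up to cubic terms bounded in the same
    space; the nearly resonant terms are bounded with a constant depending on [K].  On a
    short time interval, of length depending only on the size of the solutions, the
    difference is thus at most half of its own bound, hence zero.  The convolutions are
    truncated to [|j| <= L]; their tails are [O(1/L)] uniformly in time.
    The mode equations come from testing with [chi(t) e^(-ikx)].  That products of functions
    have convolved Fourier coefficients rests on the converse of Bessel's inequality for
    integrable functions, which follows by duality from smearing with the kernel
    [(2 + 2 cos x)^n]. *)

(** * Weighted square sums over the integers *)

(** The data are weaker than the estimates want: [u t] is only an integrable function whose
    coefficients lie in [h^(1/2)]. It must be shown square integrable before [N u] and [|u|^2] can
    be expanded in modes; this is the use of the converse of Bessel's inequality. The half-waves
    carry the phase [sg k] and not [sg |k|], so that the resonance function factors over the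
    integers without case distinction. Truncation makes the boundary terms finite sums, which can be
    differentiated term by term. The full coefficients [F] and [G] enter the cubic terms only
    through their bounds in [h^(-1/2)] and [l^2]. The equations for the difference are linear in it,
    with coefficients taken from the two solutions. Hence a bound [B] of its squared norms improves
    to [B / 2], and iterating from the trivial bound [4 M] gives zero. The order of choices matters:
    [K] depends on [M] and makes the boundary terms small; the time step depends on [K], which
    enters the near-resonant constants; [L] comes last and may depend on the finite set of modes
    under consideration. *)

Section SquaredModulus.
Context {R : realType}.
Implicit Types z w : R[i].

Definition nsq z : R := complex.Re z ^+ 2 + complex.Im z ^+ 2.

Lemma cReD z w : complex.Re (z + w) = complex.Re z + complex.Re w.
Proof. by case: z w => [a b] [c d]. Qed.
Lemma cImD z w : complex.Im (z + w) = complex.Im z + complex.Im w.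
Proof. by case: z w => [a b] [c d]. Qed.
Lemma cReN z : complex.Re (- z) = - complex.Re z. Proof. by case: z. Qed.
Lemma cImN z : complex.Im (- z) = - complex.Im z. Proof. by case: z. Qed.
Lemma cReM z w : complex.Re (z * w) =
  complex.Re z * complex.Re w - complex.Im z * complex.Im w.
Proof. by case: z w => [a b] [c d]. Qed.
Lemma cImM z w : complex.Im (z * w) =
  complex.Re z * complex.Im w + complex.Im z * complex.Re w.
Proof. by case: z w => [a b] [c d]. Qed.
Lemma cReJ z : complex.Re (conjc z) = complex.Re z. Proof. by case: z. Qed.
Lemma cImJ z : complex.Im (conjc z) = - complex.Im z. Proof. by case: z. Qed.

Lemma complexP z w : complex.Re z = complex.Re w -> complex.Im z = complex.Im w -> z = w.
Proof. by case: z w => [a b] [c d] /= -> ->. Qed.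

Definition ReIm := (cReD, cImD, cReN, cImN, cReM, cImM, cReJ, cImJ).

Lemma Re_sum I (r : seq I) P (F : I -> R[i]) :
  complex.Re (\sum_(i <- r | P i) F i) = \sum_(i <- r | P i) complex.Re (F i).
Proof. by apply: (big_morph _ cReD). Qed.
Lemma Im_sum I (r : seq I) P (F : I -> R[i]) :
  complex.Im (\sum_(i <- r | P i) F i) = \sum_(i <- r | P i) complex.Im (F i).
Proof. by apply: (big_morph _ cImD). Qed.

Lemma conjcM z w : conjc (z * w) = conjc z * conjc w.
Proof. by apply: complexP; rewrite !ReIm; ring. Qed.

Lemma conjc_sum I (r : seq I) P (F : I -> R[i]) :
  conjc (\sum_(i <- r | P i) F i) = \sum_(i <- r | P i) conjc (F i).
Proof. by apply: complexP; rewrite !(cReJ, cImJ, Re_sum, Im_sum) -?sumrN; apply: eq_bigr => i _; rewrite !ReIm. Qed.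

Lemma nsq_ge0 z : 0 <= nsq z.
Proof. by rewrite addr_ge0 ?sqr_ge0. Qed.
Lemma nsq0 : nsq 0 = 0. Proof. by rewrite /nsq /= !expr0n addr0. Qed.
Lemma nsqM z w : nsq (z * w) = nsq z * nsq w.
Proof. by rewrite /nsq !ReIm; ring. Qed.
Lemma nsqJ z : nsq (conjc z) = nsq z.
Proof. by rewrite /nsq !ReIm; ring. Qed.
Lemma nsqN z : nsq (- z) = nsq z.
Proof. by rewrite /nsq !ReIm; ring. Qed.
Lemma nsqC (c : R) : nsq c%:C%C = c ^+ 2.
Proof. by rewrite /nsq /= expr0n addr0. Qed.
Lemma nsq_i : nsq ('i%C : R[i]) = 1.
Proof. by rewrite /nsq /= expr0n expr1n add0r. Qed.
Lemma nsqD_le z w : nsq (z + w) <= 2 * nsq z + 2 * nsq w.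
Proof.
rewrite /nsq !ReIm; set a := complex.Re z; set b := complex.Im z.
set c := complex.Re w; set d := complex.Im w.
by have := sqr_ge0 (a - c); have := sqr_ge0 (b - d); nra.
Qed.
Lemma nsqB_le z w : nsq (z - w) <= 2 * nsq z + 2 * nsq w.
Proof. by rewrite -(nsqN w) nsqD_le. Qed.
Lemma nsq_eq0 z : nsq z = 0 -> z = 0.
Proof.
move=> /eqP; rewrite /nsq paddr_eq0 ?sqr_ge0// !sqrf_eq0 => /andP[/eqP a /eqP b].
by apply: complexP.
Qed.
Lemma nsqE z : ComplexField.Normc.normc z ^+ 2 = nsq z.
Proof. by case: z => a b; rewrite /ComplexField.Normc.normc sqr_sqrtr// addr_ge0 ?sqr_ge0. Qed.
Lemma nsq_mulJ z : z * conjc z = (nsq z)%:C%C.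
Proof. by apply: complexP; rewrite !ReIm/= /nsq; ring. Qed.

(** Induction on the list. The cross term of the new entry is dominated by the two mixed products on
    the right: the product of these bounds its square, so the inequality between arithmetic and
    geometric mean applies. *)
Lemma cauchy_schwarz_sum I (r : seq I) (P : pred I) (c om x : I -> R) :
  (forall j, P j -> 0 < om j) ->
  (\sum_(j <- r | P j) c j * x j) ^+ 2 <=
  (\sum_(j <- r | P j) c j ^+ 2 / om j) * (\sum_(j <- r | P j) om j * x j ^+ 2).
Proof.
move=> om0; elim: r => [|i r IH]; first by rewrite !big_nil expr0n mul0r.
rewrite !big_cons; case: ifP => // Pi.
set S := \sum_(j <- r | P j) c j * x j in IH *.
set X := \sum_(j <- r | P j) c j ^+ 2 / om j in IH *.
set Y := \sum_(j <- r | P j) om j * x j ^+ 2 in IH *.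
have o := om0 _ Pi.
have X0 : 0 <= X.
  by apply: sumr_ge0 => j Pj; rewrite divr_ge0 ?sqr_ge0 ?ltW ?om0.
have Y0 : 0 <= Y.
  by apply: sumr_ge0 => j Pj; rewrite mulr_ge0 ?sqr_ge0 ?ltW ?om0.
have key : 2 * S * (c i * x i) <= X * (om i * x i ^+ 2) + Y * (c i ^+ 2 / om i).
  set A := X * (om i * x i ^+ 2); set B := Y * (c i ^+ 2 / om i).
  have A0 : 0 <= A by rewrite /A mulr_ge0// mulr_ge0 ?sqr_ge0// ltW.
  have B0 : 0 <= B by rewrite /B mulr_ge0// divr_ge0 ?sqr_ge0// ltW.
  have AB : A * B = X * Y * (c i * x i) ^+ 2.
    by rewrite /A /B; field; rewrite gt_eqF.
  have : (2 * S * (c i * x i)) ^+ 2 <= (A + B) ^+ 2.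
    have -> : (2 * S * (c i * x i)) ^+ 2 = 4 * (S ^+ 2 * (c i * x i) ^+ 2) by ring.
    have : S ^+ 2 * (c i * x i) ^+ 2 <= A * B by rewrite AB ler_wpM2r ?sqr_ge0.
    by have := sqr_ge0 (A - B); nra.
  move=> h; apply: le_trans (ler_norm _) _; rewrite -(@ler_pXn2r _ 2)// ?nnegrE ?addr_ge0//.
  by rewrite real_normK ?num_real.
have -> : (c i ^+ 2 / om i + X) * (om i * x i ^+ 2 + Y) =
   (c i * x i) ^+ 2 + X * Y + (X * (om i * x i ^+ 2) + Y * (c i ^+ 2 / om i)).
  by field; rewrite gt_eqF.
by nra.
Qed.

(** The coefficients are real, so real and imaginary parts are estimated separately with the same
    weights and no constant is lost. *)
Lemma nsq_sum_le I (r : seq I) (P : pred I) (c om : I -> R) (z : I -> R[i]) :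
  (forall j, P j -> 0 < om j) ->
  nsq (\sum_(j <- r | P j) (c j)%:C%C * z j) <=
  (\sum_(j <- r | P j) c j ^+ 2 / om j) * (\sum_(j <- r | P j) om j * nsq (z j)).
Proof.
move=> om0; rewrite /nsq Re_sum Im_sum.
under eq_bigr do rewrite cReM /= mul0r subr0.
under [X in _ + X ^+ 2]eq_bigr do rewrite cImM /= mul0r addr0.
apply: le_trans (lerD (cauchy_schwarz_sum _ _ _ om0) (cauchy_schwarz_sum _ _ _ om0)) _.
by rewrite -mulrDr -big_split/=; under [X in _ * X <= _]eq_bigr do rewrite -mulrDr.
Qed.

End SquaredModulus.

Section WeightedSums.
Context {R : realType}.
Implicit Types (a b f g : int -> R[i]) (r s : seq int).

(** Comparable to [(1 + k^2)^(1/2)]: squared moduli weighted by [jb] give the squared [H^(1/2)]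
    norm, and those weighted by its inverse the squared [H^(-1/2)] norm. This form is subadditive
    and keeps the kernel inequalities rational. *)
Definition jb (k : int) : R := 1 + `|k|%:~R.

Lemma jb_ge1 k : 1 <= jb k.
Proof. by rewrite /jb lerDl ler0z. Qed.
Lemma jb_gt0 k : 0 < jb k.
Proof. exact: lt_le_trans ltr01 (jb_ge1 k). Qed.
Lemma jbV_gt0 k : 0 < (jb k)^-1.
Proof. by rewrite invr_gt0 jb_gt0. Qed.
Lemma jbN k : jb (- k) = jb k. Proof. by rewrite /jb normrN. Qed.

(** A bound on all finite partial sums, so that no infinite sum has to be formed and a bound can be
    tested on one finite set of modes at a time. *)
Definition l2bound (om : int -> R) a (A : R) :=
  forall r, uniq r -> \sum_(k <- r) om k * nsq (a k) <= A.

Lemma l2bound_ge0 om a A : l2bound om a A -> 0 <= A.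
Proof. by move/(_ [::] isT); rewrite big_nil. Qed.

Lemma l2boundW om a A A' : A <= A' -> l2bound om a A -> l2bound om a A'.
Proof. by move=> AA' h r ur; apply: le_trans (h r ur) AA'. Qed.

Lemma l2bound_conj om a A : l2bound om a A -> l2bound om (fun k => conjc (a k)) A.
Proof. by move=> h r ur; under eq_bigr do rewrite nsqJ; exact: h. Qed.

Lemma l2boundD om a b A B : (forall k, 0 <= om k) ->
  l2bound om a A -> l2bound om b B ->
  l2bound om (fun k => a k + b k) (2 * A + 2 * B).
Proof.
move=> om0 ha hb r ur.
apply: (@le_trans _ _ (\sum_(k <- r) (2 * (om k * nsq (a k)) + 2 * (om k * nsq (b k))))).
  apply: ler_sum => k _.
  have := ler_wpM2l (om0 k) (nsqD_le (a k) (b k)); nra.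
by rewrite big_split/= -!mulr_sumr lerD// ler_wpM2l ?ha ?hb.
Qed.

Lemma l2boundN om a A : l2bound om a A -> l2bound om (fun k => - a k) A.
Proof. by move=> h r ur; under eq_bigr do rewrite nsqN; exact: h. Qed.

Lemma l2boundB om a b A B : (forall k, 0 <= om k) ->
  l2bound om a A -> l2bound om b B ->
  l2bound om (fun k => a k - b k) (2 * A + 2 * B).
Proof. by move=> o ha hb; apply: l2boundD => //; exact: l2boundN. Qed.

Lemma l2boundZ om a A (c : R[i]) : l2bound om a A ->
  l2bound om (fun k => c * a k) (nsq c * A).
Proof.
move=> h r ur; under eq_bigr do rewrite nsqM mulrCA.
by rewrite -mulr_sumr ler_wpM2l ?nsq_ge0 ?h.
Qed.

Definition window (L : nat) : seq int := [seq i%:Z - L%:Z | i <- iota 0 L.*2.+1].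

Lemma window_uniq L : uniq (window L).
Proof. by rewrite map_inj_uniq ?iota_uniq// => x y /addIr []. Qed.

Lemma mem_window L k : (k \in window L) = (`|k| <= L%:Z).
Proof.
apply/mapP/idP => [[x]|kL].
  rewrite mem_iota add0n ltnS => /andP[_ iL] ->.
  by rewrite ler_norml lerBrDr addNr lez_nat leq0n lerBlDr -PoszD addnn lez_nat iL.
exists (absz (k + L%:Z)); last first.
  by rewrite gez0_abs ?addrK//; move: kL; rewrite ler_norml lerNl -subr_ge0 opprK addrC => /andP[].
rewrite mem_iota add0n ltnS /=.
rewrite -lez_nat gez0_abs; last by move: kL; rewrite ler_norml lerNl -subr_ge0 opprK addrC => /andP[].
by move: kL; rewrite ler_norml -addnn PoszD lerD2r => /andP[].
Qed.

Lemma sum_subseq r s (P : pred int) (F : int -> R) : uniq r -> uniq s ->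
  {subset r <= s} -> (forall k, 0 <= F k) ->
  \sum_(k <- r | P k) F k <= \sum_(k <- s) F k.
Proof.
move=> ur us rs F0; rewrite -big_filter.
have uf := filter_uniq P ur.
have fs : {subset [seq i <- r | P i] <= s}.
  by move=> x; rewrite mem_filter => /andP[_ /rs].
have pf : perm_eq [seq i <- r | P i] [seq i <- s | i \in [seq i <- r | P i]].
  apply: uniq_perm => //; first exact: (filter_uniq _ us).
  by move=> x; rewrite [RHS]mem_filter; apply/idP/andP => [h|[]//]; split=> //; exact: fs.
have ps : perm_eq s ([seq i <- r | P i] ++ [seq i <- s | i \notin [seq i <- r | P i]]).
  rewrite perm_sym; apply: perm_trans (perm_cat pf (perm_refl _)) _.
  by rewrite perm_filterC.
rewrite (perm_big _ ps)/=.
by rewrite big_cat/= lerDl sumr_ge0.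
Qed.

Lemma inv_square_sum (n : nat) :
  \sum_(0 <= i < n.+1) ((i.+1%:R : R) ^+ 2)^-1 <= 2 - (n.+1%:R)^-1.
Proof.
elim: n => [|n IH]; first by rewrite big_nat1 expr1n invr1; lra.
rewrite big_nat_recr//=; apply: le_trans (lerD IH (lexx _)) _.
rewrite -[n.+2]addn1 natrD; set x : R := n.+1%:R.
have x0 : 0 < x by rewrite ltr0n.
have x1 : 0 < x + 1 by lra.
have x0' : x != 0 by rewrite gt_eqF.
have x1' : x + 1 != 0 by rewrite gt_eqF.
rewrite -subr_ge0.
have -> : 2 - (x + 1)^-1 - (2 - x^-1 + ((x + 1) ^+ 2)^-1) =
    (x * (x + 1) ^+ 2)^-1.
  by clearbody x; field; rewrite ?x0' ?x1'.
by rewrite invr_ge0 ltW// mulr_gt0// exprn_gt0.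
Qed.

Lemma jb_sum r : uniq r -> \sum_(k <- r) (jb k ^+ 2)^-1 <= 4.
Proof.
move=> ur; pose L := \max_(k <- r) `|k|%N.
have rL : {subset r <= window L}.
  move=> k kr; rewrite mem_window -abszE lez_nat.
  by rewrite /L (big_rem k)//= leq_maxl.
have p k : 0 <= (jb k ^+ 2)^-1 by rewrite invr_ge0 sqr_ge0.
apply: le_trans (sum_subseq xpredT ur (window_uniq _) rL p) _.
(* The window splits into its [L] negative entries, read backwards, and its [L + 1] nonnegative
   ones. Each half is dominated by the sum of the inverse squares, hence by 2. *)
rewrite /window -addnn -addnS iotaD map_cat big_cat !big_map add0n.
have h : \sum_(0 <= i < L.+1) ((i.+1%:R : R) ^+ 2)^-1 <= 2.
  by apply: le_trans (inv_square_sum L) _; rewrite lerBlDr lerDl invr_ge0 ler0n.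
rewrite (_ : 4 = 2 + 2); last by ring.
apply: lerD.
  rewrite (_ : iota 0 L = index_iota 0 L); last by rewrite /index_iota subn0.
  rewrite big_nat_rev/= add0n.
  apply: le_trans h; rewrite big_nat_recr//= -[leLHS]addr0 lerD ?invr_ge0 ?sqr_ge0//.
  rewrite big_nat_cond [leRHS]big_nat_cond; apply: ler_sum => i /andP[/andP[_ iL] _].
  rewrite lef_pV2 ?posrE ?exprn_gt0 ?jb_gt0//.
  rewrite ler_pXn2r ?nnegrE ?ler0n ?(ltW (jb_gt0 _))//.
  rewrite /jb distrC ger0_norm subzn ?leq_subr// subKn// -pmulrn.
  by rewrite lerDr.
apply: le_trans h; move: (iotaDl L 0 L.+1); rewrite addn0 => ->; rewrite big_map.
rewrite /index_iota subn0 le_eqVlt; apply/orP; left; apply/eqP.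
apply: eq_bigr => i _; congr ((_ ^+ _)^-1).
by rewrite /jb PoszD addrAC subrr add0r ger0_norm// -pmulrn -natr1 addrC.
Qed.

Lemma jb_sum_inj r (P : pred int) (h : int -> int) : injective h -> uniq r ->
  \sum_(k <- r | P k) (jb (h k) ^+ 2)^-1 <= 4.
Proof.
move=> hi ur; rewrite -big_filter -(big_map h xpredT (fun k => (jb k ^+ 2)^-1)).
by apply: jb_sum; rewrite map_inj_uniq ?filter_uniq.
Qed.

(* Cauchy-Schwarz in [j] for each [k], then the sum over [k] for fixed [j]. *)
Lemma bilinear_bound (r s : seq int) (P : int -> pred int)
    (h : int -> int -> int) (mu : int -> int -> R) (W al be : int -> R)
    x y (A B C : R) : uniq r -> uniq s -> (forall j, injective (h ^~ j)) ->
  (forall k, 0 <= W k) -> (forall k, 0 < al k) -> (forall k, 0 < be k) ->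
  l2bound al x A -> l2bound be y B ->
  (forall k, \sum_(j <- s | P k j) W k * mu k j ^+ 2 / (al (h k j) * be j) <= C) ->
  \sum_(k <- r) W k * nsq (\sum_(j <- s | P k j) (mu k j)%:C%C * (x (h k j) * y j))
    <= C * A * B.
Proof.
move=> ur us hi W0 al0 be0 xA yB HC.
have C0 : 0 <= C.
  apply: le_trans (HC 0); apply: sumr_ge0 => j _.
  by rewrite divr_ge0// mulr_ge0 ?sqr_ge0// ltW.
apply: (@le_trans _ _ (\sum_(k <- r) C *
    \sum_(j <- s) (al (h k j) * nsq (x (h k j)) * (be j * nsq (y j))))).
  apply: ler_sum => k _.
  have om0 j : P k j -> 0 < al (h k j) * be j by move=> _; rewrite mulr_gt0.
  apply: le_trans (ler_wpM2l (W0 k) (nsq_sum_le _ _ _ om0)) _.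
  rewrite mulrA ler_pM//.
  - by rewrite mulr_ge0// sumr_ge0// => j _; rewrite divr_ge0 ?sqr_ge0// mulr_ge0 ?ltW.
  - by apply: sumr_ge0 => j _; rewrite mulr_ge0 ?nsq_ge0// mulr_ge0 ?ltW.
  - by rewrite mulr_sumr; under eq_bigr do rewrite mulrA; exact: HC.
  - under eq_bigr do rewrite nsqM mulrACA.
    apply: sum_subseq => // j.
    by apply: mulr_ge0; rewrite mulr_ge0 ?nsq_ge0// ltW.
rewrite -mulr_sumr -mulrA ler_wpM2l// exchange_big/=.
under eq_bigr do rewrite -mulr_suml.
apply: (@le_trans _ _ (\sum_(j <- s) A * (be j * nsq (y j)))); last first.
  by rewrite -mulr_sumr ler_wpM2l ?(l2bound_ge0 xA)// yB.
apply: ler_sum => j _; rewrite ler_wpM2r ?mulr_ge0 ?nsq_ge0 ?(ltW (be0 _))//.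
by have := xA [seq h k j | k <- r]; rewrite big_map (map_inj_uniq (hi j)) => /(_ ur).
Qed.

End WeightedSums.

(** * Bilinear and trilinear estimates *)

Section ComplexCauchySchwarz.
Context {R : realType}.

(** The weighted inequality with weight [1 / nsq (a j)]; indices with [a j = 0] are removed
    beforehand because the weights must be positive. *)
Lemma nsq_cs I (s : seq I) (P : pred I) (a b : I -> R[i]) :
  nsq (\sum_(j <- s | P j) a j * b j) <=
  (\sum_(j <- s | P j) nsq (a j)) * (\sum_(j <- s | P j) nsq (b j)).
Proof.
rewrite (bigID (fun j => a j == 0))/= big1 ?add0r; last first.
  by move=> j /andP[_ /eqP ->]; rewrite mul0r.
have o j : P j && (a j != 0) -> 0 < (nsq (a j))^-1.
  move=> /andP[_ aj]; rewrite invr_gt0 lt_neqAle nsq_ge0 andbT eq_sym.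
  by apply: contra aj => /eqP/nsq_eq0 ->.
have := nsq_sum_le s (fun=> 1) (fun j => a j * b j) o.
under [X in nsq X]eq_bigr do rewrite rmorph1 mul1r.
move/le_trans; apply.
have S (F : I -> R) : (forall j, 0 <= F j) ->
    \sum_(j <- s | P j && (a j != 0)) F j <= \sum_(j <- s | P j) F j.
  move=> F0; rewrite [leRHS](bigID (fun j => a j == 0))/= lerDr.
  by apply: sumr_ge0.
apply: ler_pM.
- by apply: sumr_ge0 => j _ /=; rewrite expr1n div1r invrK nsq_ge0.
- by apply: sumr_ge0 => j _; rewrite mulr_ge0 ?invr_ge0 ?nsq_ge0.
- have -> : \sum_(j <- s | P j && (a j != 0)) 1 ^+ 2 / (nsq (a j))^-1 =
      \sum_(j <- s | P j && (a j != 0)) nsq (a j).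
    by apply: eq_bigr => j _; rewrite expr1n div1r invrK.
  by apply: S => j; exact: nsq_ge0.
- have -> : \sum_(j <- s | P j && (a j != 0)) (nsq (a j))^-1 * nsq (a j * b j) =
      \sum_(j <- s | P j && (a j != 0)) nsq (b j).
    apply: eq_bigr => j Pj; rewrite nsqM mulKf//.
    by have := o _ Pj; rewrite invr_gt0 => /gt_eqF ->.
  by apply: S => j; exact: nsq_ge0.
Qed.

End ComplexCauchySchwarz.

Section Kernels.
Context {R : realType}.
Implicit Types (a b c f g x y : int -> R[i]) (r s : seq int) (k j m sg : int).
Local Notation jb := (@jb R).

Lemma jbD k j : jb (k + j) <= jb k + jb j - 1.
Proof.
rewrite /jb; have : `|k + j|%:~R <= `|k|%:~R + `|j|%:~R :> R.
  by rewrite -intrD ler_int ler_normD.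
by lra.
Qed.

Lemma jb_le2 k : k != 0 -> jb k <= 2 * `|k%:~R|.
Proof.
move=> k0; rewrite /jb -intr_norm; have : 1 <= `|k|%:~R :> R.
  by rewrite -[1]/(1%:~R) ler_int -gtz0_ge1 normr_gt0.
by lra.
Qed.

(** Each frequency is controlled by the resonance factor [k + j - sg] and one more quantity: here
    because [k = (k + j - sg) - (j - sg)], in [jb_resd] because [2 k - sg] is the sum of the two
    factors [k + j - sg] and [k - j]. *)
Lemma jb_resl sg k j : `|sg| <= 1 -> jb k <= jb (k + j - sg) + jb j.
Proof.
move=> s1; have := jbD (k + j - sg) (sg - j); have := jbD sg (- j).
rewrite jbN subrKA addrK.
have : jb sg <= 2 by rewrite /jb -[2]/(1 + 1%:~R) lerD2l ler_int.
lra.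
Qed.

Lemma jb_resr sg k j : `|sg| <= 1 -> jb j <= jb (k + j - sg) + jb k.
Proof. by rewrite (addrC k); exact: jb_resl. Qed.

Lemma jb_resd sg k j : `|sg| <= 1 -> jb k <= jb (k + j - sg) + jb (k - j).
Proof.
move=> s1; have := jbD (k + j - sg) (k - j); have := jbD (k + k - sg) sg.
rewrite subrK (_ : k + j - sg + (k - j) = k + k - sg); last by ring.
have -> : jb (k + k) = 2 * jb k - 1.
  by rewrite /jb -mulr2n normrMn mulr2n intrD; lra.
have : jb sg <= 2 by rewrite /jb -[2]/(1 + 1%:~R) lerD2l ler_int.
have := @jb_ge1 R k; lra.
Qed.

Lemma jb_resd' sg k j : `|sg| <= 1 -> jb j <= jb (k + j - sg) + jb (k - j).
Proof. by rewrite (addrC k) -(jbN (k - j)) opprB; exact: jb_resd. Qed.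

Lemma inv_sqr_le k (c : R) : k != 0 -> c ^+ 2 <= 1 -> (c / k%:~R) ^+ 2 <= 4 / jb k ^+ 2.
Proof.
move=> k0 c1; have h := jb_le2 k0; have j0 := @jb_gt0 R k.
have n0 : 0 < `|k%:~R : R| by rewrite normr_gt0 intr_eq0.
rewrite exprMn exprVn -(real_normK (num_real (k%:~R : R))).
rewrite ler_pdivrMr ?exprn_gt0// mulrAC ler_pdivlMr ?exprn_gt0//.
apply: (@le_trans _ _ (1 * jb k ^+ 2)); first by rewrite ler_wpM2r ?sqr_ge0.
rewrite mul1r (_ : 4 = 2 ^+ 2); last by ring.
rewrite -exprMn ler_pXn2r ?nnegrE ?mulr_ge0 ?(ltW j0) ?(ltW n0)//.
Qed.

Lemma inv_mul_le (u v : R) : 0 < u -> 0 < v -> (u * v)^-1 <= (u ^+ 2)^-1 + (v ^+ 2)^-1.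
Proof.
move=> u0 v0; rewrite invfM -!exprVn; set p := u^-1; set q := v^-1.
have p0 : 0 < p by rewrite invr_gt0.
have q0 : 0 < q by rewrite invr_gt0.
by have := sqr_ge0 (p - q); nra.
Qed.

(** The form in which the kernel test is applied. If the weighted kernel is dominated by inverse
    squares of [jb] along maps injective in [j], each of them sums over [j] to at most 4, whatever
    [k] is. *)
Lemma bilinear_bound2 (r s : seq int) (P : int -> pred int)
    (h h1 h2 : int -> int -> int) (mu : int -> int -> R) (W al be : int -> R)
    x y (A B c1 c2 : R) : uniq r -> uniq s -> (forall j, injective (h ^~ j)) ->
  (forall k, injective (h1 k)) -> (forall k, injective (h2 k)) ->
  0 <= c1 -> 0 <= c2 ->
  (forall k, 0 <= W k) -> (forall k, 0 < al k) -> (forall k, 0 < be k) ->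
  l2bound al x A -> l2bound be y B ->
  (forall k j, P k j -> W k * mu k j ^+ 2 / (al (h k j) * be j) <=
      c1 / jb (h1 k j) ^+ 2 + c2 / jb (h2 k j) ^+ 2) ->
  \sum_(k <- r) W k * nsq (\sum_(j <- s | P k j) (mu k j)%:C%C * (x (h k j) * y j))
    <= 4 * (c1 + c2) * A * B.
Proof.
move=> ur us hi h1i h2i c10 c20 W0 al0 be0 xA yB Pb.
apply: (@bilinear_bound R _ _ _ _ _ W al be) => // k.
apply: (@le_trans _ _ (\sum_(j <- s | P k j)
   (c1 / jb (h1 k j) ^+ 2 + c2 / jb (h2 k j) ^+ 2))); first by apply: ler_sum => j; apply: Pb.
rewrite big_split/= -!mulr_sumr (mulrDr 4) (mulrC 4) (mulrC 4).
by apply: lerD; rewrite ler_wpM2l//; apply: jb_sum_inj.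
Qed.

(** Only one of the two factors of the resonance function is cut off: [k - j] is then a nonzero
    integer, so the product is already larger than [K]. *)
Definition nonres (K : nat) sg k j := (k != j) && (K%:Z < `|k + j - sg|).

Lemma nonres_neq0 K sg k j : nonres K sg k j -> (k - j != 0) && (k + j - sg != 0).
Proof.
case/andP => kj h; rewrite subr_eq0 kj/= -normr_gt0.
by apply: le_lt_trans h.
Qed.

Lemma jb_far (K : nat) k : (K%:Z < `|k|) -> K.+1%:R <= jb k.
Proof.
by move=> h; rewrite /jb -natr1 addrC lerD2l -[K%:R]/(K%:Z%:~R) ler_int ltW.
Qed.

Lemma jb_near (K : nat) k : ~~ (K%:Z < `|k|) -> jb k <= K.+1%:R.
Proof.
by rewrite -leNgt => h; rewrite /jb -natr1 addrC lerD2r -[K%:R]/(K%:Z%:~R) ler_int.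
Qed.

Lemma injDl k sg : injective (fun j => k + j - sg).
Proof. by move=> i j /addIr/addrI. Qed.
Lemma injBl k : injective (fun j => k - j).
Proof. by move=> i j /addrI/oppr_inj. Qed.
Lemma injDr (j : int) : injective (fun k => k + j). Proof. exact: addIr. Qed.
Lemma inj2 m sg : injective (fun j => j + m + j - sg).
Proof.
move=> i j /addIr; rewrite addrAC => h.
have : i *+ 2 = j *+ 2 by apply/(addIr m); rewrite h; ring.
by move/eqP; rewrite -subr_eq0 -mulrnBl mulrn_eq0/= subr_eq0 => /eqP.
Qed.

Let sqVM (p q : R) : (p * q)^-1 ^+ 2 = (1 / p) ^+ 2 * (1 / q) ^+ 2.
Proof. by rewrite !mul1r invfM exprMn. Qed.
Let one2 : (1 : R) ^+ 2 <= 1. Proof. by rewrite expr1n. Qed.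
Let one0 : forall k : int, (0 : R) < 1. Proof. by []. Qed.
Let jb0 : forall k : int, 0 <= jb k. Proof. by move=> k; rewrite ltW ?jb_gt0. Qed.

Section bounds.
Variables (r s : seq int) (ur : uniq r) (us : uniq s).
Variables (sg : int) (sg1 : `|sg| <= 1).

(** With [S = jb (k + j - sg)], the weight [jb k] is at most [S + jb j]. This leaves [4 / S^2] and
    [4 / (S jb j)], and [inv_mul_le] splits the second into inverse squares. *)
Lemma kernel_cubic k j (c : R) : k + j - sg != 0 -> c ^+ 2 <= 1 ->
  jb k * (c / (k + j - sg)%:~R) ^+ 2 / jb j <=
   4 / jb j ^+ 2 + 8 / jb (k + j - sg) ^+ 2.
Proof.
move=> s0 c1; have hs := inv_sqr_le s0 c1.
have := jb_resl k j sg1; have := @jb_gt0 R j; have := @jb_gt0 R (k + j - sg).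
move: hs; set S := jb (k + j - sg); set y := jb j; set x := jb k.
set q := (c / _) ^+ 2 => hs S0 y0 xSy.
have i1 := inv_mul_le y0 S0.
apply: (@le_trans _ _ ((S + y) * (4 / S ^+ 2) / y)).
  rewrite ler_wpM2r ?invr_ge0 ?(ltW y0)// ler_pM ?sqr_ge0//; exact: jb0.
rewrite (_ : (S + y) * (4 / S ^+ 2) / y = 4 * (y * S)^-1 + 4 / S ^+ 2); last first.
  by field; rewrite !gt_eqF.
by lra.
Qed.

(** This term appears when the wave forcing replaces the time derivative of the half-wave. The
    forcing carries [sg (k - j)], which cancels one resonance factor; only [k + j - sg] remains in
    the denominator, with [c = sg]. *)
Lemma bound_S_cubic1 K g b (A B : R) (c : R) : c ^+ 2 <= 1 ->
  l2bound (fun=> 1) g A -> l2bound jb b B ->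
  \sum_(k <- r) jb k * nsq (\sum_(j <- s | nonres K sg k j)
     (c / (k + j - sg)%:~R)%:C%C * (g (k - j) * b j)) <= 48 * A * B.
Proof.
move=> c1 gA bB; rewrite (_ : 48 = 4 * (4 + 8)); last by ring.
apply: (@bilinear_bound2 _ _ _ (fun k j => k - j) (fun k j => j)
   (fun k j => k + j - sg) (fun k j => c / (k + j - sg)%:~R) jb (fun=> 1) jb) => //.
- by move=> j; exact: injDr.
- by move=> k i j.
- by move=> k; exact: injDl.
- exact: jb_gt0.
- move=> k j /nonres_neq0/andP[_ h]; rewrite mul1r.
  by apply: kernel_cubic.
Qed.

(** Here the Schrodinger forcing replaces the time derivative of [u], so [f] lies only in [h^(-1/2)]
    while the result is measured in [h^(1/2)]. Both [jb k] and [jb j] are at most the sum of the two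
    resonance weights, and the two squared denominators absorb the square of that sum. *)
Lemma bound_S_cubic2 K a f (A B : R) :
  l2bound (fun=> 1) a A -> l2bound (fun k => (jb k)^-1) f B ->
  \sum_(k <- r) jb k * nsq (\sum_(j <- s | nonres K sg k j)
     (((k - j)%:~R * (k + j - sg)%:~R)^-1)%:C%C * (a (k - j) * f j)) <= 384 * A * B.
Proof.
move=> aA fB; rewrite (_ : 384 = 4 * (48 + 48)); last by ring.
apply: (@bilinear_bound2 _ _ _ (fun k j => k - j) (fun k j => k - j)
   (fun k j => k + j - sg) (fun k j => ((k - j)%:~R * (k + j - sg)%:~R)^-1)
   jb (fun=> 1) (fun k => (jb k)^-1)) => //.
- by move=> j; exact: injDr.
- by move=> k; exact: injBl.
- by move=> k; exact: injDl.
- exact: jbV_gt0.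
- move=> k j /nonres_neq0/andP[kj h]; rewrite mul1r invrK.
  have h1 := inv_sqr_le kj one2; have h2 := inv_sqr_le h one2.
  have := jb_resd k j sg1; have := jb_resd' k j sg1.
  have := @jb_gt0 R j; have := @jb_gt0 R k.
  have := @jb_gt0 R (k + j - sg); have := @jb_gt0 R (k - j).
  rewrite sqVM; move: h1 h2.
  set S := jb (k + j - sg); set m := jb (k - j).
  set y := jb j; set x := jb k => h1 h2 m0 S0 x0 y0 h3 h4.
  apply: (@le_trans _ _ ((S + m) * (4 / m ^+ 2 * (4 / S ^+ 2)) * (S + m))).
    have pq : (1 / (k - j)%:~R) ^+ 2 * (1 / (k + j - sg)%:~R) ^+ 2 <=
        4 / m ^+ 2 * (4 / S ^+ 2) by apply: ler_pM => //; exact: sqr_ge0.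
    have pq0 : 0 <= (1 / (k - j)%:~R) ^+ 2 * (1 / (k + j - sg)%:~R : R) ^+ 2.
      by rewrite mulr_ge0 ?sqr_ge0.
    apply: ler_pM => //; [by rewrite mulr_ge0// ltW|exact: ltW|].
    by apply: ler_pM => //; exact: ltW.
  have -> : (S + m) * (4 / m ^+ 2 * (4 / S ^+ 2)) * (S + m) =
      16 / m ^+ 2 + 16 / S ^+ 2 + 32 * (m * S)^-1 by field; rewrite !gt_eqF.
  have := inv_mul_le m0 S0; lra.
Qed.

(** The ratio [jb k / jb j] costs only [2 S], against a denominator of order [S^2]. The spare factor
    [1 / S] is at most [1 / (K + 1)], and this is the smallness. *)
Lemma bound_S_boundary K a b (A B : R) :
  l2bound (fun=> 1) a A -> l2bound jb b B ->
  \sum_(k <- r) jb k * nsq (\sum_(j <- s | nonres K sg k j)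
     (((k - j)%:~R * (k + j - sg)%:~R)^-1)%:C%C * (a (k - j) * b j)) <= 128 / K.+1%:R * A * B.
Proof.
move=> aA bB; have K0 : 0 < (K.+1%:R : R) by rewrite ltr0n.
rewrite (_ : 128 / _ = 4 * (32 / K.+1%:R + 0)); last by rewrite addr0; field; rewrite gt_eqF.
apply: (@bilinear_bound2 _ _ _ (fun k j => k - j) (fun k j => k - j)
   (fun k j => k - j) (fun k j => ((k - j)%:~R * (k + j - sg)%:~R)^-1)
   jb (fun=> 1) jb) => //.
- by move=> j; exact: injDr.
- by move=> k; exact: injBl.
- by move=> k; exact: injBl.
- exact: jb_gt0.
- move=> k j /[dup] /andP[_ /jb_far far] /nonres_neq0/andP[kj h]; rewrite mul1r mul0r addr0.
  have h1 := inv_sqr_le kj one2.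
  have h2 := kernel_cubic h one2.
  have h3 := inv_sqr_le h one2.
  have := jb_resl k j sg1; have := @jb_ge1 R j.
  have := @jb_gt0 R (k - j); have := @jb_gt0 R k.
  rewrite sqVM; move: h1 h2 h3 far.
  set S := jb (k + j - sg); set m := jb (k - j); set y := jb j; set x := jb k.
  set p := (_ / (k - j)%:~R) ^+ 2; set q := (_ / (k + j - sg)%:~R) ^+ 2.
  move=> h1 _ h3 far x0 m0 y1 xSy.
  have S0 : 0 < S by apply: lt_le_trans far.
  have S1 : 1 <= S by apply: le_trans far; rewrite ler1n.
  have y0 : 0 < y by lra.
  have xyS : x / y <= 2 * S by rewrite ler_pdivrMr//; nra.
  rewrite (_ : x * (p * q) / y = x / y * p * q); last by field; rewrite gt_eqF.
  apply: (@le_trans _ _ (2 * S * (4 / m ^+ 2) * (4 / S ^+ 2))).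
    have xy0 : 0 <= x / y by rewrite divr_ge0// ltW.
    have p0 : 0 <= p by exact: sqr_ge0.
    have q0 : 0 <= q by exact: sqr_ge0.
    by apply: ler_pM => //; [exact: mulr_ge0|apply: ler_pM].
  have -> : 2 * S * (4 / m ^+ 2) * (4 / S ^+ 2) = 32 / m ^+ 2 / S by field; rewrite !gt_eqF.
  rewrite -mulrA (mulrC _ S^-1) mulrA ler_wpM2r ?invr_ge0 ?sqr_ge0// ler_wpM2l//.
  by rewrite lef_pV2 ?posrE.
Qed.

(** No denominator helps here, but the interactions are few. The diagonal [k = j] is a single term,
    accounted for by the summand 1. Otherwise [jb k / jb j <= K + 2], and the factor
    [(K + 1)^2 / S^2 >= 1] is inserted to make the kernel summable. *)
Lemma bound_S_res K a b (A B : R) :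
  l2bound (fun=> 1) a A -> l2bound jb b B ->
  \sum_(k <- r) jb k * nsq (\sum_(j <- s | ~~ nonres K sg k j)
     (1 : R)%:C%C * (a (k - j) * b j)) <= 4 * (K.+2%:R * K.+1%:R ^+ 2 + 1) * A * B.
Proof.
move=> aA bB; have K0 : 0 <= (K.+1%:R : R) by [].
apply: (@bilinear_bound2 _ _ _ (fun k j => k - j) (fun k j => k + j - sg)
   (fun k j => k - j) (fun k j => 1) jb (fun=> 1) jb) => //.
- by move=> j; exact: injDr.
- by move=> k; exact: injDl.
- by move=> k; exact: injBl.
- exact: jb_gt0.
- move=> k j; rewrite negb_and negbK expr1n mul1r mulr1 => /orP[/eqP <-|/jb_near near].
    rewrite subrr divff ?gt_eqF ?jb_gt0// /jb normr0 addr0 expr1n divr1 lerDr.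
    by rewrite mulr_ge0 ?invr_ge0 ?sqr_ge0// mulr_ge0 ?sqr_ge0.
  have := jb_resl k j sg1; have := @jb_ge1 R j; have := @jb_gt0 R (k + j - sg).
  move: near; set S := jb (k + j - sg); set m := jb (k - j); set y := jb j.
  set x := jb k => near S0 y1 xSy.
  have y0 : 0 < y by lra.
  have xy : x / y <= K.+2%:R by rewrite ler_pdivrMr// -natr1; nra.
  apply: (le_trans xy); rewrite -[leLHS]addr0 lerD//; last by rewrite divr_ge0 ?sqr_ge0.
  rewrite -mulrA ler_peMr// ler_pdivlMr ?exprn_gt0// mul1r.
  by rewrite ler_pXn2r ?nnegrE ?(ltW S0).
Qed.

(** In the wave estimates the output frequency is [m] and the inputs are [j + m] and [j]. The
    resonance function is [m (2 j + m - sg)], and its factor [m] is cancelled by the one in the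
    forcing, so a single denominator is left to recover the derivative lost by [f]. *)
Lemma bound_W_cubic1 K f c (A B e : R) : e ^+ 2 <= 1 ->
  l2bound (fun k => (jb k)^-1) f A -> l2bound jb c B ->
  \sum_(m <- r) 1 * nsq (\sum_(j <- s | K%:Z < `|j + m + j - sg|)
     (e / (j + m + j - sg)%:~R)%:C%C * (f (j + m) * c j)) <= 48 * A * B.
Proof.
move=> e1 fA cB; rewrite (_ : 48 = 4 * (4 + 8)); last by ring.
apply: (@bilinear_bound2 _ _ _ (fun m j => j + m) (fun m j => j)
   (fun m j => j + m + j - sg) (fun m j => e / (j + m + j - sg)%:~R)
   (fun=> 1) (fun k => (jb k)^-1) jb) => //.
- by move=> m i j.
- by move=> m; exact: inj2.
- exact: jbV_gt0.
- exact: jb_gt0.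
- move=> m j h; rewrite mul1r invfM invrK mulrA [_ * jb _]mulrC; apply: kernel_cubic => //.
  by rewrite -normr_gt0; apply: le_lt_trans h.
Qed.

Lemma bound_W_cubic2 K f c (A B e : R) : e ^+ 2 <= 1 ->
  l2bound jb f A -> l2bound (fun k => (jb k)^-1) c B ->
  \sum_(m <- r) 1 * nsq (\sum_(j <- s | K%:Z < `|j + m + j - sg|)
     (e / (j + m + j - sg)%:~R)%:C%C * (f (j + m) * c j)) <= 48 * A * B.
Proof.
move=> e1 fA cB; rewrite (_ : 48 = 4 * (4 + 8)); last by ring.
apply: (@bilinear_bound2 _ _ _ (fun m j => j + m) (fun m j => j + m)
   (fun m j => j + m + j - sg) (fun m j => e / (j + m + j - sg)%:~R)
   (fun=> 1) jb (fun k => (jb k)^-1)) => //.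
- by move=> m; exact: addIr.
- by move=> m; exact: inj2.
- exact: jb_gt0.
- exact: jbV_gt0.
- move=> m j h; rewrite mul1r invfM invrK mulrA mulrAC [_ * jb _]mulrC.
  rewrite (addrC (j + m) j); apply: kernel_cubic => //.
  by rewrite (addrC j (j + m)) -normr_gt0; apply: le_lt_trans h.
Qed.

(** The input weights alone already give the summable kernel [1 / (jb (j + m) jb j)], so the
    resonance denominator is free to provide the smallness. *)
Lemma bound_W_boundary K b c (A B e : R) : e ^+ 2 <= 1 ->
  l2bound jb b A -> l2bound jb c B ->
  \sum_(m <- r) 1 * nsq (\sum_(j <- s | K%:Z < `|j + m + j - sg|)
     (e / (j + m + j - sg)%:~R)%:C%C * (b (j + m) * c j)) <= 32 / K.+1%:R * A * B.
Proof.
move=> e1 bA cB; have K0 : 0 < (K.+1%:R : R) by rewrite ltr0n.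
have K1 : 1 <= (K.+1%:R : R) by rewrite ler1n.
rewrite (_ : 32 / _ = 4 * (4 / K.+1%:R + 4 / K.+1%:R)); last by field; rewrite gt_eqF.
apply: (@bilinear_bound2 _ _ _ (fun m j => j + m) (fun m j => j)
   (fun m j => j + m) (fun m j => e / (j + m + j - sg)%:~R)
   (fun=> 1) jb jb) => //.
- by move=> m i j.
- by move=> m; exact: addIr.
- exact: jb_gt0.
- exact: jb_gt0.
- move=> m j h; rewrite mul1r.
  have s0 : j + m + j - sg != 0 by rewrite -normr_gt0; apply: le_lt_trans h.
  have h1 := inv_sqr_le s0 e1; have far := jb_far h.
  have := @jb_gt0 R j; have := @jb_gt0 R (j + m).
  move: h1 far; set S := jb (j + m + j - sg); set x := jb (j + m); set y := jb j.
  move=> h1 far x0 y0; have i1 := inv_mul_le y0 x0.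
  have S0 : 0 < S by apply: lt_le_trans far.
  rewrite -mulrDr; apply: ler_pM; rewrite ?sqr_ge0//.
  + by rewrite invr_ge0 mulr_ge0 ?ltW.
  + apply: (le_trans h1); rewrite ler_wpM2l// lef_pV2 ?posrE ?exprn_gt0//.
    by apply: (le_trans far); rewrite expr2; nra.
  + by rewrite (mulrC x) (le_trans i1)// addrC.
Qed.

(** The multiplier [m] is harmless near resonance: there [j + m] and [-j] differ by a bounded
    amount, so [jb (j + m)] and [jb j] are comparable up to a factor [K + 2], and [m^2] is at most a
    multiple of their product. *)
Lemma bound_W_res K b c (A B : R) :
  l2bound jb b A -> l2bound jb c B ->
  \sum_(m <- r) 1 * nsq (\sum_(j <- s | ~~ (K%:Z < `|j + m + j - sg|))
     (m%:~R : R)%:C%C * (b (j + m) * c j)) <=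
   4 * (2 * K.+3%:R * K.+1%:R ^+ 2) * A * B.
Proof.
move=> bA cB.
rewrite (_ : 4 * _ = 4 * (2 * K.+3%:R * K.+1%:R ^+ 2 + 0)); last by rewrite addr0.
apply: (@bilinear_bound2 _ _ _ (fun m j => j + m) (fun m j => j + m + j - sg)
   (fun m j => j + m) (fun m j => m%:~R) (fun=> 1) jb jb) => //.
- by move=> m; exact: inj2.
- by move=> m; exact: addIr.
- exact: jb_gt0.
- exact: jb_gt0.
- move=> m j /jb_near near; rewrite mul1r mul0r addr0.
  have := jb_resl (j + m) j sg1; have := jb_resr (j + m) j sg1.
  have := @jb_ge1 R j; have := @jb_ge1 R (j + m); have := @jb_gt0 R (j + m + j - sg).
  have mxy : m%:~R ^+ 2 <= (jb (j + m) + jb j) ^+ 2.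
    have h0 : `|m%:~R : R| <= jb (j + m) + jb j.
      have := jbD (j + m) (- j); rewrite jbN (addrC j m) addrK {1}/jb -intr_norm; lra.
    rewrite -(real_normK (num_real (m%:~R : R))) ler_pXn2r ?nnegrE//.
    by rewrite addr_ge0 ?jb0.
  move: near mxy; set S := jb (j + m + j - sg); set x := jb (j + m); set y := jb j.
  move=> near mxy S0 x1 y1 h1 h2.
  have x0 : 0 < x by lra.
  have y0 : 0 < y by lra.
  apply: (@le_trans _ _ (2 * K.+3%:R)); last first.
    rewrite -mulrA ler_peMr// ler_pdivlMr ?exprn_gt0// mul1r.
    by rewrite ler_pXn2r ?nnegrE ?(ltW S0).
  (* With [k = K + 1], comparability gives [x^2 <= (k + 1) x y] and [y^2 <= (k + 1) x y], whence
     [(x + y)^2 <= 2 (k + 2) x y]; this is the factor [K + 3]. *)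
  rewrite ler_pdivrMr ?mulr_gt0//; apply: (le_trans mxy).
  rewrite (_ : K.+3%:R = K.+1%:R + 2 :> R); last by rewrite -natrD addn2.
  move: near h1 h2; set k := K.+1%:R => near h1 h2.
  have a1 : x <= (k + 1) * y by nra.
  have a2 : y <= (k + 1) * x by nra.
  nra.
Qed.

Lemma bound_G b c (A B : R) : l2bound jb b A -> l2bound jb c B ->
  \sum_(m <- r) 1 * nsq (\sum_(j <- s) (1 : R)%:C%C * (b (j + m) * c j)) <= 8 * A * B.
Proof.
move=> bA cB; rewrite (_ : 8 = 4 * (1 + 1)); last by ring.
apply: (@bilinear_bound2 _ _ _ (fun m j => j + m) (fun m j => j)
   (fun m j => j + m) (fun m j => 1) (fun=> 1) jb jb) => //.
- by move=> m i j.
- by move=> m; exact: addIr.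
- exact: jb_gt0.
- exact: jb_gt0.
- move=> m j _; rewrite expr1n !mul1r (mulrC (jb _)); apply: inv_mul_le; exact: jb_gt0.
Qed.

(* The weight (1+|k|)^-1 is exactly critical for the kernel test, which fails by a logarithm; the
   regions |j| <= |k| and |j| > |k| are therefore summed in opposite orders. *)
Lemma bound_F a b (A B : R) : l2bound (fun=> 1) a A -> l2bound jb b B ->
  \sum_(k <- r) (jb k)^-1 * nsq (\sum_(j <- s) a (k - j) * b j) <= 16 * A * B.
Proof.
move=> aA bB.
have A0 := l2bound_ge0 aA; have B0 := l2bound_ge0 bB.
have V0 k : 0 <= (jb k)^-1 by rewrite ltW ?jbV_gt0.
apply: (@le_trans _ _ (\sum_(k <- r) (
   2 * ((jb k)^-1 * nsq (\sum_(j <- s | jb j <= jb k) (1 : R)%:C%C * (a (k - j) * b j))) +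
   2 * ((jb k)^-1 * nsq (\sum_(j <- s | ~~ (jb j <= jb k)) (1 : R)%:C%C * (a (k - j) * b j)))))).
  apply: ler_sum => k _; rewrite (bigID (fun j => jb j <= jb k))/=.
  under [X in nsq (X + _)]eq_bigr do rewrite -[_ * _]mul1r -[1](rmorph1 (real_complex R)).
  under [X in nsq (_ + X)]eq_bigr do rewrite -[_ * _]mul1r -[1](rmorph1 (real_complex R)).
  by apply: le_trans (ler_wpM2l (V0 k) (nsqD_le _ _)) _; rewrite mulrDr !(mulrCA _ 2).
rewrite big_split/= -!mulr_sumr.
suff [h1 h2] : (\sum_(k <- r) (jb k)^-1 * nsq (\sum_(j <- s | jb j <= jb k)
      (1 : R)%:C%C * (a (k - j) * b j)) <= 4 * (1 + 0) * A * B) /\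
    (\sum_(k <- r) (jb k)^-1 * nsq (\sum_(j <- s | ~~ (jb j <= jb k))
      (1 : R)%:C%C * (a (k - j) * b j)) <= 4 * A * B) by lra.
split.
  apply: (@bilinear_bound2 _ _ _ (fun k j => k - j) (fun k j => j)
    (fun k j => k - j) (fun k j => 1) (fun k => (jb k)^-1) (fun=> 1) jb) => //.
  - by move=> j; exact: injDr.
  - by move=> k i j.
  - by move=> k; exact: injBl.
  - exact: jb_gt0.
  - move=> k j jk; rewrite expr1n !mul1r mulr1 mul0r addr0 expr2 invfM.
    by rewrite ler_wpM2r// lef_pV2 ?posrE ?jb_gt0.
apply: (@le_trans _ _ (\sum_(k <- r) \sum_(j <- s | ~~ (jb j <= jb k))
    (A * ((jb k ^+ 2)^-1 * (jb j * nsq (b j)))))).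
  apply: ler_sum => k _; under [X in nsq X]eq_bigr do rewrite rmorph1 mul1r.
  apply: le_trans (ler_wpM2l (V0 k) (nsq_cs _ _ _ _)) _.
  rewrite mulrCA -[leRHS]mulr_sumr; apply: ler_pM.
  - by apply: sumr_ge0 => j _; exact: nsq_ge0.
  - by rewrite mulr_ge0// sumr_ge0// => j _; exact: nsq_ge0.
  - apply: (@le_trans _ _ (\sum_(j <- s) nsq (a (k - j)))).
      by apply: sum_subseq => // j; exact: nsq_ge0.
    have := aA [seq k - j | j <- s]; rewrite big_map (map_inj_uniq (@injBl k)) => /(_ us).
    by under eq_bigr do rewrite mul1r.
  rewrite mulr_sumr; apply: ler_sum => j; rewrite -ltNge => /ltW kj.
  rewrite mulrA ler_wpM2r ?nsq_ge0// expr2 invfM -mulrA ler_peMr//.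
  by rewrite mulrC ler_pdivlMr ?jb_gt0// mul1r.
under eq_bigr do rewrite -mulr_sumr.
rewrite -mulr_sumr (_ : 4 * A * B = A * (4 * B)); last by ring.
rewrite ler_wpM2l//; apply: (@le_trans _ _ (\sum_(k <- r) (jb k ^+ 2)^-1 * B)).
  apply: ler_sum => k _; rewrite -mulr_sumr ler_wpM2l ?invr_ge0 ?sqr_ge0//.
  apply: le_trans (bB _ us); apply: sum_subseq => // j.
  by rewrite mulr_ge0 ?nsq_ge0.
by rewrite -mulr_suml ler_wpM2r// jb_sum.
Qed.

End bounds.
End Kernels.

(** * An energy inequality *)

Section ComplexDerivative.
Context {R : realType}.
Implicit Types (f g : R -> R[i]) (t : R) (d e : R[i]).

Definition cder f t d :=
  is_derive t 1 (fun s => complex.Re (f s)) (complex.Re d) /\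
  is_derive t 1 (fun s => complex.Im (f s)) (complex.Im d).

Definition ccont (t0 t1 : R) f :=
  {within `[t0, t1], continuous (fun s => complex.Re (f s))} /\
  {within `[t0, t1], continuous (fun s => complex.Im (f s))}.

Lemma cder_eq f t d d' : d = d' -> cder f t d -> cder f t d'.
Proof. by move=> ->. Qed.

Lemma cderD f g t d e : cder f t d -> cder g t e -> cder (fun s => f s + g s) t (d + e).
Proof.
move=> [f1 f2] [g1 g2]; split.
  rewrite (_ : (fun s => _) = (fun s => complex.Re (f s)) + (fun s => complex.Re (g s))).
    by rewrite cReD; exact: is_deriveD.
  by apply/funext => s; rewrite cReD.
rewrite (_ : (fun s => _) = (fun s => complex.Im (f s)) + (fun s => complex.Im (g s))).
  by rewrite cImD; exact: is_deriveD.
by apply/funext => s; rewrite cImD.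
Qed.

Lemma cderN f t d : cder f t d -> cder (fun s => - f s) t (- d).
Proof.
move=> [f1 f2]; split.
  rewrite (_ : (fun s => _) = - (fun s => complex.Re (f s))).
    by rewrite cReN; exact: is_deriveN.
  by apply/funext => s; rewrite cReN.
rewrite (_ : (fun s => _) = - (fun s => complex.Im (f s))).
  by rewrite cImN; exact: is_deriveN.
by apply/funext => s; rewrite cImN.
Qed.

Lemma cderB f g t d e : cder f t d -> cder g t e -> cder (fun s => f s - g s) t (d - e).
Proof. by move=> hf hg; apply: cderD => //; exact: cderN. Qed.

Lemma cderJ f t d : cder f t d -> cder (fun s => conjc (f s)) t (conjc d).
Proof.
move=> [f1 f2]; split.
  by rewrite cReJ; under eq_fun do rewrite cReJ.
rewrite (_ : (fun s => _) = - (fun s => complex.Im (f s))).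
  by rewrite cImJ; exact: is_deriveN.
by apply/funext => s; rewrite cImJ.
Qed.

Lemma cderM f g t d e : cder f t d -> cder g t e ->
  cder (fun s => f s * g s) t (d * g t + f t * e).
Proof.
move=> [f1 f2] [g1 g2]; split.
  rewrite (_ : (fun s => _) = (fun s => complex.Re (f s)) * (fun s => complex.Re (g s))
     - (fun s => complex.Im (f s)) * (fun s => complex.Im (g s))).
    apply: is_derive_eq.
    by rewrite !ReIm /= /GRing.scale/=; ring.
  by apply/funext => s; rewrite cReM.
rewrite (_ : (fun s => _) = (fun s => complex.Re (f s)) * (fun s => complex.Im (g s))
   + (fun s => complex.Im (f s)) * (fun s => complex.Re (g s))).
  apply: is_derive_eq.
  by rewrite !ReIm /= /GRing.scale/=; ring.
by apply/funext => s; rewrite cImM.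
Qed.

Lemma cder_cst d t : cder (fun=> d) t 0.
Proof. by split => /=; apply: is_derive_cst. Qed.

Lemma cderZ f t (c : R[i]) d : cder f t d -> cder (fun s => c * f s) t (c * d).
Proof.
by move=> hf; apply: cder_eq (cderM (cder_cst c t) hf); rewrite mul0r add0r.
Qed.

Lemma cder_sum I (r : seq I) (P : pred I) (F : I -> R -> R[i]) (D : I -> R[i]) t :
  (forall i, P i -> cder (F i) t (D i)) ->
  cder (fun s => \sum_(i <- r | P i) F i s) t (\sum_(i <- r | P i) D i).
Proof.
move=> h; elim: r => [|i r IH].
  by rewrite big_nil; under eq_fun do rewrite big_nil; exact: cder_cst.
rewrite big_cons; under eq_fun do rewrite big_cons; case: ifP => // Pi.
by apply: cderD => //; exact: h.
Qed.

Lemma ccontD t0 t1 f g : ccont t0 t1 f -> ccont t0 t1 g -> ccont t0 t1 (fun s => f s + g s).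
Proof.
move=> [f1 f2] [g1 g2]; split.
  rewrite (funext (fun s => cReD (f s) (g s))) => x.
  by apply: cvgD; [exact: f1|exact: g1].
rewrite (funext (fun s => cImD (f s) (g s))) => x.
by apply: cvgD; [exact: f2|exact: g2].
Qed.

Lemma ccontN t0 t1 f : ccont t0 t1 f -> ccont t0 t1 (fun s => - f s).
Proof.
move=> [f1 f2]; split.
  by rewrite (funext (fun s => cReN (f s))) => x; apply: cvgN; exact: f1.
by rewrite (funext (fun s => cImN (f s))) => x; apply: cvgN; exact: f2.
Qed.

Lemma ccontB t0 t1 f g : ccont t0 t1 f -> ccont t0 t1 g -> ccont t0 t1 (fun s => f s - g s).
Proof. by move=> hf hg; apply: ccontD => //; exact: ccontN. Qed.

Lemma ccontJ t0 t1 f : ccont t0 t1 f -> ccont t0 t1 (fun s => conjc (f s)).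
Proof.
move=> [f1 f2]; split; first by rewrite (funext (fun s => cReJ (f s))).
by rewrite (funext (fun s => cImJ (f s))) => x; apply: cvgN; exact: f2.
Qed.

Lemma ccontM t0 t1 f g : ccont t0 t1 f -> ccont t0 t1 g -> ccont t0 t1 (fun s => f s * g s).
Proof.
move=> [f1 f2] [g1 g2]; split.
  rewrite (funext (fun s => cReM (f s) (g s))) => x.
  apply: cvgB; apply: cvgM; by [exact: f1|exact: g1|exact: f2|exact: g2].
rewrite (funext (fun s => cImM (f s) (g s))) => x.
apply: cvgD; apply: cvgM; by [exact: f1|exact: g1|exact: f2|exact: g2].
Qed.

Lemma ccont_cst t0 t1 d : ccont t0 t1 (fun=> d).
Proof. by split => x; exact: cvg_cst. Qed.

Lemma ccont_eq t0 t1 f g : f =1 g -> ccont t0 t1 f -> ccont t0 t1 g.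
Proof. by move=> /funext ->. Qed.

Lemma ccont_sum t0 t1 I (r : seq I) (P : pred I) (F : I -> R -> R[i]) :
  (forall i, P i -> ccont t0 t1 (F i)) ->
  ccont t0 t1 (fun s => \sum_(i <- r | P i) F i s).
Proof.
move=> h; elim: r => [|i r IH].
  by apply: ccont_eq (ccont_cst t0 t1 0) => s; rewrite big_nil.
case Pi : (P i); last by apply: ccont_eq IH => s; rewrite big_cons Pi.
by apply: ccont_eq (ccontD (h i Pi) IH) => s; rewrite big_cons Pi.
Qed.

Lemma ccontW t0 t1 s0 s1 f : t0 <= s0 -> s1 <= t1 -> ccont t0 t1 f -> ccont s0 s1 f.
Proof.
move=> a b [f1 f2]; have S : `[s0, s1]%classic `<=` `[t0, t1]%classic.
  by move=> x /=; rewrite !in_itv/= => /andP[? ?]; apply/andP; split; lra.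
by split; [exact: continuous_subspaceW f1|exact: continuous_subspaceW f2].
Qed.

(* The real part of [conj Z Z'] is insensitive to the skew term, so [E] grows at most like the
   remainder; its maximum is absorbed after Young's inequality. *)
Lemma energy_bound (t0 t1 : R) (r : seq int) (W lam : int -> R)
    (Z Q : int -> R -> R[i]) (rho : R) : t0 < t1 ->
  (forall k, 0 <= W k) -> (forall k, ccont t0 t1 (Z k)) ->
  (forall k t, t0 < t < t1 ->
     cder (Z k) t (- ('i%C * (lam k)%:C%C * Z k t) + Q k t)) ->
  (forall k, Z k t0 = 0) ->
  (forall t, t0 < t < t1 -> \sum_(k <- r) W k * nsq (Q k t) <= rho) ->
  forall t, t0 <= t <= t1 ->
    \sum_(k <- r) W k * nsq (Z k t) <= 4 * (t1 - t0) ^+ 2 * rho.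
Proof.
move=> t01 W0 cZ dZ Z0 Qr.
pose E t := \sum_(k <- r) W k * nsq (Z k t).
pose E' t := \sum_(k <- r) W k * (2 * complex.Re (conjc (Z k t) * Q k t)).
have cE : {within `[t0, t1], continuous E}.
  rewrite /E; elim: r {Qr E' E} => [|k r IH].
    by rewrite (funext (fun s => big_nil _ _ _ _)) => x; exact: cvg_cst.
  rewrite (funext (fun s => big_cons _ _ _ _ _ _)) => x; apply: cvgD; last exact: IH.
  apply: cvgM; first exact: cvg_cst.
  have [h1 h2] := cZ k.
  by apply: cvgD; apply: cvgM; by [exact: h1|exact: h2].
have dE t : t0 < t < t1 -> is_derive t 1 E (E' t).
  move=> tt; rewrite /E /E'; elim: r {Qr E' cE E} => [|k r IH].
    by rewrite big_nil (funext (fun s => big_nil _ _ _ _)); exact: is_derive_cst.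
  rewrite big_cons (funext (fun s => big_cons _ _ _ _ _ _)).
  rewrite (_ : (fun s => _) = (fun s => W k * nsq (Z k s)) +
     (fun s => \sum_(j <- r) W j * nsq (Z j s))); last by apply/funext.
  apply: is_deriveD.
  have [h1 h2] := dZ k t tt.
  rewrite (_ : (fun s => _) = W k *: ((fun s => complex.Re (Z k s)) * (fun s => complex.Re (Z k s)) +
     (fun s => complex.Im (Z k s)) * (fun s => complex.Im (Z k s)))); last first.
    by apply/funext => s; rewrite /nsq !expr2.
  apply: is_derive_eq.
  by rewrite !ReIm/= /GRing.scale/=; ring.
have [c cI cmax] := EVT_max (ltW t01) cE.
move: (cI); rewrite in_itv/= => /andP[c0 c1] t ht.
have rho0 : 0 <= rho.
  apply: le_trans (Qr ((t0 + t1) / 2) _); last by lra.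
  by apply: sumr_ge0 => k _; rewrite mulr_ge0 ?nsq_ge0.
have Emax s : t0 <= s <= t1 -> E s <= E c by move=> ?; apply: cmax; rewrite in_itv.
have E0 s : 0 <= E s by apply: sumr_ge0 => k _; rewrite mulr_ge0 ?nsq_ge0.
apply: le_trans (Emax _ ht) _.
have Et0 : E t0 = 0 by apply: big1 => k _; rewrite Z0 nsq0 mulr0.
move: c0; rewrite le_eqVlt => /orP[/eqP c0|c0].
  by rewrite -c0 Et0 !mulr_ge0// subr_ge0 ltW.
have cE' : {within `[t0, c], continuous E}.
  apply: continuous_subspaceW cE => x /=; rewrite !in_itv/= => /andP[? ?]; lra.
have [|x xI mvt] := @MVT R E E' t0 c c0 _ cE'.
  by move=> x; rewrite in_itv/= => /andP[a b]; apply: dE; lra.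
move: xI; rewrite in_itv/= => /andP[x0 xc].
have tx : t0 < x < t1 by lra.
set d := t1 - t0; have d0 : 0 < d by rewrite subr_gt0.
(* Young's inequality with parameter [2 d]: after multiplication by the length [d], the energy term
   contributes exactly half of the maximum [E c]. The rest is [2 d^2 rho], which doubles to the
   constant 4. *)
have E'x : E' x <= E x / (2 * d) + 2 * d * rho.
  apply: (@le_trans _ _ (E x / (2 * d) + 2 * d * \sum_(k <- r) W k * nsq (Q k x))); last first.
    by rewrite lerD2l ler_wpM2l ?Qr// mulr_ge0 ?(ltW d0).
  rewrite /E /E' mulr_suml mulr_sumr -big_split/=; apply: ler_sum => k _.
  rewrite -mulrA (mulrCA (2 * d)) -mulrDr ler_wpM2l// !ReIm /nsq.
  set a := complex.Re (Z k x); set b := complex.Im (Z k x).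
  set e := complex.Re (Q k x); set f := complex.Im (Q k x).
  rewrite -subr_ge0.
  have -> : (a ^+ 2 + b ^+ 2) / (2 * d) + 2 * d * (e ^+ 2 + f ^+ 2) -
    2 * (a * e - - b * f) = ((a - 2 * d * e) ^+ 2 + (b - 2 * d * f) ^+ 2) / (2 * d).
    by field; rewrite gt_eqF.
  by rewrite divr_ge0 ?mulr_ge0 ?(ltW d0)// addr_ge0 ?sqr_ge0.
have Ex := Emax x (ltac:(lra)); have Ec := E0 c.
have h : E c <= (E c / (2 * d) + 2 * d * rho) * d.
  rewrite -[leLHS]subr0 -Et0 mvt.
  apply: (@le_trans _ _ ((E c / (2 * d) + 2 * d * rho) * (c - t0))).
    rewrite ler_wpM2r; [by []|lra|]; apply: (le_trans E'x).
    by rewrite lerD2r ler_wpM2r// invr_ge0 mulr_ge0 ?(ltW d0).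
  rewrite ler_wpM2l ?/d; [by []| |lra].
  by rewrite addr_ge0 ?divr_ge0 ?mulr_ge0 ?(ltW d0).
have : (E c / (2 * d) + 2 * d * rho) * d = E c / 2 + 2 * d ^+ 2 * rho.
  by field; rewrite gt_eqF.
move=> h2; rewrite h2 in h; move: h; set q := d ^+ 2; nra.
Qed.

End ComplexDerivative.

(** * Normal forms *)

Section NormalForms.
Context {R : realType}.
Implicit Types (a b c f g h : int -> R[i]) (K L : nat) (sg k m : int) (t : R).
Local Notation jb := (@jb R).

Definition S_full L a b k : R[i] := \sum_(j <- window L) a (k - j) * b j.
Definition S_boundary K sg L a b k : R[i] := \sum_(j <- window L | nonres K sg k j)
  (((k - j)%:~R * (k + j - sg)%:~R)^-1 : R)%:C%C * (a (k - j) * b j).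
Definition S_nonres K sg L a b k : R[i] := \sum_(j <- window L | nonres K sg k j)
  a (k - j) * b j.
(** The explicit coefficient 1 gives the sum the shape estimated in [bound_S_res]. *)
Definition S_res K sg L a b k : R[i] := \sum_(j <- window L | ~~ nonres K sg k j)
  (1 : R)%:C%C * (a (k - j) * b j).
Definition S_cubic1 K sg L g b k : R[i] := \sum_(j <- window L | nonres K sg k j)
  (sg%:~R / (k + j - sg)%:~R : R)%:C%C * (g (k - j) * b j).

Lemma S_fullE K sg L a b k : S_full L a b k = S_nonres K sg L a b k + S_res K sg L a b k.
Proof.
rewrite /S_full (bigID (nonres K sg k))/=; congr (_ + _).
by apply: eq_bigr => j _; rewrite rmorph1 mul1r.
Qed.

(* [k^2 - j^2 - sg (k - j) = (k - j)(k + j - sg)] is the resonance function. *)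
Lemma cder_S_boundary K sg L (a b g f : int -> R -> R[i]) k t :
  (forall m, m != 0 -> cder (a m) t
     (- ('i%C * (sg * m)%:~R%:C%C * a m t) - 'i%C * (sg * m)%:~R%:C%C * g m t)) ->
  (forall j, cder (b j) t (- ('i%C * (j * j)%:~R%:C%C * b j t) - 'i%C * f j t)) ->
  cder (fun s => S_boundary K sg L (a ^~ s) (b ^~ s) k) t
   (- ('i%C * (k * k)%:~R%:C%C * S_boundary K sg L (a ^~ t) (b ^~ t) k) +
    'i%C * (S_nonres K sg L (a ^~ t) (b ^~ t) k -
     (S_cubic1 K sg L (g ^~ t) (b ^~ t) k + S_boundary K sg L (a ^~ t) (f ^~ t) k))).
Proof.
move=> da db; rewrite /S_boundary /S_nonres /S_cubic1.
apply: cder_eq; last first.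
  apply: cder_sum => j /nonres_neq0/andP[kj _].
  by apply: cderZ; apply: cderM; [exact: da|exact: db].
rewrite -big_split/= -sumrB !mulr_sumr -sumrN -big_split/=; apply: eq_bigr => j /nonres_neq0/andP[kj sj].
have kj' : (k - j)%:~R%:C%C != 0 :> R[i].
  by rewrite (rmorph_int (real_complex R)) intr_eq0.
have sj' : (k + j - sg)%:~R%:C%C != 0 :> R[i].
  by rewrite (rmorph_int (real_complex R)) intr_eq0.
move: kj' sj'; rewrite fmorphV !rmorphM/= fmorphV/= !(rmorph_int (real_complex R)).
rewrite !(intrM, intrD, mulrNz).
set x := a (k - j) t; set y := b j t; set z := g (k - j) t; set w := f j t.
move=> h1 h2; field.
by rewrite h1 h2.
Qed.

Definition W_full L b c m : R[i] := \sum_(j <- window L) b (j + m) * conjc (c j).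
Definition W_far K sg L b c m : R[i] :=
  \sum_(j <- window L | K%:Z < `|j + m + j - sg|) b (j + m) * conjc (c j).
Definition W_boundary K sg L b c m : R[i] :=
  \sum_(j <- window L | K%:Z < `|j + m + j - sg|)
  (sg%:~R / (j + m + j - sg)%:~R : R)%:C%C * (b (j + m) * conjc (c j)).
(** Unlike [W_far], this sum includes the multiplier [m]: in the far region [m] is removed by the
    normal form, whereas here it must be estimated together with the product. *)
Definition W_near K sg L b c m : R[i] :=
  \sum_(j <- window L | ~~ (K%:Z < `|j + m + j - sg|))
  (m%:~R : R)%:C%C * (b (j + m) * conjc (c j)).

Lemma W_fullE K sg L b c m :
  m%:~R%:C%C * W_full L b c m = m%:~R%:C%C * W_far K sg L b c m + W_near K sg L b c m.
Proof.
rewrite /W_full (bigID (fun j => K%:Z < `|j + m + j - sg|))/= mulrDr; congr (_ + _).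
by rewrite mulr_sumr.
Qed.

(** The phases of [b (j + m)] and [conjc (c j)] combine to [(j + m)^2 - j^2], which exceeds [sg m]
    by [m (2 j + m - sg)]. Dividing by the second factor alone therefore produces the term [sg m]
    times [W_far]. *)
Lemma cder_W_boundary K sg L (b c f h : int -> R -> R[i]) m t :
  (forall j, cder (b j) t (- ('i%C * (j * j)%:~R%:C%C * b j t) - 'i%C * f j t)) ->
  (forall j, cder (c j) t (- ('i%C * (j * j)%:~R%:C%C * c j t) - 'i%C * h j t)) ->
  cder (fun s => W_boundary K sg L (b ^~ s) (c ^~ s) m) t
   (- ('i%C * (sg * m)%:~R%:C%C * W_boundary K sg L (b ^~ t) (c ^~ t) m) +
    'i%C * (W_boundary K sg L (b ^~ t) (h ^~ t) m -
      W_boundary K sg L (f ^~ t) (c ^~ t) m -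
      (sg * m)%:~R%:C%C * W_far K sg L (b ^~ t) (c ^~ t) m)).
Proof.
move=> db dc; rewrite /W_boundary /W_far.
apply: cder_eq; last first.
  apply: cder_sum => j _.
  by apply: cderZ; apply: cderM; [exact: db|apply: cderJ; exact: dc].
rewrite [X in _ - X]mulr_sumr -!sumrB !mulr_sumr -sumrN -big_split/=; apply: eq_bigr => j hj.
have sj : j + m + j - sg != 0 by rewrite -normr_gt0; apply: le_lt_trans hj.
have sj' : (j + m + j - sg)%:~R%:C%C != 0 :> R[i].
  by rewrite (rmorph_int (real_complex R)) intr_eq0.
have -> : conjc (- ('i%C * (j * j)%:~R%:C%C * c j t) - 'i%C * h j t) =
    'i%C * (j * j)%:~R%:C%C * conjc (c j t) + 'i%C * conjc (h j t).
  by apply: complexP; rewrite !ReIm/=; ring.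
move: sj'; rewrite !rmorphM/= fmorphV/= !(rmorph_int (real_complex R)).
rewrite !(intrM, intrD, mulrNz).
set x := b (j + m) t; set y := conjc (c j t); set z := conjc (h j t).
set w := f (j + m) t.
by move=> h1; field.
Qed.

(* Cauchy-Schwarz leaves a tail of size O(1/L), uniformly in time. *)
Definition clim (f : nat -> R[i]) (l : R[i]) :=
  forall e : R, 0 < e -> exists L0, forall L, (L0 <= L)%N -> nsq (f L - l) <= e.

Lemma climP2 (f : nat -> R[i]) l (B : R) : clim f l ->
  (exists L0, forall L, (L0 <= L)%N -> nsq (f L) <= B) -> nsq l <= 2 * B.
Proof.
move=> fl [L0 fB]; apply/ler_addgt0Pr => e e0.
have [L1 hL1] := fl (e / 2) ltac:(lra).
have h1 := hL1 (maxn L0 L1) (leq_maxr _ _); have h2 := fB (maxn L0 L1) (leq_maxl _ _).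
have := nsqB_le (f (maxn L0 L1)) (f (maxn L0 L1) - l); rewrite subKr; lra.
Qed.

(** Fatou's lemma for a finite sum, where one [L] serves all modes of the list; the factor 2 comes
    from the crude inequality [nsqB_le]. *)
Lemma sum_limit (r : seq int) (W : int -> R) (f : nat -> int -> R[i]) (l : int -> R[i]) (B : R) :
  (forall k, 0 <= W k) -> (forall k, clim (f ^~ k) (l k)) ->
  (forall L, \sum_(k <- r) W k * nsq (f L k) <= B) ->
  \sum_(k <- r) W k * nsq (l k) <= 2 * B.
Proof.
move=> W0 fl fB; apply/ler_addgt0Pr => e e0.
have [L hL] : exists L, \sum_(k <- r) W k * nsq (f L k - l k) <= e / 2.
  suff [L0 h] : exists L0, forall L, (L0 <= L)%N ->
      \sum_(k <- r) W k * nsq (f L k - l k) <= e / 2 by exists L0; exact: h.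
  have e2 : 0 < e / 2 by lra.
  elim: r (e / 2) e2 {fB} => [|k r IH] d d0.
    by exists 0 => L _; rewrite big_nil ltW.
  have [L1 h1] := IH (d / 2) ltac:(lra).
  have W1 : 0 < W k + 1 by have := W0 k; lra.
  have [L2 h2] := fl k (d / 2 / (W k + 1)) ltac:(rewrite !divr_gt0//).
  exists (maxn L1 L2) => L; rewrite geq_max => /andP[/h1 l1 /h2 l2].
  rewrite big_cons; move: l2; rewrite ler_pdivlMr// => l2.
  by have := W0 k; have := nsq_ge0 (f L k - l k); nra.
have h : \sum_(k <- r) W k * nsq (l k) <=
    \sum_(k <- r) (2 * (W k * nsq (f L k)) + 2 * (W k * nsq (f L k - l k))).
  apply: ler_sum => k _; have := nsqB_le (f L k) (f L k - l k); rewrite subKr.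
  by have := W0 k; nra.
move: h; rewrite big_split/= -!mulr_sumr; have := fB L; lra.
Qed.

(** Outside the window [jb] is at least [L + 1], so that part of [y] has squared norm at most
    [B / (L + 1)]; the factor 2 is that of [climP2]. *)
Lemma conv_tail (x y : int -> R[i]) (l : R[i]) (A B : R) L :
  l2bound (fun=> 1) x A -> l2bound jb y B ->
  clim (fun L => \sum_(j <- window L) x j * y j) l ->
  nsq (\sum_(j <- window L) x j * y j - l) <= 2 * A * B / L.+1%:R.
Proof.
move=> xA yB xyl; have A0 := l2bound_ge0 xA; have B0 := l2bound_ge0 yB.
have L0 : 0 < (L.+1%:R : R) by rewrite ltr0n.
rewrite -nsqN opprB (_ : 2 * A * B / _ = 2 * (A * B / L.+1%:R)); last first.
  by field; rewrite gt_eqF.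
apply: (@climP2 (fun L' => \sum_(j <- window L') x j * y j - \sum_(j <- window L) x j * y j)).
  move=> e e0; have [L1 h] := xyl e e0; exists L1 => L' /h.
  by rewrite opprB addrA subrK.
exists L => L' LL'.
have -> : \sum_(j <- window L') x j * y j - \sum_(j <- window L) x j * y j =
   \sum_(j <- window L' | j \notin window L) x j * y j.
  rewrite (bigID (fun j => j \in window L))/= -big_filter addrC.
  apply/eqP; rewrite subr_eq; apply/eqP; congr (_ + _); apply: perm_big.
  apply: uniq_perm; rewrite ?filter_uniq ?window_uniq// => j.
  rewrite mem_filter !mem_window; apply/andP/idP => [[]//|h]; split=> //.
  by apply: (le_trans h); rewrite lez_nat.
apply: le_trans (nsq_cs _ _ _ _) _; rewrite -mulrA; apply: ler_pM.
- by apply: sumr_ge0 => j _; exact: nsq_ge0.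
- by apply: sumr_ge0 => j _; exact: nsq_ge0.
- apply: le_trans (xA _ (window_uniq L')); under [leRHS]eq_bigr do rewrite mul1r.
  by apply: sum_subseq; rewrite ?window_uniq// => j; exact: nsq_ge0.
rewrite ler_pdivlMr// mulr_suml.
apply: le_trans (yB _ (window_uniq L')).
apply: (@le_trans _ _ (\sum_(j <- window L' | j \notin window L) jb j * nsq (y j))).
  apply: ler_sum => j; rewrite mem_window -ltNge => /(@jb_far R) h.
  by rewrite mulrC ler_wpM2r ?nsq_ge0.
apply: sum_subseq; rewrite ?window_uniq// => j.
by rewrite mulr_ge0 ?nsq_ge0// ltW ?jb_gt0.
Qed.

Lemma l2bound_shift a A k : l2bound (fun=> 1) a A -> l2bound (fun=> 1) (fun j => a (k - j)) A.
Proof.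
move=> aA r ur; have := aA [seq k - j | j <- r].
by rewrite big_map (map_inj_uniq (@injBl k)); apply.
Qed.

Lemma l2bound_shiftD a A k : l2bound (fun=> 1) a A -> l2bound (fun=> 1) (fun j => a (j + k)) A.
Proof.
move=> aA r ur; have := aA [seq j + k | j <- r].
by rewrite big_map (map_inj_uniq (@injDr k)); apply.
Qed.

Lemma l2bound_jb a A : l2bound jb a A -> l2bound (fun=> 1) a A.
Proof.
move=> aA r ur; apply: le_trans (aA r ur); apply: ler_sum => k _.
by rewrite ler_wpM2r ?nsq_ge0 ?jb_ge1.
Qed.

Lemma conv_boundF a b (F : int -> R[i]) (A B : R) :
  l2bound (fun=> 1) a A -> l2bound jb b B ->
  (forall k, clim (fun L => S_full L a b k) (F k)) ->
  l2bound (fun k => (jb k)^-1) F (32 * A * B).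
Proof.
move=> aA bB hF r ur; rewrite (_ : 32 * A * B = 2 * (16 * A * B)); last by ring.
apply: (@sum_limit r _ (fun L => S_full L a b)) => // [k|L].
  by rewrite ltW ?jbV_gt0.
by apply: bound_F => //; exact: window_uniq.
Qed.

Lemma conv_boundG b c (G : int -> R[i]) (A B : R) :
  l2bound jb b A -> l2bound jb c B ->
  (forall m, clim (fun L => W_full L b c m) (G m)) ->
  l2bound (fun=> 1) G (16 * A * B).
Proof.
move=> bA cB hG r ur; rewrite (_ : 16 * A * B = 2 * (8 * A * B)); last by ring.
apply: (@sum_limit r _ (fun L => W_full L b c)) => // L.
have := @bound_G R r (window L) ur (window_uniq L) b (fun k => conjc (c k)) A B bA (l2bound_conj cB).
rewrite (eq_bigr (fun m => 1 * nsq (W_full L b c m)))// => m _.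
by congr (1 * nsq _); apply: eq_bigr => j _; rewrite rmorph1 mul1r.
Qed.

End NormalForms.

(** * Uniqueness for the mode system *)

Section Contraction.
Context {R : realType}.
Implicit Types (K L : nat) (sg k m : int) (t : R).
Local Notation jb := (@jb R).

(* [a 1] and [a (-1)] are the half-waves [N +/- (i/k) d_t N], [F] and [G] the coefficients of [N
   u] and [|u|^2]; the bounds [M] are for squared norms. *)
Record mode_system (T M : R) (u : int -> R -> R[i]) (a : int -> int -> R -> R[i])
    (F G : int -> R -> R[i]) : Prop := ModeSystem {
  ms_cu : forall k, ccont 0 T (u k);
  ms_ca : forall sg k, `|sg| = 1 -> ccont 0 T (a sg k);
  ms_du : forall k t, 0 < t < T ->
    cder (u k) t (- ('i%C * (k * k)%:~R%:C%C * u k t) - 'i%C * F k t);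
  ms_da : forall sg m t, `|sg| = 1 -> m != 0 -> 0 < t < T ->
    cder (a sg m) t (- ('i%C * (sg * m)%:~R%:C%C * a sg m t)
                     - 'i%C * (sg * m)%:~R%:C%C * G m t);
  ms_F : forall k t, 0 <= t <= T ->
    clim (fun L => S_full L (fun m => (1 / 2 : R)%:C%C * (a 1 m t + a (-1) m t)) (u ^~ t) k) (F k t);
  ms_G : forall m t, 0 <= t <= T ->
    clim (fun L => W_full L (u ^~ t) (u ^~ t) m) (G m t);
  ms_bu : forall t, 0 <= t <= T -> l2bound jb (u ^~ t) M;
  ms_ba : forall sg t, `|sg| = 1 -> 0 <= t <= T -> l2bound (fun=> 1) (fun m => a sg m t) M }.

(** What is left of the quadratic term after the derivative of the boundary term is subtracted: the
    nearly resonant part, and the two cubic parts obtained by differentiating either factor. *)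
Definition S_rest K sg L a g b f k : R[i] :=
  S_res K sg L a b k + (S_cubic1 K sg L g b k + S_boundary K sg L a f k).

(** [cS] and [cW] are the constants of the nearly resonant estimates, the only ones that grow with
    [K]. *)
Definition cS K : R := 4 * (K.+2%:R * K.+1%:R ^+ 2 + 1).
Definition cW K : R := 4 * (2 * K.+3%:R * K.+1%:R ^+ 2).

Lemma S_rest_bound r K sg L a g b f (A B C D : R) : uniq r -> `|sg| <= 1 ->
  l2bound (fun=> 1) a A -> l2bound (fun=> 1) g B -> l2bound jb b C ->
  l2bound (fun k => (jb k)^-1) f D ->
  \sum_(k <- r) jb k * nsq (S_rest K sg L a g b f k) <=
    2 * (cS K * A * C) + 4 * (48 * B * C) + 4 * (384 * A * D).
Proof.
move=> ur sg1 aA gB bC fD.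
have us := window_uniq L.
have h1 := bound_S_res ur us sg1 K aA bC.
have sq1 : (sg%:~R : R) ^+ 2 <= 1.
  rewrite -[leRHS](expr1n _ 2) -(real_normK (num_real _)) ler_pXn2r ?nnegrE//.
  by rewrite -intr_norm -[1]/(1%:~R) ler_int.
have h2 := bound_S_cubic1 ur us sg1 K sq1 gB bC.
have h3 := bound_S_cubic2 ur us sg1 K aA fD.
have : \sum_(k <- r) jb k * nsq (S_rest K sg L a g b f k) <=
  \sum_(k <- r) (2 * (jb k * nsq (S_res K sg L a b k)) +
     4 * (jb k * nsq (S_cubic1 K sg L g b k)) + 4 * (jb k * nsq (S_boundary K sg L a f k))).
  apply: ler_sum => k _; rewrite /S_rest.
  have := nsqD_le (S_res K sg L a b k) (S_cubic1 K sg L g b k + S_boundary K sg L a f k).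
  have := nsqD_le (S_cubic1 K sg L g b k) (S_boundary K sg L a f k).
  move=> p1 p2; have p3 := le_trans p2 (lerD (lexx _) (ler_wpM2l (ltac:(lra) : 0 <= 2) p1)).
  have := ler_wpM2l (ltW (@jb_gt0 R k)) p3; lra.
rewrite !big_split/= -!mulr_sumr => /le_trans; apply.
by rewrite !lerD// ler_wpM2l.
Qed.

Definition W_rest K sg L b f c h m : R[i] :=
  sg%:~R%:C%C * W_near K sg L b c m +
  (W_boundary K sg L b h m - W_boundary K sg L f c m).

Lemma W_rest_bound r K sg L b f c h (A B C D : R) : uniq r -> `|sg| <= 1 ->
  l2bound jb b A -> l2bound (fun k => (jb k)^-1) f B -> l2bound jb c C ->
  l2bound (fun k => (jb k)^-1) h D ->
  \sum_(m <- r) 1 * nsq (W_rest K sg L b f c h m) <=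
    2 * (cW K * A * C) + 4 * (48 * B * C) + 4 * (48 * A * D).
Proof.
move=> ur sg1 bA fB cC hD.
have us := window_uniq L.
have cC' := l2bound_conj cC; have hD' := l2bound_conj hD.
have h1 := bound_W_res ur us sg1 K bA cC'.
have sq1 : (sg%:~R : R) ^+ 2 <= 1.
  rewrite -[leRHS](expr1n _ 2) -(real_normK (num_real _)) ler_pXn2r ?nnegrE//.
  by rewrite -intr_norm -[1]/(1%:~R) ler_int.
have h2 := bound_W_cubic1 ur us sg1 K sq1 fB cC'.
have h3 := bound_W_cubic2 ur us sg1 K sq1 bA hD'.
have : \sum_(m <- r) 1 * nsq (W_rest K sg L b f c h m) <=
  \sum_(m <- r) (2 * (1 * nsq (W_near K sg L b c m)) +
     4 * (1 * nsq (W_boundary K sg L f c m)) + 4 * (1 * nsq (W_boundary K sg L b h m))).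
  apply: ler_sum => m _; rewrite /W_rest !mul1r.
  have := nsqD_le (sg%:~R%:C%C * W_near K sg L b c m)
     (W_boundary K sg L b h m - W_boundary K sg L f c m).
  have := nsqB_le (W_boundary K sg L b h m) (W_boundary K sg L f c m).
  rewrite nsqM nsqC.
  have := ler_wpM2r (nsq_ge0 (W_near K sg L b c m)) sq1; rewrite mul1r; lra.
rewrite !big_split/= -!mulr_sumr => /le_trans; apply.
rewrite -mulr_sumr mul1r in h1; rewrite -mulr_sumr mul1r in h2.
rewrite -mulr_sumr mul1r in h3; rewrite !mul1r.
by apply: lerD; [apply: lerD|]; rewrite ler_wpM2l.
Qed.

End Contraction.

Section TwoSolutions.
Context {R : realType}.
Implicit Types (K L : nat) (sg k m : int) (t : R).
Local Notation jb := (@jb R).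

Variables (T M : R) (u1 u2 : int -> R -> R[i]) (a1 a2 : int -> int -> R -> R[i]).
Variables (F1 G1 F2 G2 : int -> R -> R[i]).
Hypothesis H1 : mode_system T M u1 a1 F1 G1.
Hypothesis H2 : mode_system T M u2 a2 F2 G2.
Hypothesis zero_mode : forall sg t, `|sg| = 1 -> 0 <= t <= T -> a1 sg 0 t = a2 sg 0 t.

Let w k t := u1 k t - u2 k t.
(** The half-wave equations hold only for nonzero modes. With the value 0 at [k = 0] the difference
    satisfies its equation at every mode, and [zero_mode] makes this value the true one. *)
Let d sg k t := if k == 0 then 0 else a1 sg k t - a2 sg k t.
Let f k t := F1 k t - F2 k t.
Let g k t := G1 k t - G2 k t.
Let mean (a : int -> int -> R -> R[i]) t m := (1 / 2 : R)%:C%C * (a 1 m t + a (-1) m t).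

Let dE sg k t : `|sg| = 1 -> 0 <= t <= T -> d sg k t = a1 sg k t - a2 sg k t.
Proof. by move=> s1 tT; rewrite /d; case: eqP => // ->; rewrite zero_mode// subrr. Qed.

Let jb0 k : 0 <= jb k. Proof. by rewrite ltW ?jb_gt0. Qed.
Let jbV0 k : 0 <= (jb k)^-1. Proof. by rewrite ltW ?jbV_gt0. Qed.
Let one0 : forall k : int, (0 : R) <= 1. Proof. by []. Qed.

Lemma mean_bound (a : int -> int -> R -> R[i]) t (A : R) :
  (forall sg, `|sg| = 1 -> l2bound (fun=> 1) (fun m => a sg m t) A) -> l2bound (fun=> 1) (mean a t) A.
Proof.
move=> aA; have h := l2boundD one0 (aA 1 erefl) (aA (-1) erefl).
apply: l2boundW (l2boundZ (1 / 2 : R)%:C%C h).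
by rewrite nsqC; lra.
Qed.

Lemma diff_F L k t : 0 <= t <= T ->
  S_full L (mean a1 t) (u1 ^~ t) k - S_full L (mean a2 t) (u2 ^~ t) k =
  S_full L (mean d t) (u1 ^~ t) k + S_full L (mean a2 t) (w ^~ t) k.
Proof.
move=> tT; rewrite /S_full -sumrB -big_split/=; apply: eq_bigr => j _.
by rewrite /mean !dE// /w; ring.
Qed.

Lemma diff_G L m t :
  W_full L (u1 ^~ t) (u1 ^~ t) m - W_full L (u2 ^~ t) (u2 ^~ t) m =
  W_full L (w ^~ t) (u1 ^~ t) m + W_full L (u2 ^~ t) (w ^~ t) m.
Proof.
rewrite /W_full -sumrB -big_split/=; apply: eq_bigr => j _.
have -> : conjc (w j t) = conjc (u1 j t) - conjc (u2 j t).
  by apply: complexP; rewrite !ReIm; ring.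
by rewrite /w; ring.
Qed.

Lemma clim_sub (p q : nat -> R[i]) x y : clim p x -> clim q y ->
  clim (fun L => p L - q L) (x - y).
Proof.
move=> hp hq e e0; have [L1 h1] := hp (e / 4) ltac:(lra).
have [L2 h2] := hq (e / 4) ltac:(lra).
exists (maxn L1 L2) => L; rewrite geq_max => /andP[/h1 l1 /h2 l2].
have := nsqB_le (p L - x) (q L - y).
by rewrite (_ : p L - x - (q L - y) = p L - q L - (x - y)); [lra|ring].
Qed.

Lemma exists_inv (C e : R) : 0 < e -> exists L : nat, C / L.+1%:R <= e.
Proof.
move=> e0; exists (Num.bound `|C / e|).
rewrite ler_pdivrMr// mulrC -ler_pdivrMr//.
apply: le_trans (ler_norm _) _; apply: ltW; apply: lt_trans (archi_boundP _) _ => //.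
by rewrite ltr_nat.
Qed.

Definition tailF L k t :=
  f k t - (S_full L (mean d t) (u1 ^~ t) k + S_full L (mean a2 t) (w ^~ t) k).
Definition tailG L m t :=
  g m t - (W_full L (w ^~ t) (u1 ^~ t) m + W_full L (u2 ^~ t) (w ^~ t) m).

Lemma tailF_le L k t : 0 <= t <= T -> nsq (tailF L k t) <= 8 * M ^+ 2 / L.+1%:R.
Proof.
move=> tT; rewrite /tailF -diff_F// /f.
have b1 := conv_tail L (l2bound_shift k (mean_bound (fun sg s1 => ms_ba H1 s1 tT)))
   (ms_bu H1 tT) (ms_F H1 k tT).
have b2 := conv_tail L (l2bound_shift k (mean_bound (fun sg s1 => ms_ba H2 s1 tT)))
   (ms_bu H2 tT) (ms_F H2 k tT).
rewrite -/(S_full L (mean a1 t) (u1 ^~ t) k) in b1.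
rewrite -/(S_full L (mean a2 t) (u2 ^~ t) k) in b2.
set s1 := S_full _ _ _ _ in b1 *; set s2 := S_full _ _ _ _ in b2 *.
have := nsqB_le (s2 - F2 k t) (s1 - F1 k t).
rewrite (_ : s2 - _ - _ = F1 k t - F2 k t - (s1 - s2)); last by ring.
by move: b1 b2; move: (L.+1%:R^-1) => q; lra.
Qed.

Lemma tailG_le L m t : 0 <= t <= T -> nsq (tailG L m t) <= 8 * M ^+ 2 / L.+1%:R.
Proof.
move=> tT; rewrite /tailG -diff_G// /g.
have b1 := conv_tail L (l2bound_shiftD m (l2bound_jb (ms_bu H1 tT)))
   (l2bound_conj (ms_bu H1 tT)) (ms_G H1 m tT).
have b2 := conv_tail L (l2bound_shiftD m (l2bound_jb (ms_bu H2 tT)))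
   (l2bound_conj (ms_bu H2 tT)) (ms_G H2 m tT).
rewrite -/(W_full L (u1 ^~ t) (u1 ^~ t) m) in b1.
rewrite -/(W_full L (u2 ^~ t) (u2 ^~ t) m) in b2.
set s1 := W_full _ _ _ _ in b1 *; set s2 := W_full _ _ _ _ in b2 *.
have := nsqB_le (s2 - G2 m t) (s1 - G1 m t).
rewrite (_ : s2 - _ - _ = G1 m t - G2 m t - (s1 - s2)); last by ring.
by move: b1 b2; move: (L.+1%:R^-1) => q; lra.
Qed.

Lemma diffF_bound t (B : R) : 0 <= t <= T -> l2bound jb (w ^~ t) B ->
  (forall sg, `|sg| = 1 -> l2bound (fun=> 1) (fun m => d sg m t) B) ->
  l2bound (fun k => (jb k)^-1) (f ^~ t) (128 * M * B).
Proof.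
move=> tT wB dB r ur; rewrite (_ : 128 * M * B = 2 * (2 * (16 * B * M) + 2 * (16 * M * B))); last by ring.
apply: (@sum_limit R r _ (fun L k => S_full L (mean a1 t) (u1 ^~ t) k - S_full L (mean a2 t) (u2 ^~ t) k)) => //.
  by move=> k; apply: clim_sub; [exact: (ms_F H1)|exact: (ms_F H2)].
move=> L; under eq_bigr do rewrite diff_F//.
have b1 := bound_F ur (window_uniq L) (mean_bound dB) (ms_bu H1 tT).
have b2 := bound_F ur (window_uniq L) (mean_bound (fun sg s1 => ms_ba H2 s1 tT)) wB.
apply: (@le_trans _ _ (\sum_(k <- r) (2 * ((jb k)^-1 * nsq (S_full L (mean d t) (u1 ^~ t) k)) +
   2 * ((jb k)^-1 * nsq (S_full L (mean a2 t) (w ^~ t) k))))).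
  apply: ler_sum => k _; rewrite !(mulrCA 2) -mulrDr ler_wpM2l// nsqD_le//.
by rewrite big_split/= -!mulr_sumr lerD// ler_wpM2l.
Qed.

Lemma diffG_bound t (B : R) : 0 <= t <= T -> l2bound jb (w ^~ t) B ->
  l2bound (fun=> 1) (g ^~ t) (64 * M * B).
Proof.
move=> tT wB r ur; rewrite (_ : 64 * M * B = 2 * (2 * (8 * B * M) + 2 * (8 * M * B))); last by ring.
apply: (@sum_limit R r _ (fun L m => W_full L (u1 ^~ t) (u1 ^~ t) m - W_full L (u2 ^~ t) (u2 ^~ t) m)) => //.
  by move=> k; apply: clim_sub; [exact: (ms_G H1)|exact: (ms_G H2)].
move=> L; under eq_bigr do rewrite diff_G//.
have P b c A C : l2bound jb b A -> l2bound jb c C ->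
    \sum_(m <- r) nsq (W_full L b c m) <= 8 * A * C.
  move=> bA cC; have := bound_G ur (window_uniq L) bA (l2bound_conj cC).
  rewrite (eq_bigr (fun m => nsq (W_full L b c m)))// => m _.
  by rewrite mul1r; congr (nsq _); apply: eq_bigr => j _; rewrite rmorph1 mul1r.
have b1 := P _ _ _ _ wB (ms_bu H1 tT); have b2 := P _ _ _ _ (ms_bu H2 tT) wB.
apply: (@le_trans _ _ (\sum_(k <- r) (2 * (nsq (W_full L (w ^~ t) (u1 ^~ t) k)) +
   2 * (nsq (W_full L (u2 ^~ t) (w ^~ t) k))))).
  by apply: ler_sum => k _; rewrite mul1r nsqD_le.
by rewrite big_split/= -!mulr_sumr lerD// ler_wpM2l.
Qed.

(** The factor of [B] in the bound for the forcing of the transformed difference. The numerical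
    constant is the exact value of the cubic part of [4 (X1 + X2)] in [contraction_u]; the wave part
    needs less. *)
Definition Theta K : R := 16 * (cS K + cW K) * M + 1020 * (1024 * M ^+ 2).

(** The truncation error is bounded uniformly in the mode, hence is small after summation over a
    finite list. That [L] depends on the list does no harm, since the bounds to be proved concern
    one finite list at a time. *)
Lemma small_tail (r : seq int) (W : int -> R) (e C : R) : 0 < e -> 0 <= C -> (forall k, 0 <= W k) ->
  exists L, \sum_(k <- r) W k * (C / L.+1%:R) <= e.
Proof.
move=> e0 C0 W0; have [L hL] := exists_inv ((\sum_(k <- r) W k) * C) e0.
by exists L; rewrite -mulr_suml mulrA.
Qed.

Lemma der_w k t : 0 < t < T ->
  cder (w k) t (- ('i%C * (k * k)%:~R%:C%C * w k t) - 'i%C * f k t).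
Proof.
move=> tT; apply: cder_eq (cderB (ms_du H1 k tT) (ms_du H2 k tT)).
by rewrite /w /f; ring.
Qed.

Lemma der_d sg m t : `|sg| = 1 -> 0 < t < T ->
  cder (d sg m) t (- ('i%C * (sg * m)%:~R%:C%C * d sg m t)
     - 'i%C * (sg * m)%:~R%:C%C * g m t).
Proof.
move=> s1 tT; rewrite /d; case: eqP => [->|/eqP m0].
  apply: cder_eq (cder_cst 0 t).
  by apply: complexP; rewrite !ReIm mulr0 /= ; ring.
apply: cder_eq (cderB (@ms_da _ _ _ _ _ _ _ H1 sg m t s1 m0 tT) (@ms_da _ _ _ _ _ _ _ H2 sg m t s1 m0 tT)).
rewrite /g; set x := _%:~R%:C%C; by ring.
Qed.

Variables (t0 t1 B : R).
Hypotheses (t0ge0 : 0 <= t0) (t01 : t0 < t1) (t1T : t1 <= T).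
Hypothesis w0 : forall k, w k t0 = 0.
Hypothesis d0 : forall sg k, `|sg| = 1 -> d sg k t0 = 0.
Hypothesis wB : forall t, t0 <= t <= t1 -> l2bound jb (w ^~ t) B.
Hypothesis dB : forall t, t0 <= t <= t1 ->
  forall sg, `|sg| = 1 -> l2bound (fun=> 1) (fun m => d sg m t) B.

Let inT t : t0 <= t <= t1 -> 0 <= t <= T.
Proof. by move=> /andP[a b]; rewrite (le_trans t0ge0 a) (le_trans b t1T). Qed.
Let inT' t : t0 < t < t1 -> 0 < t < T. Proof. by move=> /andP[a b]; rewrite (le_lt_trans t0ge0 a) (lt_le_trans b t1T). Qed.
Let t00 : t0 <= t0 <= t1. Proof. by rewrite lexx ltW. Qed.
Let M0 : 0 <= M. Proof. by apply: l2bound_ge0 (ms_bu H1 (inT t00)). Qed.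
Let B0 : 0 <= B. Proof. by apply: l2bound_ge0 (wB t00). Qed.
Let p1 : `|1 : int| = 1. Proof. by []. Qed.
Let n1 : `|(-1) : int| = 1. Proof. by []. Qed.
Let F1B t : 0 <= t <= T -> l2bound (fun k => (jb k)^-1) (F1 ^~ t) (32 * M * M).
Proof.
move=> tT; apply: conv_boundF (mean_bound (fun sg s1 => ms_ba H1 s1 tT)) (ms_bu H1 tT) _.
by move=> k; exact: (ms_F H1).
Qed.
Let F2B t : 0 <= t <= T -> l2bound (fun k => (jb k)^-1) (F2 ^~ t) (32 * M * M).
Proof.
move=> tT; apply: conv_boundF (mean_bound (fun sg s1 => ms_ba H2 s1 tT)) (ms_bu H2 tT) _.
by move=> k; exact: (ms_F H2).
Qed.
Let G2B t : 0 <= t <= T -> l2bound (fun=> 1) (G2 ^~ t) (16 * M * M).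
Proof.
move=> tT; apply: conv_boundG (ms_bu H2 tT) (ms_bu H2 tT) _.
by move=> k; exact: (ms_G H2).
Qed.

Let cw k : ccont t0 t1 (w k).
Proof. by apply: (@ccontW _ 0 T) => //; apply: ccontB; [exact: (ms_cu H1)|exact: (ms_cu H2)]. Qed.
Let cu1 k : ccont t0 t1 (u1 k).
Proof. by apply: (@ccontW _ 0 T) => //; exact: (ms_cu H1). Qed.
Let cu2 k : ccont t0 t1 (u2 k).
Proof. by apply: (@ccontW _ 0 T) => //; exact: (ms_cu H2). Qed.
Let ca2 sg k : `|sg| = 1 -> ccont t0 t1 (a2 sg k).
Proof. by move=> s1; apply: (@ccontW _ 0 T) => //; exact: (ms_ca H2). Qed.
Let cd sg k : `|sg| = 1 -> ccont t0 t1 (d sg k).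
Proof.
move=> s1; rewrite /d; case: eqP => _; first exact: ccont_cst.
by apply: (@ccontW _ 0 T) => //; apply: ccontB; [exact: (ms_ca H1)|exact: (ms_ca H2)].
Qed.

Lemma cS_ge0 K : 0 <= cS K :> R.
Proof. by rewrite /cS mulr_ge0// addr_ge0// mulr_ge0// sqr_ge0. Qed.
Lemma cW_ge0 K : 0 <= cW K :> R.
Proof. by rewrite /cW mulr_ge0// mulr_ge0 ?sqr_ge0// mulr_ge0. Qed.

Lemma ccont_S_boundary K sg L (a b : int -> R -> R[i]) k :
  (forall m, ccont t0 t1 (a m)) -> (forall m, ccont t0 t1 (b m)) ->
  ccont t0 t1 (fun s => S_boundary K sg L (a ^~ s) (b ^~ s) k).
Proof.
move=> ha hb; apply: ccont_sum => j _; apply: ccontM; first exact: ccont_cst.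
by apply: ccontM; [exact: ha|exact: hb].
Qed.

Lemma ccont_W_boundary K sg L (a b : int -> R -> R[i]) k :
  (forall m, ccont t0 t1 (a m)) -> (forall m, ccont t0 t1 (b m)) ->
  ccont t0 t1 (fun s => W_boundary K sg L (a ^~ s) (b ^~ s) k).
Proof.
move=> ha hb; apply: ccont_sum => j _; apply: ccontM; first exact: ccont_cst.
by apply: ccontM; [exact: ha|apply: ccontJ; exact: hb].
Qed.

(** The energy inequality is applied to [Z = w + BS / 2]. The factor one half is that of [N] as the
    mean of the half-waves, and [BS] has four terms because [d u1] and [a2 w] each occur with both
    signs. Its derivative cancels the nonresonant part of the forcing. *)
Lemma contraction_u K t : t0 <= t <= t1 ->
  l2bound jb (w ^~ t) (8 * (t1 - t0) ^+ 2 * (Theta K * B) + 1024 / K.+1%:R * M * B).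
Proof.
move=> tI r ur; apply/ler_addgt0Pr => e0 e00.
set dl := (t1 - t0) ^+ 2.
have dl0 : 0 < dl by rewrite exprn_gt0// subr_gt0.
(* The truncation error enters the final estimate as [16 dl e], so this choice makes it exactly the
   slack [e0]. *)
pose e := e0 / (16 * dl); have e1 : 0 < e by rewrite divr_gt0// mulr_gt0.
have [L hL] := small_tail r e1 (mulr_ge0 (ltac:(lra) : 0 <= 8) (sqr_ge0 M)) jb0.
pose BS s k : R[i] := S_boundary K 1 L (fun m => d 1 m s) (u1 ^~ s) k +
  S_boundary K (-1) L (fun m => d (-1) m s) (u1 ^~ s) k +
  (S_boundary K 1 L (fun m => a2 1 m s) (w ^~ s) k +
   S_boundary K (-1) L (fun m => a2 (-1) m s) (w ^~ s) k).
pose Rs s k : R[i] :=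
  S_rest K 1 L (fun m => d 1 m s) (g ^~ s) (u1 ^~ s) (F1 ^~ s) k +
  S_rest K (-1) L (fun m => d (-1) m s) (g ^~ s) (u1 ^~ s) (F1 ^~ s) k +
  (S_rest K 1 L (fun m => a2 1 m s) (G2 ^~ s) (w ^~ s) (f ^~ s) k +
   S_rest K (-1) L (fun m => a2 (-1) m s) (G2 ^~ s) (w ^~ s) (f ^~ s) k).
have four (x1 x2 x3 x4 : R[i]) : nsq (x1 + x2 + (x3 + x4)) <=
    4 * nsq x1 + 4 * nsq x2 + (4 * nsq x3 + 4 * nsq x4).
  have := nsqD_le (x1 + x2) (x3 + x4); have := nsqD_le x1 x2.
  by have := nsqD_le x3 x4; lra.
have sum4 (x1 x2 x3 x4 : int -> R[i]) (X1 X2 X3 X4 : R) :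
   \sum_(k <- r) jb k * nsq (x1 k) <= X1 -> \sum_(k <- r) jb k * nsq (x2 k) <= X2 ->
   \sum_(k <- r) jb k * nsq (x3 k) <= X3 -> \sum_(k <- r) jb k * nsq (x4 k) <= X4 ->
   \sum_(k <- r) jb k * nsq (x1 k + x2 k + (x3 k + x4 k)) <= 4 * (X1 + X2 + (X3 + X4)).
  move=> h1 h2 h3 h4; apply: (@le_trans _ _ (\sum_(k <- r)
     (4 * (jb k * nsq (x1 k)) + 4 * (jb k * nsq (x2 k)) +
     (4 * (jb k * nsq (x3 k)) + 4 * (jb k * nsq (x4 k)))))).
    by apply: ler_sum => k _; have := ler_wpM2l (jb0 k) (four (x1 k) (x2 k) (x3 k) (x4 k)); lra.
  by rewrite !big_split/= -!mulr_sumr; lra.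
have half : nsq ((1 / 2 : R)%:C%C) = 1 / 4 by rewrite nsqC; lra.
pose Z k s := w k s + (1 / 2 : R)%:C%C * BS s k.
pose Q k s := - ('i%C * (tailF L k s + (1 / 2 : R)%:C%C * Rs s k)).
pose X1 := 2 * (cS K * B * M) + 4 * (48 * (64 * M * B) * M) + 4 * (384 * B * (32 * M * M)).
pose X2 := 2 * (cS K * M * B) + 4 * (48 * (16 * M * M) * B) + 4 * (384 * M * (128 * M * B)).
have QB s : t0 < s < t1 -> \sum_(k <- r) jb k * nsq (Q k s) <= 2 * e + 4 * (X1 + X2).
  move=> sI; have sI' : t0 <= s <= t1 by lra.
  have sT := inT sI'.
  have rB : \sum_(k <- r) jb k * nsq (Rs s k) <= 4 * (X1 + X1 + (X2 + X2)).
    apply: sum4.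
    - exact: (S_rest_bound K L ur _ (dB sI' p1) (diffG_bound sT (wB sI')) (ms_bu H1 sT) (F1B sT)).
    - exact: (S_rest_bound K L ur _ (dB sI' n1) (diffG_bound sT (wB sI')) (ms_bu H1 sT) (F1B sT)).
    - exact: (S_rest_bound K L ur _ (ms_ba H2 p1 sT) (G2B sT) (wB sI') (diffF_bound sT (wB sI') (dB sI'))).
    - exact: (S_rest_bound K L ur _ (ms_ba H2 n1 sT) (G2B sT) (wB sI') (diffF_bound sT (wB sI') (dB sI'))).
  apply: (@le_trans _ _ (\sum_(k <- r) (2 * (jb k * (8 * M ^+ 2 / L.+1%:R)) + 1 / 2 * (jb k * nsq (Rs s k))))).
    apply: ler_sum => k _; rewrite /Q nsqN nsqM nsq_i mul1r.
    have := nsqD_le (tailF L k s) ((1 / 2 : R)%:C%C * Rs s k).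
    rewrite nsqM half; have := tailF_le L k sT; set q := 8 * M ^+ 2 / _ => h1 h2.
    have h3 : nsq (tailF L k s + (1 / 2)%:C%C * Rs s k) <= 2 * q + 1 / 2 * nsq (Rs s k) by lra.
    by have := ler_wpM2l (jb0 k) h3; lra.
  by rewrite big_split/= -!mulr_sumr; lra.
have cZ k : ccont t0 t1 (Z k).
  apply: ccontD => //; apply: ccontM; first exact: ccont_cst.
  apply: ccontD; apply: ccontD; apply: ccont_S_boundary => // m.
  - exact: cd.
  - exact: cd.
  - exact: ca2.
  - exact: ca2.
have dZ k s : t0 < s < t1 -> cder (Z k) s (- ('i%C * ((k * k)%:~R)%:C%C * Z k s) + Q k s).
  move=> sI; have sT := inT' sI.
  have e1' := cder_S_boundary K L k (fun m _ => der_d m p1 sT) (fun j => ms_du H1 j sT).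
  have e2' := cder_S_boundary K L k (fun m _ => der_d m n1 sT) (fun j => ms_du H1 j sT).
  have e3' := cder_S_boundary K L k (fun m hm => ms_da H2 p1 hm sT) (fun j => der_w j sT).
  have e4' := cder_S_boundary K L k (fun m hm => ms_da H2 n1 hm sT) (fun j => der_w j sT).
  have e5 := cderD (der_w k sT) (cderZ ((1 / 2 : R)%:C%C) (cderD (cderD e1' e2') (cderD e3' e4'))).
  apply: cder_eq e5; rewrite /Q /Z /BS /Rs /S_rest.
  have -> : f k s = tailF L k s + (1 / 2 : R)%:C%C * (
      S_full L (fun m => d 1 m s) (u1 ^~ s) k + S_full L (fun m => d (-1) m s) (u1 ^~ s) k +
      (S_full L (fun m => a2 1 m s) (w ^~ s) k + S_full L (fun m => a2 (-1) m s) (w ^~ s) k)).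
    rewrite /tailF (_ : S_full L (mean d s) (u1 ^~ s) k = (1 / 2 : R)%:C%C *
      (S_full L (fun m => d 1 m s) (u1 ^~ s) k + S_full L (fun m => d (-1) m s) (u1 ^~ s) k)); last first.
      by rewrite /S_full -big_split/= mulr_sumr; apply: eq_bigr => j _; rewrite /mean; ring.
    rewrite (_ : S_full L (mean a2 s) (w ^~ s) k = (1 / 2 : R)%:C%C *
      (S_full L (fun m => a2 1 m s) (w ^~ s) k + S_full L (fun m => a2 (-1) m s) (w ^~ s) k)); last first.
      by rewrite /S_full -big_split/= mulr_sumr; apply: eq_bigr => j _; rewrite /mean; ring.
    by ring.
  rewrite !(@S_fullE R K 1 L (fun m => d 1 m s)) !(@S_fullE R K (-1) L (fun m => d (-1) m s)).
  rewrite !(@S_fullE R K 1 L (fun m => a2 1 m s)) !(@S_fullE R K (-1) L (fun m => a2 (-1) m s)).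
  by ring.
have Z0 k : Z k t0 = 0.
  have z1 sg : `|sg| = 1 -> S_boundary K sg L (fun m => d sg m t0) (u1 ^~ t0) k = 0.
    by move=> s1; apply: big1 => j _; rewrite d0// mul0r mulr0.
  have z2 sg : S_boundary K sg L (fun m => a2 sg m t0) (w ^~ t0) k = 0.
    by apply: big1 => j _; rewrite w0// !mulr0.
  by rewrite /Z w0 /BS z1// z1// !z2 !(addr0, mulr0).
have ZB := energy_bound t01 jb0 cZ dZ Z0 QB tI.
have tT := inT tI.
have BSB : \sum_(k <- r) jb k * nsq (BS t k) <= 4 * (128 / K.+1%:R * B * M + 128 / K.+1%:R * B * M
    + (128 / K.+1%:R * M * B + 128 / K.+1%:R * M * B)).
  have us := window_uniq L.
  apply: sum4.
  - exact: (bound_S_boundary ur us _ K (dB tI p1) (ms_bu H1 tT)).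
  - exact: (bound_S_boundary ur us _ K (dB tI n1) (ms_bu H1 tT)).
  - exact: (bound_S_boundary ur us _ K (ms_ba H2 p1 tT) (wB tI)).
  - exact: (bound_S_boundary ur us _ K (ms_ba H2 n1 tT) (wB tI)).
(* Return from [Z] to [w]. The boundary term contributes [1/2 * 4 * (4 * 128) / (K + 1) = 1024 / (K
   + 1)] times [M B]. *)
apply: (@le_trans _ _ (\sum_(k <- r) (2 * (jb k * nsq (Z k t)) + 1 / 2 * (jb k * nsq (BS t k))))).
  apply: ler_sum => k _; have := nsqB_le (Z k t) ((1 / 2 : R)%:C%C * BS t k).
  rewrite {1}/Z addrK nsqM half => h.
  have h3 : nsq (w k t) <= 2 * nsq (Z k t) + 1 / 2 * nsq (BS t k) by lra.
  by have := ler_wpM2l (jb0 k) h3; lra.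
rewrite big_split/= -!mulr_sumr -/dl in ZB *.
have key : 2 * (4 * dl * (2 * e + 4 * (X1 + X2))) = e0 + 8 * dl * (4 * (X1 + X2)).
  by rewrite /e; field; rewrite gt_eqF.
have X12 : 4 * (X1 + X2) <= Theta K * B.
  rewrite /X1 /X2 /Theta; have := mulr_ge0 (mulr_ge0 (cW_ge0 K) M0) B0; lra.
have := ler_wpM2l (ltW dl0) X12.
move: ZB BSB; move: (K.+1%:R^-1) => q; lra.
Qed.

Lemma contraction_a K sg t : `|sg| = 1 -> t0 <= t <= t1 ->
  l2bound (fun=> 1) (fun m => d sg m t)
    (8 * (t1 - t0) ^+ 2 * (Theta K * B) + 1024 / K.+1%:R * M * B).
Proof.
move=> s1 tI r ur; apply/ler_addgt0Pr => e0 e00.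
have s1' : `|sg| <= 1 by rewrite s1.
set dl := (t1 - t0) ^+ 2.
have dl0 : 0 < dl by rewrite exprn_gt0// subr_gt0.
pose e := e0 / (16 * dl); have e1 : 0 < e by rewrite divr_gt0// mulr_gt0.
have sg2 : (sg%:~R : R) ^+ 2 = 1.
  by rewrite -(real_normK (num_real _)) -intr_norm s1 expr1n.
(* The wave forcing multiplies the truncation error by [sg m], so [L] is chosen against the weight
   [m^2]; this is possible only because the list is finite. *)
have [L hL] := small_tail r e1 (mulr_ge0 (ltac:(lra) : 0 <= 8) (sqr_ge0 M))
   (fun k => sqr_ge0 (k%:~R : R)).
pose BW s m : R[i] := W_boundary K sg L (w ^~ s) (u1 ^~ s) m +
  W_boundary K sg L (u2 ^~ s) (w ^~ s) m.
pose Rs s m : R[i] :=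
  W_rest K sg L (w ^~ s) (f ^~ s) (u1 ^~ s) (F1 ^~ s) m +
  W_rest K sg L (u2 ^~ s) (F2 ^~ s) (w ^~ s) (f ^~ s) m.
have sum2 (x1 x2 : int -> R[i]) (X1 X2 : R) :
   \sum_(k <- r) 1 * nsq (x1 k) <= X1 -> \sum_(k <- r) 1 * nsq (x2 k) <= X2 ->
   \sum_(k <- r) 1 * nsq (x1 k + x2 k) <= 2 * (X1 + X2).
  move=> h1 h2; apply: (@le_trans _ _ (\sum_(k <- r)
     (2 * (1 * nsq (x1 k)) + 2 * (1 * nsq (x2 k))))).
    by apply: ler_sum => k _; have := nsqD_le (x1 k) (x2 k); lra.
  by rewrite !big_split/= -![X in X + _]mulr_sumr -![X in _ + X]mulr_sumr; lra.
pose Z m s := d sg m s - BW s m.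
pose Q m s := - ('i%C * ((sg * m)%:~R%:C%C * tailG L m s + Rs s m)).
pose X1 := 2 * (cW K * B * M) + 4 * (48 * (128 * M * B) * M) + 4 * (48 * B * (32 * M * M)).
pose X2 := 2 * (cW K * M * B) + 4 * (48 * (32 * M * M) * B) + 4 * (48 * M * (128 * M * B)).
have QB s : t0 < s < t1 -> \sum_(m <- r) 1 * nsq (Q m s) <= 2 * e + 4 * (X1 + X2).
  move=> sI; have sI' : t0 <= s <= t1 by lra.
  have sT := inT sI'.
  have rB : \sum_(m <- r) 1 * nsq (Rs s m) <= 2 * (X1 + X2).
    apply: sum2.
    - exact: (W_rest_bound K L ur s1' (wB sI') (diffF_bound sT (wB sI') (dB sI')) (ms_bu H1 sT) (F1B sT)).
    - exact: (W_rest_bound K L ur s1' (ms_bu H2 sT) (F2B sT) (wB sI') (diffF_bound sT (wB sI') (dB sI'))).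
  apply: (@le_trans _ _ (\sum_(m <- r) (2 * (m%:~R ^+ 2 * (8 * M ^+ 2 / L.+1%:R)) + 2 * (1 * nsq (Rs s m))))).
    apply: ler_sum => m _; rewrite /Q nsqN nsqM nsq_i !mul1r.
    have := nsqD_le ((sg * m)%:~R%:C%C * tailG L m s) (Rs s m).
    rewrite nsqM nsqC intrM exprMn sg2 mul1r.
    have := ler_wpM2l (sqr_ge0 (m%:~R : R)) (tailG_le L m sT).
    by move: (8 * M ^+ 2 / _) => q; lra.
  by rewrite big_split/= -[X in X + _]mulr_sumr -[X in _ + X]mulr_sumr; lra.
have cZ m : ccont t0 t1 (Z m).
  apply: ccontB; first exact: cd.
  by apply: ccontD; apply: ccont_W_boundary.
have dZ m s : t0 < s < t1 -> cder (Z m) s (- ('i%C * ((sg * m)%:~R)%:C%C * Z m s) + Q m s).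
  move=> sI; have sT := inT' sI.
  have e1' := cder_W_boundary K sg L m (fun j => der_w j sT) (fun j => ms_du H1 j sT).
  have e2' := cder_W_boundary K sg L m (fun j => ms_du H2 j sT) (fun j => der_w j sT).
  have e5 := cderB (der_d m s1 sT) (cderD e1' e2').
  apply: cder_eq e5; rewrite /Q /Z /BW /Rs /W_rest.
  have -> : g m s = tailG L m s + (W_full L (w ^~ s) (u1 ^~ s) m + W_full L (u2 ^~ s) (w ^~ s) m).
    by rewrite /tailG subrK.
  have h1 := @W_fullE R K sg L (w ^~ s) (u1 ^~ s) m.
  have h2 := @W_fullE R K sg L (u2 ^~ s) (w ^~ s) m.
  rewrite intrM rmorphM/=.
  move: h1 h2.
  set f1 := W_full _ _ _ _; set f2 := W_full _ _ _ _.
  set v1 := W_far _ _ _ _ _ _; set v2 := W_far _ _ _ _ _ _.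
  set q1 := W_near _ _ _ _ _ _; set q2 := W_near _ _ _ _ _ _.
  move=> h1 h2; set ms := m%:~R%:C%C in h1 h2 *; set ss := sg%:~R%:C%C.
  have E x : 'i%C * (ss * ms) * (x + (f1 + f2)) = 'i%C * (ss * ms) * x +
     'i%C * ss * (ms * f1) + 'i%C * ss * (ms * f2) by ring.
  by rewrite E h1 h2; ring.
have Z0 m : Z m t0 = 0.
  have z1 c : W_boundary K sg L (w ^~ t0) c m = 0.
    by apply: big1 => j _; rewrite w0// mul0r mulr0.
  have z2 c : W_boundary K sg L c (w ^~ t0) m = 0.
    apply: big1 => j _; rewrite w0// (_ : conjc 0 = 0 :> R[i]) ?mulr0//.
    by apply: complexP; rewrite !ReIm/= ?oppr0.
  by rewrite /Z d0// /BW z1 z2 addr0 subr0.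
have ZB := energy_bound t01 one0 cZ dZ Z0 QB tI.
have tT := inT tI.
have BWB : \sum_(k <- r) 1 * nsq (BW t k) <= 2 * (32 / K.+1%:R * B * M + 32 / K.+1%:R * M * B).
  have us := window_uniq L.
  have sq1 : (sg%:~R : R) ^+ 2 <= 1 by rewrite sg2.
  have PB b c A C (bA : l2bound jb b A) (cC : l2bound jb c C) :
      \sum_(m <- r) 1 * nsq (W_boundary K sg L b c m) <= 32 / K.+1%:R * A * C.
    by apply: bound_W_boundary => //; exact: l2bound_conj.
  by apply: sum2; [exact: (PB _ _ _ _ (wB tI) (ms_bu H1 tT))|exact: (PB _ _ _ _ (ms_bu H2 tT) (wB tI))].
apply: (@le_trans _ _ (\sum_(k <- r) (2 * (1 * nsq (Z k t)) + 2 * (1 * nsq (BW t k))))).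
  apply: ler_sum => k _; have := nsqD_le (Z k t) (BW t k).
  by rewrite {1}/Z subrK; lra.
rewrite big_split/= -[X in X + _]mulr_sumr -[X in _ + X]mulr_sumr; rewrite -/dl in ZB.
have key : 2 * (4 * dl * (2 * e + 4 * (X1 + X2))) = e0 + 8 * dl * (4 * (X1 + X2)).
  by rewrite /e; field; rewrite gt_eqF.
have X12 : 4 * (X1 + X2) <= Theta K * B.
  rewrite /X1 /X2 /Theta; have := mulr_ge0 (mulr_ge0 (cS_ge0 K) M0) B0.
  have := mulr_ge0 (mulr_ge0 M0 M0) B0; have := mulr_ge0 (mulr_ge0 (cW_ge0 K) M0) B0; lra.
have := ler_wpM2l (ltW dl0) X12.
(* The boundary terms actually contribute [256 / (K + 1)]. The larger constant 1024 is shared with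
   [contraction_u], so that both components inherit the same new bound. *)
have q0 : 0 <= K.+1%:R^-1 * (M * B) by rewrite mulr_ge0 ?invr_ge0// mulr_ge0.
move: q0 ZB BWB; move: (K.+1%:R^-1) => q; lra.
Qed.

End TwoSolutions.

Section ModesUnique.
Context {R : realType}.
Local Notation jb := (@jb R).
Variables (T M : R) (u1 u2 : int -> R -> R[i]) (a1 a2 : int -> int -> R -> R[i]).
Variables (F1 G1 F2 G2 : int -> R -> R[i]).
Hypothesis H1 : mode_system T M u1 a1 F1 G1.
Hypothesis H2 : mode_system T M u2 a2 F2 G2.
Hypothesis zero_mode : forall sg t, `|sg| = 1 -> 0 <= t <= T -> a1 sg 0 t = a2 sg 0 t.

Let agree (t : R) := (forall k, u1 k t = u2 k t) /\
  (forall sg k, `|sg| = 1 -> a1 sg k t = a2 sg k t).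

Lemma halving_zero (x C : R) : 0 <= C -> (forall n, x <= C / 2 ^+ n) -> x <= 0.
Proof.
move=> C0 h; apply/ler_addgt0Pr => e e0; rewrite add0r.
have [L hL] := exists_inv C e0.
apply: le_trans (h L) (le_trans _ hL).
rewrite ler_wpM2l// lef_pV2 ?posrE ?exprn_gt0// -natrX ler_nat.
exact: ltn_expl.
Qed.

Lemma local_unique : 0 <= M -> exists2 dl : R, 0 < dl &
  forall t0 t1, 0 <= t0 -> t0 < t1 -> t1 <= T -> t1 - t0 <= dl -> agree t0 ->
  forall t, t0 <= t <= t1 -> agree t.
Proof.
(* [K] is fixed first: the boundary terms then cost a quarter of the bound, and the time step may
   depend on [Theta M K]. *)
move=> M0; have [K hK] := exists_inv (1024 * M) (ltac:(lra) : 0 < 1 / 4 :> R).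
have Th0 : 0 <= Theta M K.
  exact: (addr_ge0 (mulr_ge0 (mulr_ge0 (ler0n R 16) (addr_ge0 (cS_ge0 K) (cW_ge0 K))) M0)
    (mulr_ge0 (ler0n R 1020) (mulr_ge0 (ler0n R 1024) (sqr_ge0 M)))).
(* Since [dl <= 1], [8 dl^2 Theta <= 8 dl Theta <= 1/4]. With the quarter from the boundary terms
   the bound is halved; the [+ 1] keeps the inverse meaningful when [Theta] vanishes. *)
pose dl : R := (32 * (Theta M K + 1))^-1.
have dl0 : 0 < dl by rewrite invr_gt0; lra.
exists dl => // t0 t1 t00 t01 t1T tdl [agu aga] t tI.
have D : 8 * (t1 - t0) ^+ 2 * Theta M K <= 1 / 4.
  have d1 : dl * (32 * (Theta M K + 1)) = 1 by rewrite mulVf// gt_eqF//; lra.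
  have d2 : (t1 - t0) ^+ 2 <= dl.
    apply: (@le_trans _ _ (dl * 1)); last by rewrite mulr1.
    rewrite expr2; apply: ler_pM => //; rewrite ?subr_ge0 ?(ltW t01)//.
    apply: (le_trans tdl); rewrite /dl invf_le1; lra.
  by have := ler_wpM2r Th0 d2; lra.
pose w k t := u1 k t - u2 k t.
pose d sg k t := if k == 0 then 0 else a1 sg k t - a2 sg k t.
have inT s : t0 <= s <= t1 -> 0 <= s <= T.
  by move=> /andP[a b]; rewrite (le_trans t00 a) (le_trans b t1T).
(* The two components must be improved together, because each contraction estimate uses the current
   bound of both. *)
have bnd n : (forall s, t0 <= s <= t1 -> l2bound jb (w ^~ s) (4 * M / 2 ^+ n)) /\
    (forall s, t0 <= s <= t1 -> forall sg, `|sg| = 1 ->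
      l2bound (fun=> 1) (fun m => d sg m s) (4 * M / 2 ^+ n)).
  elim: n => [|n [IHw IHd]].
    rewrite expr0 divr1 (_ : 4 * M = 2 * M + 2 * M); last by ring.
    split=> s sI.
      have jb0 k : 0 <= jb k by rewrite ltW ?jb_gt0.
      exact: (l2boundB jb0 (ms_bu H1 (inT _ sI)) (ms_bu H2 (inT _ sI))).
    move=> sg s1.
    have dE : (fun m => d sg m s) = (fun m => a1 sg m s - a2 sg m s).
      apply/funext => m; rewrite /d; case: eqP => // ->.
      by rewrite zero_mode ?subrr// inT.
    have one0 (k : int) : 0 <= 1 :> R by [].
    rewrite dE; exact: (l2boundB one0 (ms_ba H1 s1 (inT _ sI)) (ms_ba H2 s1 (inT _ sI))).
  have B0 : 0 <= 4 * M / 2 ^+ n by rewrite divr_ge0 ?exprn_ge0// mulr_ge0.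
  have le : 8 * (t1 - t0) ^+ 2 * (Theta M K * (4 * M / 2 ^+ n)) +
      1024 / K.+1%:R * M * (4 * M / 2 ^+ n) <= 4 * M / 2 ^+ n.+1.
    rewrite [2 ^+ n.+1]exprSr (_ : 4 * M / (2 ^+ n * 2) = (4 * M / 2 ^+ n) * (1 / 2)); last first.
      by field; rewrite expf_neq0//.
    move: B0; set X := 4 * M / 2 ^+ n => B0.
    have e1 := ler_wpM2r B0 D; have e2 := ler_wpM2r B0 hK.
    by move: e1 e2; move: (K.+1%:R^-1) => q; lra.
  have w0 k : w k t0 = 0 by rewrite /w agu subrr.
  have d0 sg k : `|sg| = 1 -> d sg k t0 = 0.
    by move=> s1; rewrite /d aga// subrr; case: eqP.
  split=> s sI.
    by apply: l2boundW le _; apply: (contraction_u H1 H2 zero_mode t00 t01 t1T w0 d0 IHw IHd).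
  move=> sg s1.
  by apply: l2boundW le _; apply: (contraction_a H1 H2 zero_mode t00 t01 t1T w0 d0 IHw IHd).
have M4 : 0 <= 4 * M by lra.
split=> [k|sg k s1].
  apply/eqP; rewrite -subr_eq0; apply/eqP/nsq_eq0/le_anti; rewrite nsq_ge0 andbT.
  apply: (halving_zero M4) => n; have := (bnd n).1 t tI [:: k] isT.
  by rewrite big_seq1; apply: le_trans; rewrite ler_peMl ?nsq_ge0 ?jb_ge1.
have [->|k0] := eqVneq k 0; first by apply: zero_mode => //; exact: inT.
apply/eqP; rewrite -subr_eq0; apply/eqP/nsq_eq0/le_anti; rewrite nsq_ge0 andbT.
apply: (halving_zero M4) => n; have := (bnd n).2 t tI sg s1 [:: k] isT.
by rewrite big_seq1 mul1r /d (negbTE k0).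
Qed.

Lemma modes_unique : 0 < T -> agree 0 -> forall t, 0 <= t <= T -> agree t.
Proof.
move=> T0 ag0.
have M0 : 0 <= M by apply: l2bound_ge0 (ms_bu H1 (t := 0) _); rewrite lexx ltW.
have [dl dl0 loc] := local_unique M0.
(* The length [dl] does not depend on the starting time, so finitely many intervals cover
   [[0, T]]. *)
have step n : forall t, 0 <= t <= T -> t <= n%:R * dl -> agree t.
  elim: n => [|n IH] t tT tn.
    by have -> : t = 0 by apply/le_anti; rewrite mul0r in tn; rewrite tn; case/andP: tT.
  have [tn'|tn'] := leP t (n%:R * dl); first exact: IH.
  case/andP: (tT) => t_0 t_T.
  have nd0 : 0 <= n%:R * dl by rewrite mulr_ge0 ?(ltW dl0).
  apply: (loc (n%:R * dl) t) => //; [|apply: IH => //|by rewrite lexx andbT ltW].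
    by move: tn; rewrite -natr1; lra.
  by rewrite nd0/= (le_trans (ltW tn')).
move=> t tT; apply: (step (Num.bound (T / dl))) => //.
case/andP: tT => _ /le_trans; apply.
by rewrite -ler_pdivrMr// ltW// archi_boundP// divr_ge0 ?ltW.
Qed.

End ModesUnique.

(** * Smooth functions and the du Bois-Reymond lemma *)

Section SmoothReal.
Context {R : realType}.
Implicit Types (f g : R -> R) (n : nat).

Fixpoint Cn n f : Prop :=
  if n is n'.+1 then exists2 f', (forall x : R, is_derive x 1 f (f' x)) & Cn n' f' else True.

Definition smoothR f := forall n, Cn n f.

Lemma Cn_le n f : Cn n.+1 f -> Cn n f.
Proof. by elim: n f => [//|n IH] f [f' df cf]; exists f' => //; exact: IH. Qed.

Lemma Cn_cst n c : Cn n (cst c).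
Proof. by elim: n c => [//|n IH] c; exists (cst 0) => // x; exact: is_derive_cst. Qed.

Lemma CnD n f g : Cn n f -> Cn n g -> Cn n (f + g).
Proof.
elim: n f g => [//|n IH] f g [f' df cf] [g' dg cg].
by exists (f' + g') => [x|]; [exact: is_deriveD|exact: IH].
Qed.

Lemma CnM n f g : Cn n f -> Cn n g -> Cn n (f * g).
Proof.
elim: n f g => [//|n IH] f g [f' df cf] [g' dg cg].
exists (f * g' + g * f') => [x|]; last first.
  by apply: CnD; apply: IH => //; apply: Cn_le; [exists f'|exists g'].
by apply: is_derive_eq; rewrite /GRing.scale/=.
Qed.

Lemma Cn_affine n f (a b : R) : Cn n f -> Cn n (fun x => f (a * x + b)).
Proof.
elim: n f => [//|n IH] f [f' df cf].
exists (cst a * (fun x => f' (a * x + b))) => [x|]; last first.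
  by apply: CnM; [exact: Cn_cst|exact: IH].
have da : is_derive x 1 (fun y : R => a * y + b) a.
  rewrite (_ : (fun y => _) = a *: (id : R -> R) + cst b); last by apply/funext.
  by apply: is_derive_eq; rewrite addr0 /GRing.scale/= mulr1.
by apply: (is_derive_eq (@is_derive1_comp _ f (fun y => a * y + b) x _ _ (df _) da)); rewrite /= mulrC.
Qed.

Lemma CnZ n f (c : R) : Cn n f -> Cn n (fun x => c * f x).
Proof. by move=> cf; apply: (@CnM n (cst c)) => //; exact: Cn_cst. Qed.

Lemma Cn_trig n : Cn n (@cos R) /\ Cn n (@sin R).
Proof.
elim: n => [//|n [IHc IHs]]; split.
  exists (fun x => - 1 * sin x); last exact: CnZ.
  by move=> x; rewrite mulN1r; exact: is_derive_cos.
by exists (@cos R) => // x; exact: is_derive_sin.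
Qed.

Lemma smoothR_derive f : smoothR f -> exists2 f', (forall x : R, is_derive x 1 f (f' x)) & smoothR f'.
Proof.
move=> sf; have [f' df _] := sf 1; exists f' => // n.
have [g dg cg] := sf n.+1; rewrite (_ : f' = g)//.
apply/funext => x; have h1 := df x; have h2 := dg x.
by rewrite -(@derive_val _ _ _ _ _ _ _ h1) (@derive_val _ _ _ _ _ _ _ h2).
Qed.

Lemma smoothR_primitive f g : (forall x : R, is_derive x 1 f (g x)) -> smoothR g -> smoothR f.
Proof. by move=> df sg [//|n]; exists g. Qed.

Lemma smoothR_derivable f x : smoothR f -> derivable f x 1.
Proof. by move=> /(_ 1)[f' df _]; have := df x => h; exact: ex_derive. Qed.

Lemma smoothR_continuous f : smoothR f -> continuous f.
Proof. by move=> sf x; apply/differentiable_continuous/derivable1_diffP/smoothR_derivable. Qed.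

Lemma smoothR_derive1 f : smoothR f -> smoothR (derive1 f).
Proof.
move=> /smoothR_derive[f' df sf']; rewrite (_ : derive1 f = f')//.
by apply/funext => x; rewrite derive1E; have h := df x; rewrite derive_val.
Qed.

(** The classical flat function with an inverse power in front. The family is closed under
    differentiation, since the derivative combines the members [n + 1] and [n + 2]; one induction
    thus covers all orders. *)
Definition flat n (t : R) : R := if 0 < t then t ^- n * expR (- t^-1) else 0.

(** One term of the exponential series, [expR (1/t) >= t^-(n+2) / (n+2)!], beats the inverse power
    with [t^2] to spare. A quadratic bound is what differentiability at 0 with derivative 0
    requires. *)
Lemma flat_bound n t : `|flat n t| <= (n.+2)`!%:R * t ^+ 2.
Proof.
rewrite /flat; case: ifPn => t0; last by rewrite normr0 mulr_ge0 ?sqr_ge0.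
rewrite ger0_norm; last by rewrite mulr_ge0 ?invr_ge0 ?exprn_ge0 ?expR_ge0 ?(ltW t0).
have f0 : 0 < (n.+2)`!%:R :> R by rewrite ltr0n fact_gt0.
have h : t ^- n.+2 / (n.+2)`!%:R <= expR t^-1.
  have := @expR_ge1Dxn R t^-1 n.+1 (ltac:(by rewrite invr_ge0 ltW)).
  by rewrite exprVn; lra.
rewrite expRN ler_pdivrMr ?expR_gt0//.
have h2 := ler_wpM2l (mulr_ge0 (ltW f0) (sqr_ge0 t)) h.
apply: le_trans h2; rewrite le_eqVlt; apply/orP; left; apply/eqP.
rewrite !exprSr; field.
by rewrite !gt_eqF// exprn_gt0.
Qed.

Lemma is_derive_sq_bound (f : R -> R) (c : R) : (forall t, `|f t| <= c * t ^+ 2) ->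
  is_derive (0 : R) 1 f 0.
Proof.
move=> fc; have f0 : f 0 = 0.
  by apply/eqP; rewrite -normr_le0 (le_trans (fc 0))// expr0n mulr0.
have c0 : 0 <= c by have := fc 1; rewrite expr1n mulr1; exact: le_trans.
have cv : (fun h => h^-1 *: ((f \o shift 0) (h *: (1 : R)) - f 0)) @ 0^' --> (0 : R).
  apply/cvgrPdist_le => e e0; near=> h.
  rewrite /= sub0r normrN f0 subr0 addr0 [h *: 1]mulr1 /GRing.scale/= normrM normfV.
  have h0 : h != 0 by near: h; exact: nbhs_dnbhs_neq.
  have hn : 0 < `|h| by rewrite normr_gt0.
  rewrite ler_pdivrMl//; apply: (le_trans (fc h)).
  rewrite -(real_normK (num_real h)) expr2 mulrCA ler_wpM2l//.
  have hl : `|h| <= e / (c + 1) by near: h; apply: dnbhs0_le; rewrite divr_gt0// ltr_pwDr.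
  have c1 : 0 < c + 1 by rewrite ltr_pwDr.
  rewrite ler_pdivlMr// in hl; have := normr_ge0 h; nra.
apply: DeriveDef; first exact: (cvgP _ cv).
exact: (cvg_lim _ cv).
Unshelve. all: by end_near. Qed.

Lemma is_derive_flat n (t : R) :
  is_derive t 1 (flat n) ((- n%:R) * flat n.+1 t + flat n.+2 t).
Proof.
have [t0|t0|->] := ltgtP t 0.
- rewrite /flat !ifF; [|by apply/negbTE; rewrite -leNgt ltW..].
  rewrite mulr0 addr0; apply: (near_eq_is_derive (f := cst 0)) => //.
  + near=> s; rewrite ifF//; apply/negbTE; rewrite -leNgt ltW//.
    by near: s; exact: lt_nbhsl.
- have t0' : t != 0 by rewrite gt_eqF.
  rewrite /flat !t0.
  apply: (@near_eq_is_derive R R R (fun s : R => s ^- n * expR (- s^-1))) => //.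
  + near=> s; rewrite /flat ifT//; near: s; exact: lt_nbhsr.
  have dV : is_derive t 1 (fun s : R => - s^-1) (t ^- 2).
    have h := @is_deriveV R id t 1 1 t0' (is_derive_id _ _).
    rewrite (_ : (fun s => _) = - (fun s : R => s^-1)); last by apply/funext.
    by apply: is_derive_eq; rewrite /GRing.scale/= mulr1 opprK.
  have dE := @is_derive1_comp R expR (fun s => - s^-1) t _ _ (is_derive_expR _) dV.
  have dX : is_derive t 1 (fun s : R => s ^- n) (- n%:R * t ^- n.+1).
    elim: (n) => [|m IH].
      rewrite mulNr mul0r oppr0 (_ : (fun s => _) = cst 1); first exact: is_derive_cst.
      by apply/funext => s; rewrite expr0 invr1.
    rewrite (_ : (fun s => _) = (fun s : R => s ^- m) * (fun s : R => s^-1)); last first.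
      by apply/funext => s; rewrite exprSr invfM.
    have dV' : is_derive t 1 (fun s : R => s^-1) (- t ^- 2).
      have h := @is_deriveV R id t 1 1 t0' (is_derive_id _ _).
      by apply: (is_derive_eq h); rewrite /GRing.scale/= mulr1.
    apply: is_derive_eq; rewrite /GRing.scale/= -natr1 !exprSr expr0.
    by field; rewrite expf_neq0 t0'.
  rewrite (_ : (fun s => _) = (fun s : R => s ^- n) * (expR \o (fun s => - s^-1))); last by apply/funext.
  apply: is_derive_eq; rewrite /GRing.scale/= !exprSr expr0.
  by field; rewrite expf_neq0 t0'.
- rewrite /flat ltxx mulr0 addr0; apply: is_derive_sq_bound; exact: flat_bound.
Unshelve. all: by end_near. Qed.

Lemma Cn_flat N n : Cn N (flat n).
Proof.
elim: N n => [//|N IH] n.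
exists (fun t => - n%:R * flat n.+1 t + flat n.+2 t); first exact: is_derive_flat.
by apply: (@CnD N (fun t => - n%:R * flat n.+1 t) (flat n.+2)) => //; exact: CnZ.
Qed.

Definition bumpR (a b x : R) := flat 0 (x - a) * flat 0 (b - x).

Lemma smoothR_bumpR a b : smoothR (bumpR a b).
Proof.
move=> n; apply: (@CnM n (fun x => flat 0 (x - a)) (fun x => flat 0 (b - x))).
  have := Cn_affine 1 (- a) (@Cn_flat n 0).
  by under eq_fun do rewrite mul1r.
have := Cn_affine (- 1) b (@Cn_flat n 0).
by under eq_fun do rewrite mulN1r addrC.
Qed.

Lemma flat_ge0 n t : 0 <= flat n t.
Proof. by rewrite /flat; case: ifP => // t0; rewrite mulr_ge0 ?expR_ge0// invr_ge0 exprn_ge0// ltW. Qed.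

Lemma flat_gt0 n t : 0 < t -> 0 < flat n t.
Proof. by rewrite /flat => t0; rewrite t0 mulr_gt0 ?expR_gt0// invr_gt0 exprn_gt0. Qed.

Lemma bumpR_ge0 a b x : 0 <= bumpR a b x.
Proof. by rewrite mulr_ge0 ?flat_ge0. Qed.

Lemma bumpR_gt0 a b x : a < x < b -> 0 < bumpR a b x.
Proof. by move=> /andP[ax xb]; rewrite mulr_gt0 ?flat_gt0 ?subr_gt0. Qed.

Lemma bumpR_out a b x : ~ (a < x < b) -> bumpR a b x = 0.
Proof.
move=> /negP; rewrite negb_and -!leNgt /bumpR /flat => /orP[xa|bx].
  by rewrite ifF ?mul0r//; apply/negbTE; rewrite -leNgt subr_le0.
by rewrite [X in _ * X]ifF ?mulr0//; apply/negbTE; rewrite -leNgt subr_le0.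
Qed.

Lemma smoothRD f g : smoothR f -> smoothR g -> smoothR (fun x => f x + g x).
Proof. by move=> sf sg n; apply: (@CnD n f g). Qed.

Lemma smoothRM f g : smoothR f -> smoothR g -> smoothR (fun x => f x * g x).
Proof. by move=> sf sg n; apply: (@CnM n f g). Qed.

Lemma smoothRZ f (c : R) : smoothR f -> smoothR (fun x => c * f x).
Proof. by move=> sf n; exact: CnZ. Qed.

Lemma smoothR_cst (c : R) : smoothR (fun=> c).
Proof. by move=> n; exact: Cn_cst. Qed.

Lemma smoothR_cos (k : R) : smoothR (fun x => cos (k * x)).
Proof.
move=> n; have := Cn_affine k 0 (Cn_trig n).1.
by under eq_fun do rewrite addr0.
Qed.

Lemma smoothR_sin (k : R) : smoothR (fun x => sin (k * x)).
Proof.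
move=> n; have := Cn_affine k 0 (Cn_trig n).2.
by under eq_fun do rewrite addr0.
Qed.

End SmoothReal.

Section DuBoisReymond.
Context {R : realType}.
Notation mu := (@lebesgue_measure R).
Implicit Types (f g h : R -> R) (T : R).

Definition testR T (chi : R -> R) := smoothR chi /\
  exists a b : R, [/\ 0 < a, b < T & forall t, ~ (a <= t <= b) -> chi t = 0].

Lemma within_integrable a b f : {within `[a, b], continuous f} ->
  mu.-integrable `[a, b] (EFin \o f).
Proof. by move=> cf; apply: continuous_compact_integrable => //; exact: segment_compact. Qed.

Lemma withinM a b f g : {within `[a, b], continuous f} -> {within `[a, b], continuous g} ->
  {within `[a, b], continuous (fun x => f x * g x)}.
Proof. by move=> cf cg x; apply: cvgM; [exact: cf|exact: cg]. Qed.

Lemma smoothR_within a b f : smoothR f -> {within `[a, b], continuous f}.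
Proof. by move=> sf; apply: continuous_subspaceT => x; exact: smoothR_continuous. Qed.

Lemma derive1P f (x d : R) : is_derive x 1 f d -> derive1 f x = d.
Proof. by move=> h; rewrite derive1E derive_val. Qed.

Definition prim f (x : R) : R := \int[mu]_(t in `[0, x]) f t.

(** The hypothesis that [f] vanishes before [a > 0] yields the derivative at every real [x], also at
    [x <= 0], where [prim f] is locally zero. *)
Lemma is_derive_prim f (a x : R) : 0 < a -> continuous f -> (forall t, t < a -> f t = 0) ->
  is_derive x 1 (prim f) (f x).
Proof.
move=> a0 cf fa; have [x0|x0] := ltP 0 x.
  have x1 : x < x + 1 by rewrite ltrDl.
  have intf : mu.-integrable `[0, x + 1] (EFin \o f).
    by apply: within_integrable; apply: continuous_subspaceT.
  have [h1 h2] := continuous_FTC1_closed x1 intf x0 (cf x).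
  apply: DeriveDef; [exact: h1|rewrite -derive1E; exact: h2].
have xa : x < a by apply: le_lt_trans a0.
rewrite fa//; apply: (near_eq_is_derive (f := cst 0)) => //.
near=> y; rewrite /prim; apply/esym.
rewrite (@eq_Rintegral _ _ _ _ _ (cst 0)); first by rewrite Rintegral_cst// mul0r.
move=> z; rewrite inE/= in_itv/= => /andP[_ zy]; apply: fa; apply: (le_lt_trans zy).
by near: y; exact: lt_nbhsl.
Unshelve. all: by end_near. Qed.

Lemma prim0 f (a x : R) : (forall t, t < a -> f t = 0) -> x < a -> prim f x = 0.
Proof.
move=> fa xa; rewrite /prim (@eq_Rintegral _ _ _ _ _ (cst 0)); first by rewrite Rintegral_cst// mul0r.
by move=> z; rewrite inE/= in_itv/= => /andP[_ zy]; apply: fa; apply: (le_lt_trans zy).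
Qed.

Lemma prim_const f (b x : R) : continuous f -> (forall t, b < t -> f t = 0) -> 0 <= b ->
  b <= x -> prim f x = prim f b.
Proof.
move=> cf fb b0 bx; apply/eqP; rewrite -subr_eq0; apply/eqP.
rewrite /prim Rintegral_itvB; [|by apply: within_integrable; apply: continuous_subspaceT|by rewrite bnd_simp|by rewrite bnd_simp].
rewrite (@eq_Rintegral _ _ _ _ _ (cst 0)); first by rewrite Rintegral_cst// mul0r.
by move=> z; rewrite inE/= in_itv/= => /andP[bz _]; apply: fb.
Qed.

Lemma bumpR_mass T (a b : R) : 0 < a -> a < b -> b < T -> 0 < prim (bumpR a b) T.
Proof.
move=> a0 ab bT; have cb := smoothR_continuous (@smoothR_bumpR R a b).
have z t : t < a -> bumpR a b t = 0 by move=> ta; rewrite bumpR_out//; lra.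
have dP x := @is_derive_prim _ _ x a0 cb z.
have cP : continuous (prim (bumpR a b)).
  by move=> x; apply/differentiable_continuous/derivable1_diffP; have h := dP x; exact: ex_derive.
have mid : a < (a + b) / 2 < b by lra.
have [|x xI h1] := @MVT R (prim (bumpR a b)) (bumpR a b) a b ab (fun x _ => dP x).
  exact: continuous_subspaceT.
have [|y yI h2] := @MVT R (prim (bumpR a b)) (bumpR a b) b T bT (fun x _ => dP x).
  exact: continuous_subspaceT.
have [|v vI h3] := @MVT R (prim (bumpR a b)) (bumpR a b) 0 a a0 (fun x _ => dP x).
  exact: continuous_subspaceT.
have P0 : prim (bumpR a b) 0 = 0 by rewrite (@prim0 _ a).
have p1 : 0 < bumpR a b x * (b - a).
  by rewrite mulr_gt0 ?subr_gt0//; apply: bumpR_gt0; move: xI; rewrite in_itv.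
have p2 : 0 <= bumpR a b y * (T - b) by rewrite mulr_ge0 ?bumpR_ge0// subr_ge0 ltW.
have p3 : 0 <= bumpR a b v * (a - 0) by rewrite mulr_ge0 ?bumpR_ge0// subr0 ltW.
lra.
Qed.

Lemma testR_prim T f (a b : R) : 0 < a -> a <= b -> b < T -> smoothR f ->
  (forall t, ~ (a <= t <= b) -> f t = 0) -> prim f T = 0 -> testR T (prim f).
Proof.
move=> a0 ab bT sf fz fT; have cf := smoothR_continuous sf.
have z1 t : t < a -> f t = 0 by move=> ta; apply: fz; lra.
have z2 t : b < t -> f t = 0 by move=> ta; apply: fz; lra.
split; first exact: smoothR_primitive (fun x => is_derive_prim x a0 cf z1) sf.
exists a, b; split=> // t /negP; rewrite negb_and -!ltNge => /orP[ta|bt]; first exact: prim0 ta.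
have b0 : 0 <= b by apply: le_trans ab; exact: ltW.
by rewrite (prim_const cf z2 b0 (ltW bt)) -(prim_const cf z2 b0 (ltW bT)).
Qed.

(** The inequality for all pairs is constancy, by symmetry. If it fails, two bumps around [s1] and
    [s2], weighted to total mean zero, have a primitive that is an admissible test function, and
    pairing with [f] gives a positive number. *)
Lemma du_bois_reymond0 T f : {within `[0, T], continuous f} ->
  (forall chi, testR T chi -> \int[mu]_(t in `[0, T]) (f t * derive1 chi t) = 0) ->
  forall s1 s2, 0 < s1 < T -> 0 < s2 < T -> f s1 <= f s2.
Proof.
move=> cf hf s1 s2 s1T s2T; rewrite leNgt; apply/negP => ff.
pose c1 := (f s1 + f s2) / 2.
have near_pt s (e : R) : 0 < s < T -> 0 < e -> exists2 d, 0 < d &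
    [/\ 0 < s - d, s + d < T & forall x, s - d < x < s + d -> `|f s - f x| < e].
  move=> /andP[s0 sT] e0.
  have T0 : 0 < T by exact: lt_trans sT.
  have [cfi _ _] := (continuous_within_itvP f T0).1 cf.
  have := cfi s; rewrite in_itv/= s0 sT => /(_ isT)/cvgrPdist_lt/(_ e e0).
  move=> /nbhs_ballP[d /= d0 hd].
  exists (Num.min d (Num.min s (T - s)) / 2).
    by rewrite divr_gt0// !lt_min d0 s0 subr_gt0.
  set m := Num.min _ _.
  have m1 : m <= d by rewrite ge_min lexx.
  have m2 : m <= s by rewrite !ge_min lexx orbT.
  have m3 : m <= T - s by rewrite !ge_min lexx !orbT.
  split; [lra|lra|move=> x xs; apply: hd].
  by rewrite /ball/= ltr_norml; lra.
have e0 : 0 < (f s1 - f s2) / 4 by lra.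
have [d1 d10 [a1 b1 h1]] := near_pt _ _ s1T e0.
have [d2 d20 [a2 b2 h2]] := near_pt _ _ s2T e0.
pose p1 := bumpR (s1 - d1) (s1 + d1); pose p2 := bumpR (s2 - d2) (s2 + d2).
pose m1 := prim p1 T; pose m2 := prim p2 T.
have m10 : 0 < m1 by apply: bumpR_mass => //; lra.
have m20 : 0 < m2 by apply: bumpR_mass => //; lra.
(* The weights make the integral of [p] vanish, so its primitive is again zero to the right of both
   bumps. *)
pose p x := m2 * p1 x + - m1 * p2 x.
have sp1 : smoothR p1 := smoothR_bumpR _ _.
have sp2 : smoothR p2 := smoothR_bumpR _ _.
have sp : smoothR p by apply: smoothRD; apply: smoothRZ.
have int g : smoothR g -> mu.-integrable `[0, T] (EFin \o g).
  by move=> sg; apply: within_integrable; exact: smoothR_within.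
have intf g : smoothR g -> mu.-integrable `[0, T] (EFin \o (fun x => f x * g x)).
  by move=> sg; apply: within_integrable; apply: withinM => //; exact: smoothR_within.
have mI : measurable (`[0, T]%classic : set (measurableTypeR R)) by exact: measurable_itv.
have pT : prim p T = 0.
  rewrite /prim RintegralD//; [|exact: int (smoothRZ _ sp1)|exact: int (smoothRZ _ sp2)].
  rewrite !RintegralZl//; [|exact: int|exact: int].
  by rewrite -/(prim p1 T) -/(prim p2 T) -/m1 -/m2; ring.
pose a := Num.min (s1 - d1) (s2 - d2); pose b := Num.max (s1 + d1) (s2 + d2).
have ha1 : a <= s1 - d1 by rewrite ge_min lexx.
have ha2 : a <= s2 - d2 by rewrite ge_min lexx orbT.
have hb1 : s1 + d1 <= b by rewrite le_max lexx.
have hb2 : s2 + d2 <= b by rewrite le_max lexx orbT.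
have a0 : 0 < a by rewrite lt_min a1 a2.
have bT : b < T by rewrite gt_max b1 b2.
have pz t : ~ (a <= t <= b) -> p t = 0.
  move=> h; rewrite /p /p1 /p2 !bumpR_out ?mulr0 ?addr0// => /andP[u v]; apply: h; apply/andP; split; lra.
have ab : a <= b by lra.
have tp := testR_prim a0 ab bT sp pz pT.
have := hf _ tp.
have -> : derive1 (prim p) = p.
  apply/funext => x; apply: derive1P; apply: is_derive_prim a0 (smoothR_continuous sp) _.
  by move=> t ta; apply: pz; move=> /andP[u _]; move: ta; rewrite ltNge u.
have -> : \int[mu]_(t in `[0, T]) (f t * p t) =
    m2 * \int[mu]_(t in `[0, T]) (f t * p1 t) + - m1 * \int[mu]_(t in `[0, T]) (f t * p2 t).
  rewrite -!RintegralZl//; [|exact: intf|exact: intf].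
  rewrite -RintegralD//; last 2 first.
  - by apply: within_integrable; apply: withinM; [move=> x; exact: cvg_cst|apply: withinM => //; exact: smoothR_within].
  - by apply: within_integrable; apply: withinM; [move=> x; exact: cvg_cst|apply: withinM => //; exact: smoothR_within].
  by apply: eq_Rintegral => x _; rewrite /p; ring.
have I1 : (f s1 - (f s1 - f s2) / 4) * m1 <= \int[mu]_(t in `[0, T]) (f t * p1 t).
  rewrite /m1 /prim -RintegralZl//; last exact: int.
  apply: le_Rintegral => //; [exact: int (smoothRZ _ sp1)|exact: intf|move=> x _].
  have [xs|xs] := boolP (s1 - d1 < x < s1 + d1); last by rewrite /p1 bumpR_out ?mulr0//; exact/negP.
  by rewrite ler_wpM2r ?bumpR_ge0//; have := h1 x xs; rewrite ltr_norml; lra.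
have I2 : \int[mu]_(t in `[0, T]) (f t * p2 t) <= (f s2 + (f s1 - f s2) / 4) * m2.
  rewrite /m2 /prim -RintegralZl; [|exact: mI|exact: int].
  apply: le_Rintegral => //; [exact: intf|exact: int (smoothRZ _ sp2)|move=> x _].
  have [xs|xs] := boolP (s2 - d2 < x < s2 + d2); last by rewrite /p2 bumpR_out ?mulr0//; exact/negP.
  by rewrite ler_wpM2r ?bumpR_ge0//; have := h2 x xs; rewrite ltr_norml; lra.
have J1 := ler_wpM2l (ltW m20) I1; have J2 := ler_wpM2l (ltW m10) I2.
have df : 0 < f s1 - f s2 by rewrite subr_gt0.
move: J1 J2 (mulr_gt0 (mulr_gt0 m10 m20) df).
move: (\int[mu]_(t in _) (f t * p1 t)) (\int[mu]_(t in _) (f t * p2 t)) => A1 A2.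
clear; lra.
Qed.

(** Integration by parts turns the term with [g] into one with [prim g], and the previous lemma
    shows that [f - prim g] is constant inside the interval. *)
Lemma du_bois_reymond T f g : 0 < T -> {within `[0, T], continuous f} ->
  {within `[0, T], continuous g} ->
  (forall chi, testR T chi -> \int[mu]_(t in `[0, T]) (f t * derive1 chi t) +
     \int[mu]_(t in `[0, T]) (g t * chi t) = 0) ->
  forall t, 0 < t < T -> is_derive t 1 f (g t).
Proof.
move=> T0 cf cg hfg.
have intg : mu.-integrable `[0, T] (EFin \o g) by exact: within_integrable.
have cP : {within `[0, T], continuous (prim g)} := parameterized_integral_continuous (ltW T0) intg.
have cgi x : 0 < x < T -> {for x, continuous g}.
  by move=> xT; have [h _ _] := (continuous_within_itvP g T0).1 cg; apply: h; rewrite in_itv.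
have dP x : 0 < x < T -> is_derive x 1 (prim g) (g x).
  move=> /andP[x0 xT].
  have [h1 h2] := continuous_FTC1_closed xT intg x0 (cgi x (introT andP (conj x0 xT))).
  apply: DeriveDef; [exact: h1|rewrite -derive1E; exact: h2].
have cH : {within `[0, T], continuous (fun x => f x - prim g x)}.
  by move=> x; apply: cvgB; [exact: cf|exact: cP].
have H s1 s2 : 0 < s1 < T -> 0 < s2 < T -> f s1 - prim g s1 <= f s2 - prim g s2.
  apply: (du_bois_reymond0 cH) => chi tchi; have [schi [a [b [a0 bT chiz]]]] := tchi.
  have sd := smoothR_derive1 schi.
  have chi0 : chi 0 = 0 by apply: chiz; lra.
  have chiT : chi T = 0 by apply: chiz; lra.
  have LR (F : R -> R) : {within `[0, T], continuous F} -> (forall x, 0 < x < T -> derivable F x 1) ->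
      derivable_oo_LRcontinuous F 0 T.
    move=> cF dF; have [h1 h2 h3] := (continuous_within_itvP F T0).1 cF.
    by split => // x; rewrite in_itv/=; exact: dF.
  have ibp := @Rintegration_by_parts R chi (prim g) (derive1 chi) g 0 T T0
     (@smoothR_within 0 T _ sd)
     (LR chi (@smoothR_within 0 T _ schi) (fun x _ => @smoothR_derivable R chi x schi))
     (fun x _ => erefl) cg
     (LR (prim g) cP (fun x xT => @ex_derive _ _ _ _ _ _ _ (dP x xT))).
  have hg : {in `]0, T[, derive1 (prim g) =1 g}.
    by move=> x; rewrite in_itv/= => xT; apply: derive1P; exact: dP.
  move: (ibp hg); rewrite chi0 chiT !mul0r subrr sub0r => ibp'.
  have := hfg chi tchi.
  rewrite (@eq_Rintegral _ _ _ mu _ (fun t => chi t * g t) (fun t => g t * chi t)); last first.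
    by move=> x _; rewrite mulrC.
  rewrite ibp' -RintegralB//; last 2 first.
  - by apply: within_integrable; apply: withinM => //; exact: smoothR_within.
  - by apply: within_integrable; apply: withinM => //; exact: smoothR_within.
  move=> hh; rewrite -[RHS]hh; apply: eq_Rintegral => x _.
  by rewrite mulrBl; congr (_ - _); rewrite mulrC.
move=> t tT; have h := dP t tT.
have C x : 0 < x < T -> prim g x + (f t - prim g t) = f x.
  move=> xT; have := H x t xT tT; have := H t x tT xT; lra.
apply: (near_eq_is_derive (f := prim g + cst (f t - prim g t))); last first.
  by apply: is_derive_eq; rewrite addr0.
case/andP: tT => t0 tT.
near=> x; apply: C; apply/andP; split; near: x; [exact: lt_nbhsr|exact: lt_nbhsl].
Unshelve. all: by end_near. Qed.

End DuBoisReymond.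

(** * Fourier coefficients on the torus *)

Section TorusIntegral.
Context {R : realType}.
Notation tau := (@torus_measure R).
Notation mu := (@lebesgue_measure R).
Notation D := (@torus_dom R).
Implicit Types (f g : R -> R).

Definition I1 f := tau.-integrable setT (EFin \o f).
Definition J f : R := \int[tau]_x f x.
Definition mf f := measurable_fun (setT : set (measurableTypeR R)) f.

Lemma tauE (A : set R) : tau A = mu (A `&` D). Proof. by []. Qed.

Lemma two_pi_gt0 : 0 < (pi *+ 2 : R).
Proof. by rewrite mulrn_wgt0// pi_gt0. Qed.

Lemma tau_setT : tau setT = (pi *+ 2)%:E.
Proof.
rewrite tauE setTI /torus_dom lebesgue_measure_itv/= lte_fin two_pi_gt0.
by rewrite -EFinB subr0.
Qed.

Lemma tau_fin : (tau setT < +oo)%E. Proof. by rewrite tau_setT ltry. Qed.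

Lemma mD : measurable (D : set (measurableTypeR R)).
Proof. exact: measurable_torus_dom. Qed.

Lemma tauC : tau (~` D) = 0%E.
Proof. by rewrite tauE setICl measure0. Qed.

Lemma I1_mf f : I1 f -> mf f.
Proof. by move=> /integrableP[/measurable_EFinP]. Qed.

Lemma ge0_integral_tau (f : R -> \bar R) : measurable_fun (setT : set (measurableTypeR R)) f ->
  (forall x, (0 <= f x)%E) -> (\int[tau]_x f x = \int[mu]_(x in D) f x)%E.
Proof.
move=> hf f0.
have -> : (\int[tau]_x f x = \int[tau]_(x in D) f x)%E.
  have := @ge0_negligible_integral _ _ _ tau setT (~` D) f (measurableC mD) measurableT hf
    (fun x _ => f0 x) tauC.
  by rewrite setTD setCK.
apply: eq_measure_integral => A mA AD.
by rewrite tauE setIidl.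
Qed.

Lemma I1P f : mf f -> I1 f <-> mu.-integrable D (EFin \o f).
Proof.
move=> hf; have E : (\int[tau]_x `|(f x)%:E| = \int[mu]_(x in D) `|(f x)%:E|)%E.
  by rewrite ge0_integral_tau//; apply: measurableT_comp => //; exact/measurable_EFinP.
split=> /integrableP[_ h]; apply/integrableP; split.
- by apply/measurable_EFinP; apply: measurable_funS hf.
- by move: h; rewrite E.
- exact/measurable_EFinP.
- by rewrite E.
Qed.

Lemma JE f : I1 f -> J f = \int[mu]_(x in D) f x.
Proof.
move=> hf; rewrite /J /Rintegral; congr fine.
have -> : (\int[tau]_x (f x)%:E = \int[tau]_(x in D) (f x)%:E)%E.
  have := @negligible_integral _ _ _ tau setT (~` D) _ (measurableC mD) measurableT hf tauC.
  by rewrite setTD setCK.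
apply: eq_measure_integral => A mA AD.
by rewrite tauE setIidl.
Qed.

Lemma mf_cont f : continuous f -> mf f.
Proof. by move=> cf; apply: continuous_measurable_fun. Qed.

Lemma mfD f g : mf f -> mf g -> mf (fun x => f x + g x).
Proof. by move=> hf hg; apply: measurable_funD. Qed.
Lemma mfB f g : mf f -> mf g -> mf (fun x => f x - g x).
Proof. by move=> hf hg; apply: measurable_funB. Qed.
Lemma mfM f g : mf f -> mf g -> mf (fun x => f x * g x).
Proof. by move=> hf hg; apply: measurable_funM. Qed.
Lemma mf_cst c : mf (fun=> c). Proof. exact: measurable_cst. Qed.
Lemma mfZ f c : mf f -> mf (fun x => c * f x).
Proof. by move=> hf; apply: mfM => //; exact: mf_cst. Qed.

Lemma I1_le f g : mf f -> (forall x, `|f x| <= g x) -> I1 g -> I1 f.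
Proof.
move=> hf fg ig.
have h := @le_integrable _ _ _ tau setT measurableT (EFin \o f) (EFin \o g).
apply: h => //; first exact/measurable_EFinP.
by move=> x _ /=; rewrite lee_fin (le_trans (fg x))// ler_norm.
Qed.

Lemma I1_cst c : I1 (fun=> c).
Proof.
apply: measurable_bounded_integrable; [exact: measurableT|exact: tau_fin|exact: mf_cst|].
by exists `|c|; split; rewrite ?num_real// => y cy x _; exact: ltW.
Qed.

Lemma I1_bounded f (c : R) : mf f -> (forall x, `|f x| <= c) -> I1 f.
Proof. by move=> hf fc; apply: I1_le fc (I1_cst c). Qed.

Lemma I1D f g : I1 f -> I1 g -> I1 (fun x => f x + g x).
Proof. by move=> hf hg; exact: (integrableD measurableT hf hg). Qed.
Lemma I1B f g : I1 f -> I1 g -> I1 (fun x => f x - g x).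
Proof. by move=> hf hg; exact: (integrableB measurableT hf hg). Qed.
Lemma I1Z f c : I1 f -> I1 (fun x => c * f x).
Proof. by move=> hf; exact: (integrableZl measurableT c hf). Qed.
Lemma I1_abs f : I1 f -> I1 (fun x => `|f x|).
Proof. by move=> hf; exact: (integrable_abse hf). Qed.

Lemma JD f g : I1 f -> I1 g -> J (fun x => f x + g x) = J f + J g.
Proof. by move=> hf hg; rewrite /J RintegralD. Qed.
Lemma JB f g : I1 f -> I1 g -> J (fun x => f x - g x) = J f - J g.
Proof. by move=> hf hg; rewrite /J RintegralB. Qed.
Lemma JZ f c : I1 f -> J (fun x => c * f x) = c * J f.
Proof. by move=> hf; rewrite /J RintegralZl. Qed.
Lemma J_cst c : J (fun=> c) = c * (pi *+ 2).
Proof. by rewrite /J Rintegral_cst// tau_setT. Qed.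
Lemma J_ge0 f : (forall x, 0 <= f x) -> 0 <= J f.
Proof. by move=> f0; apply: Rintegral_ge0. Qed.
Lemma J_le f g : I1 f -> I1 g -> (forall x, f x <= g x) -> J f <= J g.
Proof. by move=> hf hg fg; apply: le_Rintegral. Qed.
Lemma J_abs f : I1 f -> `|J f| <= J (fun x => `|f x|).
Proof. by move=> hf; apply: le_normr_Rintegral. Qed.
Lemma J_ext f g : f =1 g -> J f = J g.
Proof. by move=> /funext ->. Qed.

Definition sq f := mf f /\ I1 (fun x => f x ^+ 2).

Lemma sq_mf f : sq f -> mf f. Proof. by case. Qed.

Lemma sq_I1M f g : sq f -> sq g -> I1 (fun x => f x * g x).
Proof.
move=> [m1 i1] [m2 i2]; apply: (I1_le (mfM m1 m2) _ (I1D i1 i2)) => x.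
rewrite ler_norml; have := sqr_ge0 (f x - g x); have := sqr_ge0 (f x + g x); nra.
Qed.

Lemma sqM_bounded f g : sq f -> mf g -> (forall x, `|g x| <= 1) -> sq (fun x => f x * g x).
Proof.
move=> [m1 i1] m2 g1; split; first exact: mfM.
apply: (I1_le _ _ i1) => [|x]; first exact: (mfM (mfM m1 m2) (mfM m1 m2)).
rewrite exprMn normrM ger0_norm ?sqr_ge0// ler_piMr ?sqr_ge0//.
by rewrite normrX expr_le1.
Qed.

Lemma I1M_bounded f g : I1 f -> mf g -> (forall x, `|g x| <= 1) -> I1 (fun x => f x * g x).
Proof.
move=> i1 m2 g1; apply: (I1_le _ _ (I1_abs i1)) => [|x]; first exact: mfM (I1_mf i1) m2.
by rewrite normrM ler_piMr.
Qed.

Lemma sqD f g : sq f -> sq g -> sq (fun x => f x + g x).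
Proof.
move=> sf sg; split; first exact: mfD (sq_mf sf) (sq_mf sg).
have h := I1D (I1D sf.2 sg.2) (I1Z 2 (sq_I1M sf sg)).
rewrite (_ : (fun x => _) = (fun x => f x ^+ 2 + g x ^+ 2 + 2 * (f x * g x)))//.
by apply/funext => x; ring.
Qed.

Lemma sqZ f c : sq f -> sq (fun x => c * f x).
Proof.
move=> [m1 i1]; split; first exact: mfZ.
rewrite (_ : (fun x => _) = (fun x => c ^+ 2 * f x ^+ 2)); first exact: I1Z.
by apply/funext => x; rewrite exprMn.
Qed.

Lemma sqB f g : sq f -> sq g -> sq (fun x => f x - g x).
Proof.
move=> sf sg; have := sqD sf (sqZ (-1) sg).
by rewrite (_ : (fun x => f x + -1 * g x) = (fun x => f x - g x))//; apply/funext => x; rewrite mulN1r.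
Qed.

Lemma sq_bounded f (c : R) : mf f -> (forall x, `|f x| <= c) -> sq f.
Proof.
move=> hf fc; split=> //; apply: (@I1_bounded _ (c ^+ 2)); first exact: (mfM hf hf).
by move=> x; rewrite normrX lerXn2r ?nnegrE// (le_trans _ (fc x)).
Qed.

Lemma sq_I1 f : sq f -> I1 f.
Proof.
move=> sf; have s1 : sq (fun=> 1) by apply: (@sq_bounded _ 1); [exact: mf_cst|rewrite normr1].
by have := sq_I1M sf s1; under eq_fun do rewrite mulr1.
Qed.

Lemma J_sq_ge0 f : 0 <= J (fun x => f x ^+ 2).
Proof. by apply: J_ge0 => x; exact: sqr_ge0. Qed.

Lemma J_cs f g : sq f -> sq g ->
  J (fun x => f x * g x) ^+ 2 <= J (fun x => f x ^+ 2) * J (fun x => g x ^+ 2).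
Proof.
move=> sf sg; set A := J (fun x => f x ^+ 2); set B := J (fun x => g x ^+ 2).
set C := J _.
have H (t : R) : 0 <= A + 2 * t * C + t ^+ 2 * B.
  have := J_sq_ge0 (fun x => f x + t * g x).
  rewrite (J_ext (g := fun x => f x ^+ 2 + (2 * t) * (f x * g x) + t ^+ 2 * g x ^+ 2)); last first.
    by move=> x; ring.
  rewrite JD; [|exact: (I1D sf.2 (I1Z _ (sq_I1M sf sg)))|exact: I1Z sg.2].
  by rewrite JD ?JZ//; [exact: sg.2|exact: sq_I1M|exact: sf.2|exact: I1Z (sq_I1M sf sg)].
have B0 : 0 <= B by exact: J_sq_ge0.
have A0 : 0 <= A by exact: J_sq_ge0.
have [B00|Bn0] := eqVneq B 0.
  rewrite B00 mulr0.
  have [->|Cn0] := eqVneq C 0; first by rewrite expr0n.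
  (* In the degenerate case [B = 0] the quadratic polynomial is affine in [t]; this value of [t]
     would make it equal to -1. *)
  have := H (- (A + 1) / (2 * C)); rewrite B00 mulr0 addr0.
  rewrite (_ : A + 2 * (- (A + 1) / (2 * C)) * C = - 1); first by rewrite oppr_ge0 ler10.
  by field.
have Bp : 0 < B by rewrite lt_neqAle eq_sym Bn0.
have := H (- C / B).
rewrite (_ : A + 2 * (- C / B) * C + (- C / B) ^+ 2 * B = A - C ^+ 2 / B); last by field.
by rewrite subr_ge0 ler_pdivrMr.
Qed.

End TorusIntegral.

Section Fourier.
Context {R : realType}.
Notation tau := (@torus_measure R).
Notation twopi := (pi *+ 2 : R).
Implicit Types (f g : R -> R[i]) (k j : int).

(** [E k x] is [e^(-ikx)]: pairing with it extracts the [k]-th coefficient, while the Fourier series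
    itself is written with [E (- k)]. *)
Definition E k (x : R) : R[i] := (cos (k%:~R * x) -i* sin (k%:~R * x))%C.
Definition CI f : R[i] := cintegral tau setT f.
Definition cI1 f := I1 (fun x => complex.Re (f x)) /\ I1 (fun x => complex.Im (f x)).
Definition csq f := sq (fun x => complex.Re (f x)) /\ sq (fun x => complex.Im (f x)).
Definition fc f k : R[i] := fourier_coef (dist_of f) k.

Lemma CIE f : CI f = (J (fun x => complex.Re (f x)) +i* J (fun x => complex.Im (f x)))%C.
Proof. by []. Qed.

Lemma fcE f k : fc f k = (twopi^-1)%:C%C * CI (fun x => f x * E k x).
Proof. by []. Qed.

Lemma ReEk k x : complex.Re (E k x) = cos (k%:~R * x). Proof. by []. Qed.
Lemma ImEk k x : complex.Im (E k x) = - sin (k%:~R * x). Proof. by []. Qed.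

Lemma Ek0 x : E 0 x = 1.
Proof. by apply: complexP; rewrite ?ReEk ?ImEk mul0r ?cos0 ?sin0 ?oppr0. Qed.

Lemma EkM k j x : E k x * E j x = E (k + j) x.
Proof.
by apply: complexP; rewrite ?cReM ?cImM ?ReEk ?ImEk intrD mulrDl ?cosD ?sinD; ring.
Qed.

Lemma EkJ k x : conjc (E k x) = E (- k) x.
Proof. by apply: complexP; rewrite ?cReJ ?cImJ ?ReEk ?ImEk mulrNz mulNr ?cosN ?sinN. Qed.

Lemma nsqE1 k x : nsq (E k x) = 1.
Proof. by rewrite /nsq ReEk ImEk sqrrN cos2Dsin2. Qed.

Lemma nsq_cE k x (z : R[i]) : nsq (z * E k x) = nsq z.
Proof. by rewrite nsqM nsqE1 mulr1. Qed.

Lemma ReE_le1 k x : `|complex.Re (E k x)| <= 1.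
Proof. by rewrite ReEk cos_max. Qed.
Lemma ImE_le1 k x : `|complex.Im (E k x)| <= 1.
Proof. by rewrite ImEk normrN sin_max. Qed.
Lemma mfReE k : mf (fun x => complex.Re (E k x)).
Proof. by apply: mf_cont; apply: smoothR_continuous; exact: smoothR_cos. Qed.
Lemma mfImE k : mf (fun x => complex.Im (E k x)).
Proof.
apply: mf_cont; apply: smoothR_continuous.
rewrite (_ : (fun x => _) = (fun x => -1 * sin (k%:~R * x))); last by apply/funext => x; rewrite mulN1r.
by apply: smoothRZ; exact: smoothR_sin.
Qed.

Lemma cI1_ext f g : f =1 g -> cI1 f -> cI1 g.
Proof. by move=> /funext ->. Qed.
Lemma CI_ext f g : f =1 g -> CI f = CI g.
Proof. by move=> /funext ->. Qed.

Lemma csq_cI1 f : csq f -> cI1 f.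
Proof. by case=> a b; split; exact: sq_I1. Qed.

Lemma cI1D f g : cI1 f -> cI1 g -> cI1 (fun x => f x + g x).
Proof.
move=> [f1 f2] [g1 g2]; split.
  by rewrite (funext (fun x => cReD (f x) (g x))); exact: I1D.
by rewrite (funext (fun x => cImD (f x) (g x))); exact: I1D.
Qed.

Lemma cI1Z f (c : R[i]) : cI1 f -> cI1 (fun x => c * f x).
Proof.
move=> [f1 f2]; split.
  by rewrite (funext (fun x => cReM c (f x))); apply: I1B; exact: I1Z.
by rewrite (funext (fun x => cImM c (f x))); apply: I1D; exact: I1Z.
Qed.

Lemma cI1_cst (c : R[i]) : cI1 (fun=> c).
Proof. by split; exact: I1_cst. Qed.

Lemma cI1_sum I (r : seq I) (P : pred I) (F : I -> R -> R[i]) :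
  (forall i, P i -> cI1 (F i)) -> cI1 (fun x => \sum_(i <- r | P i) F i x).
Proof.
move=> h; elim: r => [|i r IH].
  by apply: cI1_ext (cI1_cst 0) => x; rewrite big_nil.
case Pi : (P i); last by apply: cI1_ext IH => x; rewrite big_cons Pi.
by apply: cI1_ext (cI1D (h i Pi) IH) => x; rewrite big_cons Pi.
Qed.

Lemma cI1ME f k : cI1 f -> cI1 (fun x => f x * E k x).
Proof.
move=> [f1 f2]; split.
  rewrite (funext (fun x => cReM (f x) (E k x))).
  apply: I1B; apply: I1M_bounded => //; by [exact: mfReE|exact: mfImE|exact: ReE_le1|exact: ImE_le1].
rewrite (funext (fun x => cImM (f x) (E k x))).
apply: I1D; apply: I1M_bounded => //; by [exact: mfReE|exact: mfImE|exact: ReE_le1|exact: ImE_le1].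
Qed.

Lemma csqD f g : csq f -> csq g -> csq (fun x => f x + g x).
Proof.
move=> [f1 f2] [g1 g2]; split.
  by rewrite (funext (fun x => cReD (f x) (g x))); exact: sqD.
by rewrite (funext (fun x => cImD (f x) (g x))); exact: sqD.
Qed.

Lemma csqZ f (c : R[i]) : csq f -> csq (fun x => c * f x).
Proof.
move=> [f1 f2]; split.
  by rewrite (funext (fun x => cReM c (f x))); apply: sqB; exact: sqZ.
by rewrite (funext (fun x => cImM c (f x))); apply: sqD; exact: sqZ.
Qed.

Lemma csqJ f : csq f -> csq (fun x => conjc (f x)).
Proof.
move=> [f1 f2]; split; first by rewrite (funext (fun x => cReJ (f x))).
rewrite (funext (fun x => cImJ (f x))) (_ : (fun x => _) = (fun x => -1 * complex.Im (f x))).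
  exact: sqZ.
by apply/funext => x; rewrite mulN1r.
Qed.

Lemma csqME f k : csq f -> csq (fun x => f x * E k x).
Proof.
move=> [f1 f2]; split.
  rewrite (funext (fun x => cReM (f x) (E k x))).
  apply: sqB; apply: sqM_bounded => //; by [exact: mfReE|exact: mfImE|exact: ReE_le1|exact: ImE_le1].
rewrite (funext (fun x => cImM (f x) (E k x))).
apply: sqD; apply: sqM_bounded => //; by [exact: mfReE|exact: mfImE|exact: ReE_le1|exact: ImE_le1].
Qed.

Lemma csq_cI1M f g : csq f -> csq g -> cI1 (fun x => f x * g x).
Proof.
move=> [f1 f2] [g1 g2]; split.
  by rewrite (funext (fun x => cReM (f x) (g x))); apply: I1B; exact: sq_I1M.
by rewrite (funext (fun x => cImM (f x) (g x))); apply: I1D; exact: sq_I1M.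
Qed.

Lemma CID f g : cI1 f -> cI1 g -> CI (fun x => f x + g x) = CI f + CI g.
Proof.
move=> [f1 f2] [g1 g2]; apply: complexP.
  by rewrite cReD !CIE/= (funext (fun x => cReD (f x) (g x))) JD.
by rewrite cImD !CIE/= (funext (fun x => cImD (f x) (g x))) JD.
Qed.

Lemma CIZ f (c : R[i]) : cI1 f -> CI (fun x => c * f x) = c * CI f.
Proof.
move=> [f1 f2]; apply: complexP.
  rewrite cReM !CIE/= (funext (fun x => cReM c (f x))) JB ?JZ//; exact: I1Z.
rewrite cImM !CIE/= (funext (fun x => cImM c (f x))) JD ?JZ//; exact: I1Z.
Qed.

Lemma CI0 : CI (fun=> 0) = 0.
Proof. by apply: complexP; rewrite !CIE/= J_cst mul0r. Qed.

Lemma CI_sum I (r : seq I) (P : pred I) (F : I -> R -> R[i]) :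
  (forall i, P i -> cI1 (F i)) ->
  CI (fun x => \sum_(i <- r | P i) F i x) = \sum_(i <- r | P i) CI (F i).
Proof.
move=> h; elim: r => [|i r IH].
  by rewrite big_nil -[RHS]CI0; apply: CI_ext => x; rewrite big_nil.
rewrite big_cons; case: ifP => Pi; last first.
  by rewrite -IH; apply: CI_ext => x; rewrite big_cons Pi.
rewrite -IH -CID; [|exact: h|exact: cI1_sum].
by apply: CI_ext => x; rewrite big_cons Pi.
Qed.

Lemma CIJ f : cI1 f -> CI (fun x => conjc (f x)) = conjc (CI f).
Proof.
move=> [f1 f2]; apply: complexP.
  by rewrite cReJ !CIE/= (funext (fun x => cReJ (f x))).
rewrite cImJ !CIE/= (funext (fun x => cImJ (f x))) -mulN1r -JZ//.
by apply: J_ext => x; rewrite mulN1r.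
Qed.

Lemma cI1E k : cI1 (E k).
Proof. by apply: cI1_ext (cI1ME k (cI1_cst 1)) => x; rewrite mul1r. Qed.

Lemma csqE k : csq (E k).
Proof.
split; first by apply: (@sq_bounded _ _ 1); [exact: mfReE|exact: ReE_le1].
by apply: (@sq_bounded _ _ 1); [exact: mfImE|exact: ImE_le1].
Qed.

Lemma trig_periodic k : sin (k%:~R * twopi) = 0 /\ cos (k%:~R * twopi) = 1.
Proof.
have H n : sin (n%:R * twopi) = 0 /\ cos (n%:R * twopi) = 1.
  rewrite mulr_natl; split.
    by rewrite -[_ *+ n]add0r (periodicn (@sinD2pi R)) sin0.
  by rewrite -[_ *+ n]add0r (periodicn (@cosD2pi R)) cos0.
case: k => n; first exact: H.
by rewrite NegzE mulrNz mulNr sinN cosN; have [-> ->] := H n.+1; rewrite oppr0.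
Qed.

Lemma J_derive (F f : R -> R) : smoothR F -> (forall x : R, is_derive x 1 F (f x)) ->
  continuous f -> I1 f -> J f = F twopi - F 0.
Proof.
move=> sF dF cf i1; rewrite JE// /Rintegral.
rewrite (@continuous_FTC2 R f F 0 twopi)//; first exact: two_pi_gt0.
- exact: continuous_subspaceT.
- have cF := smoothR_continuous sF; split.
  + by move=> x _; exact: smoothR_derivable.
  + by apply: cvg_at_right_filter; exact: cF.
  + by apply: cvg_at_left_filter; exact: cF.
- by move=> x _; apply: derive1P; exact: dF.
Qed.

Lemma CI_E k : CI (E k) = if k == 0 then twopi%:C%C else 0.
Proof.
have [->|k0] := eqVneq k 0.
  rewrite (CI_ext (g := fun=> 1)); last exact: Ek0.
  by apply: complexP; rewrite CIE/= J_cst ?mul1r ?mul0r.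
have kR : (k%:~R : R) != 0 by rewrite intr_eq0.
have dl (x : R) : is_derive x 1 (fun y : R => k%:~R * y) k%:~R.
  rewrite (_ : (fun y => _) = k%:~R *: (id : R -> R)); last by apply/funext.
  by apply: is_derive_eq; rewrite /GRing.scale/= mulr1.
have [s2 c2] := trig_periodic k.
have ds (x : R) : is_derive x 1 (fun y => (k%:~R)^-1 * sin (k%:~R * y)) (cos (k%:~R * x)).
  have h := is_derive1_comp (is_derive_sin (k%:~R * x)) (dl x).
  rewrite (_ : (fun y => _) = (k%:~R : R)^-1 *: (sin \o (fun y : R => k%:~R * y))); last by apply/funext.
  by apply: is_derive_eq; rewrite /GRing.scale/= mulrCA mulVf ?mulr1.
have dc (x : R) : is_derive x 1 (fun y => (k%:~R)^-1 * cos (k%:~R * y)) (- sin (k%:~R * x)).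
  have h := is_derive1_comp (is_derive_cos (k%:~R * x)) (dl x).
  rewrite (_ : (fun y => _) = (k%:~R : R)^-1 *: (cos \o (fun y : R => k%:~R * y))); last by apply/funext.
  by apply: is_derive_eq; rewrite /GRing.scale/= mulrCA mulVf ?mulr1.
have [i1 i2] := cI1E k.
apply: complexP; rewrite CIE /=.
  rewrite (J_derive _ ds) ?s2 ?mulr0 ?sin0 ?mulr0 ?subr0//.
  - by apply: smoothRZ; exact: smoothR_sin.
  - by apply: smoothR_continuous; exact: smoothR_cos.
rewrite (J_derive _ dc) ?c2 ?mulr0 ?cos0 ?mulr1 ?subrr//.
- by apply: smoothRZ; exact: smoothR_cos.
- rewrite (_ : (fun x => _) = (fun x => -1 * sin (k%:~R * x))); last by apply/funext => x; rewrite mulN1r.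
  by apply: smoothR_continuous; apply: smoothRZ; exact: smoothR_sin.
Qed.

Lemma twopi_neq0 : twopi%:C%C != 0 :> R[i].
Proof. by rewrite (fmorph_eq0 (real_complex R)) gt_eqF ?two_pi_gt0. Qed.

Lemma CI_fc f k : CI (fun x => f x * E k x) = twopi%:C%C * fc f k.
Proof. by rewrite fcE mulrA -rmorphM/= divff ?gt_eqF ?two_pi_gt0// mul1r. Qed.

Lemma fcD f g k : cI1 f -> cI1 g -> fc (fun x => f x + g x) k = fc f k + fc g k.
Proof.
move=> hf hg; rewrite !fcE -mulrDr -CID; [|exact: cI1ME..].
by congr (_ * _); apply: CI_ext => x; rewrite mulrDl.
Qed.

Lemma fcZ f (c : R[i]) k : cI1 f -> fc (fun x => c * f x) k = c * fc f k.
Proof.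
move=> hf; rewrite !fcE [RHS]mulrCA -(CIZ c); last exact: cI1ME.
by congr (_ * _); apply: CI_ext => x; rewrite -mulrA.
Qed.

Lemma fcJ f k : cI1 f -> fc (fun x => conjc (f x)) k = conjc (fc f (- k)).
Proof.
move=> hf; rewrite !fcE conjcM -CIJ; last exact: cI1ME.
congr (_ * _); first by apply: complexP; rewrite ?cReJ ?cImJ/= ?oppr0.
by apply: CI_ext => x; rewrite conjcM EkJ opprK.
Qed.

Lemma fc_E k j : fc (E j) k = if j + k == 0 then 1 else 0.
Proof.
rewrite fcE (CI_ext (g := E (j + k))); last by move=> x; rewrite EkM.
rewrite CI_E; case: ifP; rewrite ?mulr0// => _.
by rewrite -rmorphM/= mulVf ?gt_eqF ?two_pi_gt0.
Qed.

Lemma fc_trig (r : seq int) (c : int -> R[i]) k : uniq r ->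
  fc (fun x => \sum_(j <- r) c j * E (- j) x) k = if k \in r then c k else 0.
Proof.
move=> ur; rewrite fcE.
rewrite (CI_ext (g := fun x => \sum_(j <- r) (c j * (E (- j) x * E k x)))); last first.
  by move=> x; rewrite mulr_suml; apply: eq_bigr => j _; rewrite mulrA.
rewrite CI_sum => [|j _]; last by apply: cI1Z; apply: cI1ME; exact: cI1E.
rewrite mulr_sumr.
under eq_bigr => j _.
  rewrite CIZ; last by apply: cI1ME; exact: cI1E.
  rewrite mulrCA -fcE fc_E addrC subr_eq0.
  over.
case: ifP => kr.
  rewrite (bigD1_seq k)//= eqxx mulr1 big1 ?addr0// => j jk.
  by rewrite eq_sym (negbTE jk) mulr0.
apply: big1_seq => j /andP[_ jr]; case: eqP; rewrite ?mulr0// => kj.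
by rewrite kj jr in kr.
Qed.

Lemma csq_trig (r : seq int) (c : int -> R[i]) : csq (fun x => \sum_(j <- r) c j * E (- j) x).
Proof.
elim: r => [|i r IH].
  by under eq_fun do rewrite big_nil; split; (apply: (@sq_bounded _ _ 0); [exact: mf_cst|by move=> x; rewrite /= normr0]).
by under eq_fun do rewrite big_cons; apply: csqD => //; apply: csqZ; exact: csqE.
Qed.

Definition JN f : R := J (fun x => nsq (f x)).

Lemma I1_nsq f : csq f -> I1 (fun x => nsq (f x)).
Proof. by move=> [[_ a] [_ b]]; exact: I1D. Qed.

Lemma JN_ge0 f : 0 <= JN f.
Proof. by apply: J_ge0 => x; exact: nsq_ge0. Qed.

Lemma CI_nsq f : csq f -> complex.Re (CI (fun x => f x * conjc (f x))) = JN f.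
Proof. by move=> sf; rewrite CIE/=; apply: J_ext => x; rewrite nsq_mulJ. Qed.

Lemma CI_conj_trig f (r : seq int) (c : int -> R[i]) : cI1 f ->
  CI (fun x => f x * conjc (\sum_(j <- r) c j * E (- j) x)) =
  twopi%:C%C * \sum_(j <- r) conjc (c j) * fc f j.
Proof.
move=> hf.
rewrite (CI_ext (g := fun x => \sum_(j <- r) (conjc (c j) * (f x * E j x)))); last first.
  move=> x; rewrite conjc_sum mulr_sumr; apply: eq_bigr => j _.
  by rewrite conjcM EkJ opprK mulrCA.
rewrite CI_sum => [|j _]; last by apply: cI1Z; exact: cI1ME.
rewrite mulr_sumr; apply: eq_bigr => j _; rewrite CIZ; last exact: cI1ME.
by rewrite CI_fc mulrCA.
Qed.

(** The partial sum [S] is orthogonal to [f - S], so by Pythagoras its squared norm is at most that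
    of [f]. *)
Lemma bessel f (r : seq int) : csq f -> uniq r ->
  twopi * \sum_(k <- r) nsq (fc f k) <= JN f.
Proof.
move=> sf ur; pose S x := \sum_(j <- r) fc f j * E (- j) x.
have sS : csq S by exact: csq_trig.
pose g x := f x + -1 * S x.
have sg : csq g by apply: csqD => //; exact: csqZ.
have gS : CI (fun x => g x * conjc (S x)) = 0.
  rewrite CI_conj_trig; last exact: csq_cI1.
  rewrite big1_seq ?mulr0// => j /andP[_ jr].
  rewrite fcD; [|exact: csq_cI1|by apply: csq_cI1; exact: csqZ].
  by rewrite fcZ ?fc_trig ?jr ?mulN1r ?subrr ?mulr0//; exact: csq_cI1.
have SS : JN S = twopi * \sum_(k <- r) nsq (fc f k).
  rewrite -CI_nsq// CI_conj_trig; last exact: csq_cI1.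
  have -> : \sum_(j <- r) conjc (fc f j) * fc S j = (\sum_(k <- r) nsq (fc f k))%:C%C.
    rewrite rmorph_sum/=; apply: eq_big_seq => j jr.
    by rewrite fc_trig// jr mulrC nsq_mulJ.
  by rewrite -rmorphM.
have -> : JN f = JN g + JN S + 2 * complex.Re (CI (fun x => g x * conjc (S x))).
  rewrite CIE/= /JN -JD; [|exact: I1_nsq..].
  have i1 : I1 (fun x => complex.Re (g x * conjc (S x))) by have [] := csq_cI1M sg (csqJ sS).
  rewrite -JZ// -JD; [|by apply: I1D; exact: I1_nsq|exact: I1Z].
  by apply: J_ext => x; rewrite /g /nsq !ReIm/=; ring.
by rewrite gS/= mulr0 addr0 SS lerDr JN_ge0.
Qed.

End Fourier.

(** * A nonnegative trigonometric kernel and [L^2] bounds by duality *)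

Section FejerKernel.
Context {R : realType}.
Notation twopi := (pi *+ 2 : R).
Implicit Types (k j : int) (n : nat).

(** The kernel has maximum [4^n] and mean ['C(2n, n)]. A comparison up to a factor linear in [n] is
    enough, because away from its peak the kernel is geometrically smaller than its maximum. *)
Lemma central_binomial n : (4 ^ n <= (n.*2 + 2) * 'C(n.*2, n))%N.
Proof.
elim: n => [//|n IH].
have h1 := mul_bin_diag n.*2.+2 n; have h2 := mul_bin_down n.*2.+1 n.
rewrite /= in h1 h2; rewrite doubleS expnS.
have e1 : (n.*2.+1 - n = n.+1)%N by rewrite -addnn -addnS addKn.
rewrite e1 in h2.
have e2 : 'C(n.*2.+2, n.+1) = (2 * 'C(n.*2.+1, n))%N.
  apply/eqP; rewrite -(eqn_pmul2l (ltn0Sn n)) -h1 mulnA; apply/eqP; congr (_ * _)%N.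
  by rewrite mulnC mul2n doubleS.
rewrite e2; move: IH h2; move: 'C(n.*2, n) 'C(n.*2.+1, n) (4 ^ n)%N => c d q.
rewrite -!muln2; nia.
Qed.

Lemma bin_le_central n m : ('C(n.*2, m) <= 'C(n.*2, n))%N.
Proof.
have up i : (i < n)%N -> ('C(n.*2, i) <= 'C(n.*2, i.+1))%N.
  move=> hi; rewrite -(leq_pmul2l (ltn0Sn i)) mul_bin_left leq_mul2r; apply/orP; right.
  by lia.
have low d : (d <= n)%N -> ('C(n.*2, n - d) <= 'C(n.*2, n))%N.
  elim: d => [|d IH] hd; first by rewrite subn0.
  apply: leq_trans (IH (ltnW hd)).
  by have := up (n - d.+1)%N ltac:(lia); rewrite subnSK.
have [mn|mn] := leqP m n; first by rewrite -(subKn mn) low// leq_subr.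
have [m2|m2] := leqP m n.*2; last by rewrite bin_small.
rewrite -bin_sub// (_ : n.*2 - m = n - (m - n))%N; first by apply: low; lia.
by lia.
Qed.

Lemma EkB k (x y : R) : E k (x - y) = E k x * E (- k) y.
Proof.
by apply: complexP; rewrite !(cReM, cImM, ReEk, ImEk) mulrNz mulrBr mulNr cosN sinN ?cosB ?sinB; ring.
Qed.

Lemma EkX k (x : R) n : E k x ^+ n = E (k *+ n) x.
Proof. by elim: n => [|n IH]; rewrite ?expr0 ?mulr0n ?Ek0// exprS IH EkM mulrS. Qed.

(** This is [|1 + e^(-ix)|^(2n)]: it is visibly nonnegative, and its Fourier coefficients are
    binomial, so its mass and the bound on its multipliers are explicit. *)
Definition kern n (x : R) : R := (2 + 2 * cos x) ^+ n.

Lemma kern_ge0 n x : 0 <= kern n x.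
Proof. by rewrite exprn_ge0//; have := cos_geN1 x; lra. Qed.

Definition kcoef n k : R := ('C(n.*2, absz (k + n%:Z)))%:R.

Lemma kernE n (x : R) : (kern n x)%:C%C = \sum_(k <- window n) (kcoef n k)%:C%C * E k x.
Proof.
have -> : (kern n x)%:C%C = (1 + E 1 x) ^+ n.*2 * E (- n%:Z) x.
  have e : (2 + 2 * cos x)%:C%C = (1 + E 1 x) ^+ 2 * E (-1) x.
    have -> : (1 + E 1 x) ^+ 2 * E (-1) x =
        E (-1) x + E 1 x * E (-1) x + E 1 x * E (-1) x + E 1 x * (E 1 x * E (-1) x) by ring.
    rewrite !EkM subrr addr0 Ek0; apply: complexP.
      by rewrite !cReD !ReEk mulN1r mul1r cosN /=; ring.
    by rewrite !cImD !ImEk mulN1r mul1r sinN /=; ring.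
  rewrite /kern rmorphXn/= e exprMn -exprM EkX mul2n.
  by congr (_ * E _ x); rewrite mulNrn pmulrn intz.
rewrite addrC exprDn mulr_suml /window big_map.
rewrite -(big_mkord xpredT (fun i => (E 1 x ^+ (n.*2 - i) * 1 ^+ i *+ 'C(n.*2, i)) * E (- n%:Z) x)).
rewrite big_nat_rev/= /index_iota subn0; apply: eq_big_seq => i.
rewrite mem_iota add0n => /andP[_ hi].
rewrite /kcoef subrK absz_nat expr1n mulr1 subSS subKn// EkX bin_sub// -mulr_natl -mulrA EkM.
congr (_ * E _ x); first by rewrite (rmorph_nat (real_complex R)).
by rewrite pmulrn intz.
Qed.

Definition rc (f : R -> R) : R -> R[i] := fun x => (f x)%:C%C.

Lemma cI1_rc (f : R -> R) : I1 f -> cI1 (rc f).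
Proof. by move=> h; split => //; exact: I1_cst. Qed.

Lemma csq_rc (f : R -> R) : sq f -> csq (rc f).
Proof.
move=> h; split => //; apply: (@sq_bounded _ _ 0); first exact: mf_cst.
by move=> x; rewrite /= normr0.
Qed.

Lemma CI_rc (f : R -> R) : CI (rc f) = (J f)%:C%C.
Proof. by apply: complexP; rewrite CIE//= J_cst mul0r. Qed.

Lemma JN_rc (f : R -> R) : JN (rc f) = J (fun x => f x ^+ 2).
Proof. by apply: J_ext => x; rewrite nsqC. Qed.

Definition cbin n : R := ('C(n.*2, n))%:R.

Lemma cbin_gt0 n : 0 < cbin n.
Proof. by rewrite ltr0n bin_gt0 -addnn leq_addr. Qed.

Lemma kcoef_le n k : 0 <= kcoef n k / cbin n <= 1.
Proof.
rewrite divr_ge0 ?ler0n//= ler_pdivrMr ?cbin_gt0// mul1r ler_nat.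
move: (absz _) => i.
exact: bin_le_central.
Qed.

(** Convolution with the kernel normalized to mean 1. It multiplies each Fourier coefficient by a
    number in [[0, 1]] and yields a trigonometric polynomial. *)
Definition smear n (phi : R -> R) (x : R) : R :=
  J (fun y => phi y * kern n (x - y)) / (twopi * cbin n).

Lemma mf_kern n (x : R) : mf (fun y => kern n (x - y)).
Proof.
apply: mf_cont; apply: smoothR_continuous.
have h : smoothR (fun y : R => 2 + 2 * cos (x - y)).
  apply: smoothRD; first exact: smoothR_cst.
  apply: smoothRZ => m; have := Cn_affine (-1) x (Cn_trig m).1.
  by rewrite (_ : (fun y => _) = (fun y => cos (x - y)))//; apply/funext => y; rewrite mulN1r addrC.
rewrite /kern; elim: n => [|n IH].
  by rewrite (_ : (fun y => _) = (fun=> 1)); [exact: smoothR_cst|apply/funext => y; rewrite expr0].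
rewrite (_ : (fun y => _) = (fun y => (2 + 2 * cos (x - y)) * (2 + 2 * cos (x - y)) ^+ n)).
  exact: smoothRM.
by apply/funext => y; rewrite exprS.
Qed.

Lemma kern_le n x : kern n x <= 4 ^+ n.
Proof.
have h1 := cos_geN1 x; have h2 := cos_le1 x.
by rewrite /kern lerXn2r// ?nnegrE; lra.
Qed.

Lemma I1_kern n (x : R) : I1 (fun y => kern n (x - y)).
Proof.
apply: (@I1_bounded _ _ (4 ^+ n)); first exact: mf_kern.
by move=> y; rewrite ger0_norm ?kern_ge0// kern_le.
Qed.

Lemma smearE n (phi : R -> R) x : I1 phi ->
  (smear n phi x)%:C%C = \sum_(k <- window n)
     (kcoef n k / cbin n)%:C%C * (E k x * fc (rc phi) (- k)).
Proof.
move=> iphi; rewrite /smear rmorphM/= -CI_rc.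
rewrite (CI_ext (g := fun y => \sum_(k <- window n)
    ((kcoef n k)%:C%C * E k x) * (rc phi y * E (- k) y))); last first.
  move=> y; rewrite /rc rmorphM/= kernE mulr_sumr; apply: eq_bigr => k _.
  by rewrite EkB; ring.
rewrite CI_sum => [|k _]; last by apply: cI1Z; apply: cI1ME; exact: cI1_rc.
rewrite mulr_suml; apply: eq_bigr => k _.
rewrite CIZ; last by apply: cI1ME; exact: cI1_rc.
rewrite CI_fc !rmorphM/= !fmorphV/= rmorphM/=.
have t0 := @twopi_neq0 R; have c0 : (cbin n)%:C%C != 0 :> R[i].
  by rewrite (fmorph_eq0 (real_complex R)) gt_eqF ?cbin_gt0.
move: t0 c0; move: (twopi%:C%C) ((cbin n)%:C%C) => t c t0 c0.
by field; rewrite t0 c0.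
Qed.

Lemma smear1 n x : smear n (fun=> 1) x = 1.
Proof.
apply: (@complexI R); rewrite smearE; last exact: I1_cst.
have fc1 k : fc (rc (fun=> 1)) k = if k == 0 then 1 else 0.
  rewrite -[in RHS](add0r k) -fc_E; congr (_ * _); apply: CI_ext => y.
  by rewrite Ek0.
have w0 : 0 \in window n by rewrite mem_window normr0.
rewrite (bigD1_seq 0 w0 (window_uniq n))/=.
rewrite fc1 oppr0 eqxx mulr1 Ek0 mulr1 /kcoef add0r absz_nat -/(cbin n) divff ?gt_eqF ?cbin_gt0//.
rewrite big1 ?addr0// => k k0.
by rewrite fc1 oppr_eq0 (negbTE k0) !mulr0.
Qed.

End FejerKernel.

Section WeakBound.
Context {R : realType}.
Notation D := (@torus_dom R).
Notation twopi := (pi *+ 2 : R).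
Implicit Types (k j : int) (n : nat) (phi f : R -> R).

Lemma J_kern n (x : R) : J (fun y => kern n (x - y)) = twopi * cbin n.
Proof.
have := smear1 n x; rewrite /smear => h.
rewrite -[RHS]mul1r -h mulfVK; last by rewrite mulf_neq0 ?gt_eqF ?two_pi_gt0 ?cbin_gt0.
by apply: J_ext => y; rewrite mul1r.
Qed.

Lemma J_leD f g : I1 f -> I1 g -> (forall x, D x -> f x <= g x) -> J f <= J g.
Proof.
move=> hf hg fg; rewrite !JE//; apply: le_Rintegral.
- exact: mD.
- exact: (I1P (I1_mf hf)).1 hf.
- exact: (I1P (I1_mf hg)).1 hg.
- exact: fg.
Qed.

Lemma mass_gt0 n : 0 < twopi * cbin n.
Proof. by rewrite mulr_gt0 ?two_pi_gt0 ?cbin_gt0. Qed.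

Lemma I1_phi_kern n phi (B x : R) : mf phi -> (forall y, `|phi y| <= B) ->
  I1 (fun y => phi y * kern n (x - y)).
Proof.
move=> mphi bphi; apply: (I1_le (mfM mphi (mf_kern n x)) _ (I1Z B (I1_kern n x))) => y.
by rewrite normrM (ger0_norm (kern_ge0 _ _)) ler_wpM2r ?kern_ge0.
Qed.

Lemma smear_le n phi (B x : R) : mf phi -> (forall y, `|phi y| <= B) ->
  `|smear n phi x| <= B.
Proof.
move=> mphi bphi; have ik := I1_phi_kern n x mphi bphi.
rewrite /smear normrM normfV (gtr0_norm (mass_gt0 n)) ler_pdivrMr ?mass_gt0//.
apply: (le_trans (J_abs ik)); rewrite -(J_kern n x) -JZ; last exact: I1_kern.
apply: J_le; [exact: I1_abs|exact: I1Z (I1_kern n x)|move=> y].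
by rewrite normrM (ger0_norm (kern_ge0 _ _)) ler_wpM2r ?kern_ge0.
Qed.

Lemma mf_smear n phi : I1 phi -> mf (smear n phi).
Proof.
move=> iphi; have [h _] : cI1 (fun x => \sum_(k <- window n)
     (kcoef n k / cbin n)%:C%C * (E k x * fc (rc phi) (- k))).
  apply: cI1_sum => k _; apply: cI1Z; apply: cI1_ext (cI1Z (fc (rc phi) (- k)) (cI1E k)) => x.
  by rewrite mulrC.
apply: I1_mf; rewrite (_ : smear n phi = (fun x => complex.Re (\sum_(k <- window n)
     (kcoef n k / cbin n)%:C%C * (E k x * fc (rc phi) (- k)))))//.
by apply/funext => x; rewrite -smearE.
Qed.

Lemma geometric_small (q e : R) : 0 <= q < 1 -> 0 < e ->
  exists N, forall n, (N <= n)%N -> (n.*2 + 2)%:R * q ^+ n <= e.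
Proof.
move=> /andP[q0 q1] e0.
(* With this [h] one has [q (1 + h)^2 <= 1], so Bernoulli's inequality bounds [q^n] by
   [1 / (1 + n h)^2], which beats the linear factor. *)
pose h := (1 - q) / 4.
have h0 : 0 < h by rewrite divr_gt0// subr_gt0.
have h1 : h <= 1 by rewrite /h; lra.
have hq : q * (1 + h) ^+ 2 <= 1 by rewrite /h; nra.
have [N hN] := exists_inv (2 / h ^+ 2) e0.
exists N => n Nn; have n0 : 0 < (n.+1%:R : R) by rewrite ltr0n.
have b (m : nat) : 1 + m%:R * h <= (1 + h) ^+ m.
  elim: m => [|m IH]; first by rewrite mul0r addr0 expr0.
  have hm : 0 <= m%:R * h * h by rewrite mulr_ge0 ?(ltW h0)// mulr_ge0 ?(ltW h0).
  rewrite exprS -natr1; have := ler_wpM2l (ltac:(lra) : 0 <= 1 + h) IH; lra.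
have nh : h * n.+1%:R <= 1 + n%:R * h by rewrite -natr1; lra.
have c : q ^+ n * (h * n.+1%:R) ^+ 2 <= 1.
  apply: (@le_trans _ _ (q ^+ n * ((1 + h) ^+ n) ^+ 2)).
    rewrite ler_wpM2l ?exprn_ge0// lerXn2r ?nnegrE ?exprn_ge0//; [|lra|].
      by rewrite mulr_ge0// ltW.
    exact: le_trans nh (b n).
  rewrite -exprM mulnC exprM -exprMn exprn_ile1// mulr_ge0// exprn_ge0//; lra.
apply: le_trans hN; apply: (@le_trans _ _ (2 / h ^+ 2 / n.+1%:R)); last first.
  rewrite ler_wpM2l ?divr_ge0 ?sqr_ge0// lef_pV2 ?posrE ?ltr0n//.
  by rewrite ler_nat ltnS.
rewrite ler_pdivlMr// ler_pdivlMr ?exprn_gt0//.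
rewrite (_ : (n.*2 + 2)%:R = 2 * n.+1%:R :> R); last by rewrite -natrM -[n.*2]mul2n -mulnSr.
by move: c; rewrite exprMn; lra.
Qed.

Lemma kern_away (x y d : R) n : 0 < d -> d <= pi -> d <= `|x - y| <= twopi - d ->
  kern n (x - y) <= (2 + 2 * cos d) ^+ n.
Proof.
move=> d0 dpi /andP[dl dr].
have c1 := cos_geN1 (x - y); have c2 := cos_geN1 d.
suff hc : cos (x - y) <= cos d.
  by rewrite /kern lerXn2r// ?nnegrE; lra.
have -> : cos (x - y) = cos `|x - y|.
  by have [h|h] := leP 0 (x - y); [rewrite ger0_norm|rewrite ltr0_norm// cosN].
have p0 := pi_gt0 R.
have [hp|hp] := leP `|x - y| pi.
  have := ltr_cos; move: dl; rewrite le_eqVlt => /orP[/eqP -> //|dl].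
  by move=> /(_ R d `|x - y|); rewrite !in_itv/= hp dpi normr_ge0 (ltW d0) => /(_ isT isT); rewrite dl => /ltW.
have -> : cos `|x - y| = cos (twopi - `|x - y|).
  by rewrite -[RHS]cosN opprB -[RHS]cosD2pi subrK.
have dl' : d <= twopi - `|x - y| by lra.
have hp' : 0 <= twopi - `|x - y| <= pi by rewrite mulr2n; lra.
move: dl'; rewrite le_eqVlt => /orP[/eqP <- //|dl'].
have := @ltr_cos R d (twopi - `|x - y|).
by rewrite !in_itv/= hp' dpi (ltW d0) => /(_ isT isT); rewrite dl' => /ltW.
Qed.

Lemma cbin_ge n : 4 ^+ n <= (n.*2 + 2)%:R * cbin n :> R.
Proof. by rewrite /cbin -natrM -natrX ler_nat central_binomial. Qed.

Lemma smear_cvg phi (B x : R) : mf phi -> (forall y, `|phi y| <= B) ->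
  0 < x < twopi -> {for x, continuous phi} ->
  smear n phi x @[n --> \oo] --> phi x.
Proof.
move=> mphi bphi /andP[x0 x1] cphi.
have B0 : 0 <= B by apply: le_trans (bphi 0).
apply/cvgrPdist_le => e e0.
have [d1 /= d10 hd1] : exists2 d, 0 < d & forall y, `|x - y| < d -> `|phi x - phi y| <= e / 2.
  have /cvgrPdist_le/(_ (e / 2)) := cphi.
  by rewrite divr_gt0// => /(_ isT)/nbhs_ballP[d d0 h]; exists d => // y; exact: h.
(* Besides continuity within [d], the choice ensures [|x - y| <= 2 pi - d] for every [y] of the
   fundamental domain: on the circle, such a [y] is close to [x] only if it is close on the line. *)
pose d := Num.min d1 (Num.min x (twopi - x)).
have dd1 : d <= d1 by rewrite ge_min lexx.
have dx : d <= x by rewrite !ge_min lexx orbT.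
have dx' : d <= twopi - x by rewrite !ge_min lexx !orbT.
have d0 : 0 < d by rewrite !lt_min d10 x0 subr_gt0.
have dpi : d <= pi by move: dx dx'; rewrite mulr2n; lra.
pose q := (2 + 2 * cos d) / 4.
have q01 : 0 <= q < 1.
  have := cos_geN1 d; have : cos d < 1.
    have := @ltr_cos R 0 d; rewrite !in_itv/= lexx (ltW d0) dpi (ltW (pi_gt0 R)) => /(_ isT isT).
    by rewrite cos0 d0.
  by rewrite /q; lra.
have e1 : 0 < e / (4 * (B + 1)) by rewrite divr_gt0// mulr_gt0// ltr_wpDl.
have [N hN] := geometric_small q01 e1.
exists N => // n /= Nn.
have ik := I1_phi_kern n x mphi bphi; have mp := mass_gt0 n.
have -> : phi x - smear n phi x =
    J (fun y => (phi x - phi y) * kern n (x - y)) / (twopi * cbin n).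
  rewrite (J_ext (g := fun y => phi x * kern n (x - y) - phi y * kern n (x - y))); last first.
    by move=> y; rewrite mulrBl.
  rewrite JB ?JZ ?J_kern//; [|exact: I1_kern|exact: I1Z (I1_kern n x)].
  by rewrite /smear mulrBl mulfK ?gt_eqF.
have i1 : I1 (fun y => (phi x - phi y) * kern n (x - y)).
  apply: (@I1_phi_kern n (fun y => phi x - phi y) (B + B)).
    by apply: mfB => //; exact: mf_cst.
  by move=> y; apply: (le_trans (ler_normB _ _)); apply: lerD.
have i2 : I1 (fun y => e / 2 * kern n (x - y) + 2 * B * (2 + 2 * cos d) ^+ n).
  by apply: I1D (I1_cst _); exact: I1Z (I1_kern n x).
rewrite normrM normfV (gtr0_norm mp) ler_pdivrMr//.
apply: (le_trans (J_abs i1)).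
apply: (@le_trans _ _ (e / 2 * (twopi * cbin n) + 2 * B * (2 + 2 * cos d) ^+ n * twopi)).
  rewrite -(J_kern n x) -JZ; last exact: I1_kern.
  rewrite -J_cst -JD; [|exact: I1Z (I1_kern n x)|exact: I1_cst].
  apply: J_leD => //; first exact: I1_abs.
  move=> y; rewrite /torus_dom/= in_itv/= => /andP[y0 y1].
  rewrite normrM (ger0_norm (kern_ge0 _ _)).
  have q0 : 0 <= (2 + 2 * cos d) ^+ n.
    by rewrite exprn_ge0//; have := cos_geN1 d; lra.
  have [xyd|xyd] := ltP `|x - y| d.
    have := ler_wpM2r (kern_ge0 n (x - y)) (hd1 y (lt_le_trans xyd dd1)).
    have := mulr_ge0 (mulr_ge0 (ltac:(lra) : 0 <= 2) B0) q0; lra.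
  have kb : kern n (x - y) <= (2 + 2 * cos d) ^+ n.
    apply: kern_away => //; rewrite xyd/= ler_norml; lra.
  have bb : `|phi x - phi y| <= 2 * B.
    by apply: (le_trans (ler_normB _ _)); rewrite (mulr_natl B 2) mulr2n lerD.
  have := ler_pM (normr_ge0 _) (kern_ge0 _ _) bb kb.
  have := mulr_ge0 (ltW (ltac:(lra) : 0 < e / 2)) (kern_ge0 n (x - y)); lra.
have qn : (2 + 2 * cos d) ^+ n = q ^+ n * 4 ^+ n by rewrite -exprMn /q divfK.
have h1 := hN n Nn.
have h2 : (2 + 2 * cos d) ^+ n <= e / (4 * (B + 1)) * cbin n.
  rewrite qn; have := ler_wpM2l (exprn_ge0 n (proj1 (andP q01))) (cbin_ge n).
  have := ler_wpM2r (ltW (@cbin_gt0 R n)) h1; lra.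
have h3 : 2 * B * (e / (4 * (B + 1))) <= e / 2.
  rewrite mulrA ler_pdivrMr ?mulr_gt0 ?ltr_wpDl//; nra.
have cb := @cbin_gt0 R n; have tp := @two_pi_gt0 R.
have h4 := ler_wpM2l (mulr_ge0 (ltac:(lra) : 0 <= 2) B0) h2.
have h5 := ler_wpM2r (ltW cb) h3.
have h6 : 2 * B * (2 + 2 * cos d) ^+ n <= e / 2 * cbin n by lra.
have h7 := ler_wpM2r (ltW tp) h6; lra.
Qed.

End WeakBound.

Section DualityBound.
Context {R : realType}.
Notation tau := (@torus_measure R).
Notation mu := (@lebesgue_measure R).
Notation twopi := (pi *+ 2 : R).
Implicit Types (k j : int) (n : nat) (phi f : R -> R).

Lemma I1_mul_bounded f g (B : R) : I1 f -> mf g -> (forall x, `|g x| <= B) ->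
  I1 (fun x => f x * g x).
Proof.
move=> hf hg gB; apply: (I1_le (mfM (I1_mf hf) hg) _ (I1Z B (I1_abs hf))) => x.
by rewrite normrM mulrC ler_wpM2r.
Qed.

(** The pairing is a finite sum of products of coefficients. Cauchy-Schwarz combines the hypothesis
    on [f] with Bessel's inequality for [phi]; as the multipliers are at most 1, the bound does not
    depend on [n]. *)
Lemma smear_pairing n f phi (B S : R) : I1 f -> mf phi -> (forall x, `|phi x| <= B) ->
  l2bound (fun=> 1) (fc (rc f)) S ->
  J (fun x => f x * smear n phi x) ^+ 2 <= twopi * S * J (fun x => phi x ^+ 2).
Proof.
move=> hf hphi phiB hS.
have sphi : sq phi := sq_bounded hphi phiB.
have iphi := sq_I1 sphi.
have -> : J (fun x => f x * smear n phi x) ^+ 2 =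
   nsq (CI (rc (fun x => f x * smear n phi x))) by rewrite CI_rc nsqC.
have cf := cI1_rc hf.
have -> : CI (rc (fun x => f x * smear n phi x)) = \sum_(k <- window n)
    ((kcoef n k / cbin n)%:C%C * fc (rc phi) (- k)) * (twopi%:C%C * fc (rc f) k).
  rewrite (CI_ext (g := fun x => \sum_(k <- window n)
     ((kcoef n k / cbin n)%:C%C * fc (rc phi) (- k)) * (rc f x * E k x))); last first.
    move=> x; rewrite {1}/rc rmorphM/= smearE// mulr_sumr; apply: eq_bigr => k _.
    by rewrite /rc; ring.
  rewrite CI_sum => [|k _]; last by apply: cI1Z; exact: cI1ME.
  by apply: eq_bigr => k _; rewrite CIZ ?CI_fc//; exact: cI1ME.
apply: (le_trans (nsq_cs _ _ _ _)).
have P0 : 0 < twopi by exact: two_pi_gt0.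
have b1 : \sum_(k <- window n) nsq ((kcoef n k / cbin n)%:C%C * fc (rc phi) (- k)) <=
    J (fun x => phi x ^+ 2) / twopi.
  rewrite ler_pdivlMr// mulrC -JN_rc.
  apply: le_trans (@bessel _ (rc phi) [seq - k | k <- window n] (csq_rc sphi) _); last first.
    by rewrite map_inj_uniq ?window_uniq//; exact: oppr_inj.
  rewrite ler_wpM2l ?(ltW P0)// [leRHS]big_map; apply: ler_sum => k _.
  rewrite nsqM nsqC ler_piMl ?nsq_ge0//.
  by have /andP[k0 k1] := @kcoef_le R n k; rewrite expr_le1.
have b2 : \sum_(k <- window n) nsq (twopi%:C%C * fc (rc f) k) <= twopi ^+ 2 * S.
  under eq_bigr do rewrite nsqM nsqC; rewrite -mulr_sumr ler_wpM2l ?sqr_ge0//.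
  by have := hS _ (window_uniq n); under eq_bigr do rewrite mul1r.
apply: (le_trans (ler_pM _ _ b1 b2)).
- by apply: sumr_ge0 => k _; exact: nsq_ge0.
- by apply: sumr_ge0 => k _; exact: nsq_ge0.
have t0 : twopi != 0 by rewrite gt_eqF.
rewrite le_eqVlt; apply/orP; left; apply/eqP; move: t0; clear.
by move: (twopi) (J _) => t X t0; field.
Qed.

Lemma tau_bad : tau (~` `]0, twopi[%classic) = 0%E.
Proof.
rewrite tauE; apply: (@subset_measure0 _ _ _ mu _ ([set 0] `|` [set twopi])) => //.
- apply: measurableI; last exact: mD.
  by apply: measurableC; exact: measurable_itv.
- by apply: measurableU; exact: measurable_set1.
- move=> x [/= h]; rewrite /torus_dom/= in_itv/= => /andP[x0 x1].
  move: h; rewrite in_itv/= => /negP; rewrite negb_and -!leNgt => /orP[h|h].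
    by left; apply/eqP; rewrite eq_le h x0.
  by right; apply/eqP; rewrite eq_le h x1.
- apply/eqP; rewrite eq_le measure_ge0 andbT.
  apply: le_trans (measureU2 _ _ _) _; [exact: measurable_set1|exact: measurable_set1|].
  have e (x : R) : (mu [set x] <= 0)%E by rewrite lebesgue_measure_set1.
  by rewrite -[leRHS]adde0; apply: leeD; exact: e.
Qed.

(** Dominated convergence in the previous bound. [phi] need not match at the two ends of the period,
    so the smearings may fail to converge there; the endpoints form a null set. *)
Lemma weak_bound f phi (B S : R) : I1 f -> mf phi -> (forall x, `|phi x| <= B) ->
  (forall x, 0 < x < twopi -> {for x, continuous phi}) ->
  l2bound (fun=> 1) (fc (rc f)) S ->
  J (fun x => f x * phi x) ^+ 2 <= twopi * S * J (fun x => phi x ^+ 2).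
Proof.
move=> hf hphi phiB cphi hS.
have iphi := sq_I1 (sq_bounded hphi phiB).
have ms n := mf_smear n iphi.
have cv : J (fun x => f x * smear n phi x) @[n --> \oo] --> J (fun x => f x * phi x).
  have ae1 : {ae tau, forall x, setT x -> (f x * smear n phi x)%:E @[n --> \oo] --> (f x * phi x)%:E}.
    exists (~` `]0, twopi[%classic); split; [|exact: tau_bad|].
      by apply: measurableC; exact: measurable_itv.
    move=> x /= h xI; apply: h => _; move: xI; rewrite in_itv/= => xI.
    apply: cvg_EFin; first exact: nearW.
    apply: cvgM; first exact: cvg_cst.
    exact: (smear_cvg hphi phiB xI (cphi x xI)).
  have ae2 : {ae tau, forall x n, setT x -> (`|(f x * smear n phi x)%:E| <= (B * `|f x|)%:E)%E}.
    apply: aeW => x n _; rewrite /= lee_fin normrM mulrC ler_wpM2r//.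
    exact: smear_le hphi phiB.
  have [_ _ h] := @dominated_convergence _ _ _ tau setT measurableT
    (fun n x => (f x * smear n phi x)%:E) (fun x => (f x * phi x)%:E)
    (fun x => (B * `|f x|)%:E)
    (fun n => (measurable_EFinP _ _).2 (mfM (I1_mf hf) (ms n)))
    ((measurable_EFinP _ _).2 (mfM (I1_mf hf) hphi)) ae1 (I1Z B (I1_abs hf)) ae2.
  apply: fine_cvg.
  rewrite /= fineK; last by apply: integrable_fin_num => //; exact: (I1_mul_bounded hf hphi phiB).
  exact: h.
have cv2 : J (fun x => f x * smear n phi x) ^+ 2 @[n --> \oo] --> J (fun x => f x * phi x) ^+ 2.
  by rewrite expr2; under eq_fun do rewrite expr2; apply: cvgM.
rewrite -(cvg_lim _ cv2)//; apply: limr_le; first by apply/cvg_ex; eexists; exact: cv2.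
by apply: nearW => n; exact: smear_pairing.
Qed.

End DualityBound.

(** * The converse of Bessel's inequality and products *)

Section RieszFischer.
Context {R : realType}.
Notation tau := (@torus_measure R).
Notation mu := (@lebesgue_measure R).
Notation D := (@torus_dom R).
Notation twopi := (pi *+ 2 : R).
Implicit Types (f : R -> R).

Lemma approx_cont f (e : R) : I1 f -> 0 < e -> exists g : R -> R,
  [/\ continuous g, I1 g & J (fun x => `|f x - g x|) <= e].
Proof.
move=> hf e0.
have Dfin : (mu D < +oo)%E.
  by rewrite /torus_dom lebesgue_measure_itv/= lte_fin two_pi_gt0 -EFinB ltry.
have [g_ [g1 g2 g3]] := approximation_continuous_integrable mD Dfin ((I1P (I1_mf hf)).1 hf).
have hg n : I1 (g_ n) by apply: (I1P (mf_cont (g1 n))).2; exact: g2.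
have iab n : I1 (fun x => `|f x - g_ n x|) by apply: I1_abs; exact: I1B.
have E n : (\int[mu]_(z in D) `|(f z - g_ n z)%:E| = (J (fun x => `|f x - g_ n x|))%:E)%E.
  rewrite JE// /Rintegral fineK//; apply: integrable_fin_num; first exact: mD.
  exact: (I1P (I1_mf (iab n))).1.
have /fine_cvgP[_ ] := g3.
move=> /cvgrPdist_le/(_ e e0)[N _ hN]; exists (g_ N); split=> //.
have := hN N (leqnn N); rewrite /= E /= sub0r normrN ger0_norm//.
by apply: J_ge0 => x.
Qed.

Definition clip (A y : R) : R := Num.max (- A) (Num.min y A).

Lemma clipE A y : 0 <= A -> clip A y = if y <= - A then - A else if y <= A then y else A.
Proof.
move=> A0; rewrite /clip; case: (leP y A) => yA.
  by rewrite maxC maxElt; case: ltgtP.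
rewrite maxEle ifT; last by lra.
by rewrite ifF//; apply/negbTE; rewrite -ltNge; lra.
Qed.

Lemma clip_le A y : 0 <= A -> `|clip A y| <= A.
Proof.
move=> A0; rewrite clipE//; case: ifPn => h1; first by rewrite normrN ger0_norm.
case: ifPn => h2; last by rewrite ger0_norm.
by rewrite ler_norml; move: h1; rewrite -ltNge; lra.
Qed.

Lemma clip_lip A y z : 0 <= A -> `|clip A y - clip A z| <= `|y - z|.
Proof.
move=> A0; rewrite !clipE//.
case: ifPn => h1; case: ifPn => h2; rewrite ?subrr ?normr0//;
  try (case: ifPn => h3); try (case: ifPn => h4); rewrite ?subrr ?normr0//;
  rewrite -?ltNge in h1, h2; try rewrite -?ltNge in h3; try rewrite -?ltNge in h4;
  have := ler_norm (y - z); have := ler_norm (z - y); rewrite distrC => u v; rewrite ler_norml; lra.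
Qed.

Lemma clip_sqr A y : 0 <= A -> clip A y ^+ 2 <= y * clip A y.
Proof.
move=> A0; rewrite clipE//; case: ifPn => h1; first by nra.
case: ifPn => h2; first by rewrite expr2.
by move: h2; rewrite -ltNge => h2; nra.
Qed.

Lemma clip_id A y : `|y| <= A -> clip A y = y.
Proof.
move=> yA; have A0 : 0 <= A by apply: le_trans yA.
move: yA; rewrite clipE// ler_norml => /andP[h1 h2].
by rewrite h2; case: ifPn => // h3; apply/eqP; rewrite eq_le h1 h3.
Qed.

Lemma clip_nd A B y : 0 <= A -> A <= B -> clip A y ^+ 2 <= clip B y ^+ 2.
Proof.
move=> A0 AB; have B0 := le_trans A0 AB; rewrite !clipE//.
by case: ifPn; case: ifPn; rewrite -?ltNge; try (case: ifPn); rewrite -?ltNge; try (case: ifPn); rewrite -?ltNge;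
  move=> *; nra.
Qed.

Lemma clip_cont A (g : R -> R) : continuous g -> continuous (fun x => clip A (g x)).
Proof.
move=> cg x; apply: (@continuous_max R R (fun=> - A) (fun x => Num.min (g x) A)); first exact: cvg_cst.
by apply: (@continuous_min R R g (fun=> A)); [exact: cg|exact: cvg_cst].
Qed.

Lemma mf_clip A f : mf f -> mf (fun x => clip A (f x)).
Proof.
move=> hf; have h : mf (fun y => clip A y) by apply: mf_cont; apply: (@clip_cont A id) => x; exact: cvg_id.
exact: (measurableT_comp h hf).
Qed.

(** Duality would test [f] against its own truncation, but test functions have to be continuous. So
    [f] is replaced by a nearby continuous [g], and [phi = clip A g] satisfies [phi^2 <= g phi]. The
    square of the pairing then bounds itself, up to the error of approximation. *)
Lemma clip_bound f (A S : R) : 0 <= A -> I1 f -> l2bound (fun=> 1) (fc (rc f)) S ->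
  J (fun x => clip A (f x) ^+ 2) <= twopi * S.
Proof.
move=> A0 hf hS; apply/ler_addgt0Pr => e0 e00.
have S0 := l2bound_ge0 hS; have P0 := @two_pi_gt0 R.
(* The replacement of [f] by [g] costs [A e] in the pairing, which doubles when [X / 2] is absorbed,
   and [2 A e] more in the return to [clip A f]: in all [4 A e]. The [+ 1] covers [A = 0]. *)
pose e := e0 / (4 * A + 1).
have e1 : 0 < e by rewrite divr_gt0// ltr_wpDl// mulr_ge0.
have [g [cg hg fg]] := approx_cont hf e1.
pose phi x := clip A (g x).
have mphi : mf phi by apply: mf_clip; exact: mf_cont.
have bphi x : `|phi x| <= A by exact: clip_le.
have sphi : sq phi := sq_bounded mphi bphi.
have cphi x : 0 < x < twopi -> {for x, continuous phi} by move=> _; exact: clip_cont.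
have wb := weak_bound hf mphi bphi cphi hS.
have ih : I1 (fun x => `|f x - g x|) by apply: I1_abs; exact: I1B.
set X := J (fun x => phi x ^+ 2) in wb.
have X0 : 0 <= X by exact: J_sq_ge0.
have ifphi := I1_mul_bounded hf mphi bphi.
have h1 : X <= J (fun x => f x * phi x) + A * e.
  apply: (@le_trans _ _ (J (fun x => f x * phi x + A * `|f x - g x|))).
    apply: J_le; [exact: sphi.2|exact: I1D ifphi (I1Z A ih)|move=> x].
    have c1 := clip_sqr (g x) A0; have c2 := bphi x; rewrite -/(phi x) in c1.
    have : (g x - f x) * phi x <= `|f x - g x| * A.
      by apply: (le_trans (ler_norm _)); rewrite normrM distrC ler_wpM2l.
    lra.
  by rewrite JD ?JZ//; [rewrite lerD2l ler_wpM2l|exact: I1Z].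
have h2 : J (fun x => f x * phi x) <= (twopi * S + X) / 2.
  rewrite leNgt; apply/negP => h; have TS : 0 <= twopi * S by rewrite mulr_ge0 ?(ltW P0).
  have : 0 <= (twopi * S - X) ^+ 2 by exact: sqr_ge0.
  move: h wb; move: (J _) (twopi * S) TS X0 => y a TS X0; nra.
have h3 : J (fun x => clip A (f x) ^+ 2) <= X + 2 * A * e.
  have mc := mf_clip A (I1_mf hf).
  have sc : sq (fun x => clip A (f x)) := sq_bounded mc (fun x => clip_le (f x) A0).
  apply: (@le_trans _ _ (J (fun x => phi x ^+ 2 + 2 * A * `|f x - g x|))).
    apply: J_le; [exact: sc.2|exact: I1D sphi.2 (I1Z _ ih)|move=> x].
    have l := clip_lip (f x) (g x) A0; rewrite -/(phi x) in l.
    have c1 := clip_le (f x) A0; have c2 := bphi x.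
    have : (clip A (f x) - phi x) * (clip A (f x) + phi x) <= `|f x - g x| * (A + A).
      apply: (le_trans (ler_norm _)); rewrite normrM ler_pM//.
      by apply: (le_trans (ler_normD _ _)); exact: lerD.
    lra.
  by rewrite JD ?JZ//; [rewrite lerD2l ler_wpM2l// mulr_ge0|exact: sphi.2|exact: I1Z].
have h4 : 4 * A * e <= e0.
  by rewrite /e mulrA ler_pdivrMr ?ltr_wpDl ?mulr_ge0//; lra.
lra.
Qed.

Lemma J_EFin f : I1 f -> (\int[tau]_x (f x)%:E = (J f)%:E)%E.
Proof. by move=> hf; rewrite /J /Rintegral fineK//; apply: integrable_fin_num. Qed.

(** The bound for truncations does not depend on the level, and monotone convergence removes the
    truncation. *)
Lemma riesz_fischer f (S : R) : I1 f -> l2bound (fun=> 1) (fc (rc f)) S ->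
  sq f /\ J (fun x => f x ^+ 2) <= twopi * S.
Proof.
move=> hf hS; have mf_f := I1_mf hf.
have sc n : sq (fun x => clip n%:R (f x)).
  exact: (sq_bounded (mf_clip n%:R mf_f) (fun x => clip_le (f x) (ler0n R n))).
pose h n x : \bar R := (clip n%:R (f x) ^+ 2)%:E.
have hlim x : limn (h ^~ x) = (f x ^+ 2)%:E.
  apply/cvg_lim => //; apply: cvg_near_cst.
  exists (Num.bound `|f x|) => // n /= hn; rewrite /h clip_id//.
  by rewrite ltW// (lt_le_trans (archi_boundP _))// ler_nat.
have key : (\int[tau]_x (f x ^+ 2)%:E <= (twopi * S)%:E)%E.
  have := @monotone_convergence _ _ _ tau setT measurableT h
    (fun n => (measurable_EFinP _ _).2 (I1_mf (sc n).2)) _ _.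
  rewrite (_ : (fun x => limn (h ^~ x)) = (fun x => (f x ^+ 2)%:E)); last by apply/funext.
  move=> ->.
  - apply: lime_le; last first.
      by apply: nearW => n; rewrite J_EFin ?lee_fin; [exact: clip_bound|exact: (sc n).2].
    apply: ereal_nondecreasing_is_cvgn => m n mn.
    rewrite !J_EFin ?lee_fin; [|exact: (sc _).2..].
    apply: J_le; [exact: (sc _).2..|move=> x].
    by apply: clip_nd; rewrite ?ler_nat.
  - by move=> n x _; rewrite lee_fin sqr_ge0.
  - by move=> x _ m n mn; rewrite lee_fin; apply: clip_nd; rewrite ?ler_nat.
have i2 : I1 (fun x => f x ^+ 2).
  apply/integrableP; split; first by apply/measurable_EFinP; exact: (mfM mf_f mf_f).
  apply: le_lt_trans (ltry (twopi * S)).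
  by under eq_integral do rewrite /= ger0_norm ?sqr_ge0//.
by split=> //; rewrite -lee_fin -J_EFin.
Qed.

Lemma fc_ReIm (f : R -> R[i]) k : cI1 f ->
  fc (rc (fun x => complex.Re (f x))) k = (1 / 2 : R)%:C%C * (fc f k + conjc (fc f (- k))) /\
  fc (rc (fun x => complex.Im (f x))) k = (- (1 / 2) *i)%C * (fc f k - conjc (fc f (- k))).
Proof.
move=> hf; have hJ : cI1 (fun x => conjc (f x)).
  case: hf => a b; split; first by rewrite (funext (fun x => cReJ (f x))).
  rewrite (funext (fun x => cImJ (f x))) (_ : (fun x => _) = (fun x => -1 * complex.Im (f x))).
    exact: I1Z.
  by apply/funext => x; rewrite mulN1r.
rewrite -!fcJ//; split.
  rewrite -fcD// -fcZ; last exact: cI1D.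
  congr (_ * _); apply: CI_ext => x; congr (_ * _).
  by apply: complexP; rewrite /rc !ReIm/=; lra.
rewrite -[- fc _ _]mulN1r -fcZ// -fcD//; last exact: cI1Z.
rewrite -fcZ; last by apply: cI1D => //; exact: cI1Z.
congr (_ * _); apply: CI_ext => x; congr (_ * _).
by apply: complexP; rewrite /rc !ReIm/=; lra.
Qed.

Lemma riesz_fischerC (f : R -> R[i]) (S : R) : cI1 f -> l2bound (fun=> 1) (fc f) S ->
  csq f /\ JN f <= 2 * twopi * S.
Proof.
move=> hf hS; have [hr hi] := hf.
have hSN : l2bound (fun=> 1) (fun k => conjc (fc f (- k))) S.
  move=> r ur; under eq_bigr do rewrite nsqJ.
  have := hS [seq - k | k <- r]; rewrite big_map (map_inj_uniq (@oppr_inj int)) => /(_ ur).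
  by [].
have bR : l2bound (fun=> 1) (fc (rc (fun x => complex.Re (f x)))) S.
  have h := l2boundZ (1 / 2 : R)%:C%C (l2boundD (fun=> ler01) hS hSN).
  rewrite (_ : fc _ = (fun k => (1 / 2 : R)%:C%C * (fc f k + conjc (fc f (- k))))); last first.
    by apply/funext => k; have [] := fc_ReIm k hf.
  by apply: l2boundW h; rewrite nsqC; lra.
have bI : l2bound (fun=> 1) (fc (rc (fun x => complex.Im (f x)))) S.
  have h := l2boundZ (- (1 / 2) *i)%C (l2boundB (fun=> ler01) hS hSN).
  rewrite (_ : fc _ = (fun k => (- (1 / 2) *i)%C * (fc f k - conjc (fc f (- k))))); last first.
    by apply/funext => k; have [] := fc_ReIm k hf.
  by apply: l2boundW h; rewrite /nsq /=; lra.
have [s1 j1] := riesz_fischer hr bR; have [s2 j2] := riesz_fischer hi bI.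
split=> //; rewrite /JN /nsq JD; [lra|exact: s1.2|exact: s2.2].
Qed.

(** The converse of Bessel's inequality with bound 0, applied to the difference. *)
Lemma fourier_unique (f g : R -> R[i]) : cI1 f -> cI1 g -> (forall k, fc f k = fc g k) ->
  ae_eqT f g.
Proof.
move=> hf hg fg; pose h x := f x + -1 * g x.
have ih : cI1 h by apply: cI1D => //; exact: cI1Z.
have h0 : l2bound (fun=> 1) (fc h) 0.
  move=> r ur; rewrite big1// => k _; rewrite fcD//; last exact: cI1Z.
  by rewrite fcZ// fg mulN1r subrr nsq0 mulr0.
have [sh] := riesz_fischerC ih h0; rewrite mulr0 => J0.
have mh : measurable_fun (setT : set (measurableTypeR R)) (fun x => (nsq (h x))%:E).
  by apply/measurable_EFinP; exact: I1_mf (I1_nsq sh).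
have : (\int[tau]_x `|(nsq (h x))%:E| = 0)%E.
  under eq_integral do rewrite /= ger0_norm ?nsq_ge0//.
  rewrite J_EFin; last exact: I1_nsq.
  by congr (_%:E); apply/eqP; rewrite eq_le J0 JN_ge0.
move/(ae_eq_integral_abs tau measurableT mh).1.
apply: filterS => x /(_ I)/= [] /nsq_eq0; rewrite /h mulN1r => /eqP; rewrite subr_eq0 => /eqP.
by [].
Qed.

End RieszFischer.

Section Parseval.
Context {R : realType}.
Implicit Types (f g : R -> R[i]) (k m : int).
Local Notation jb := (@jb R).
Local Notation twopi := (pi *+ 2 : R).

Lemma CI_cs f g : csq f -> csq g -> nsq (CI (fun x => f x * g x)) <= 2 * JN f * JN g.
Proof.
move=> [fr fi] [gr gi].
rewrite /nsq !CIE /=.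
rewrite (J_ext (g := fun x => complex.Re (f x) * complex.Re (g x) - complex.Im (f x) * complex.Im (g x))); last by move=> x; rewrite cReM.
rewrite (J_ext (f := fun x => complex.Im (f x * g x)) (g := fun x => complex.Re (f x) * complex.Im (g x) + complex.Im (f x) * complex.Re (g x))); last by move=> x; rewrite cImM.
rewrite JB ?JD; [|exact: sq_I1M..].
have := J_cs fr gr; have := J_cs fi gi; have := J_cs fr gi; have := J_cs fi gr.
rewrite /JN /nsq JD; [|exact: fr.2|exact: fi.2]; rewrite JD; [|exact: gr.2|exact: gi.2].
set a := J (fun x => complex.Re (f x) * complex.Re (g x)).
set b := J (fun x => complex.Im (f x) * complex.Im (g x)).
set c := J (fun x => complex.Re (f x) * complex.Im (g x)).
set d := J (fun x => complex.Im (f x) * complex.Re (g x)).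
set A := J _; set B := J _; set A' := J _; set B' := J _.
move: A B A' B' a b c d; clear => A B A' B' a b c d h1 h2 h3 h4.
have := sqr_ge0 (a + b); have := sqr_ge0 (c - d).
nra.
Qed.

(** The truncated convolution is exactly the coefficient of [f] times the partial sum of [g]. The
    remainder of [g] has coefficients only outside the window, so the converse of Bessel's
    inequality makes its [L^2] norm small, and Cauchy-Schwarz controls the product with [f]. *)
Lemma fc_mul f g k (M : R) : csq f -> cI1 g -> l2bound jb (fc g) M ->
  clim (fun L => S_full L (fc f) (fc g) k) (fc (fun x => f x * g x) k).
Proof.
move=> sf ig gM; have i_f := csq_cI1 sf.
have [sg _] := riesz_fischerC ig (l2bound_jb gM).
have M0 := l2bound_ge0 gM; have tp := @two_pi_gt0 R.
pose gL L x := \sum_(j <- window L) fc g j * E (- j) x.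
have sgL L : csq (gL L) by exact: csq_trig.
have SE L : S_full L (fc f) (fc g) k = fc (fun x => f x * gL L x) k.
  rewrite fcE (CI_ext (g := fun x => \sum_(j <- window L) fc g j * (f x * E (k - j) x))); last first.
    move=> x; rewrite mulr_sumr mulr_suml; apply: eq_bigr => j _.
    by rewrite -EkM; ring.
  rewrite CI_sum => [|j _]; last by apply: cI1Z; exact: cI1ME.
  rewrite mulr_sumr; apply: eq_bigr => j _; rewrite CIZ; last exact: cI1ME.
  have tw : (twopi^-1)%:C%C * twopi%:C%C = 1 :> R[i] by rewrite -rmorphM/= mulVf ?gt_eqF.
  by rewrite CI_fc [fc g j * _]mulrCA [RHS]mulrA tw mul1r mulrC.
pose h L x := gL L x + -1 * g x.
have sh L : csq (h L) by apply: csqD => //; exact: csqZ.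
have hb L : l2bound (fun=> 1) (fc (h L)) (M / L.+1%:R).
  move=> r ur; rewrite ler_pdivlMr ?ltr0n// mulr_suml; apply: le_trans (gM r ur).
  apply: ler_sum => j _; rewrite mul1r mulrC fcD; [|exact: csq_cI1|exact: csq_cI1 (csqZ _ sg)].
  rewrite fcZ// fc_trig ?window_uniq// mulN1r.
  case: ifPn; first by rewrite subrr nsq0 mulr0 => _; rewrite mulr_ge0 ?nsq_ge0// ltW ?jb_gt0.
  rewrite mem_window -ltNge sub0r nsqN => /(@jb_far R) hj.
  by rewrite ler_wpM2r ?nsq_ge0.
have JN0 := JN_ge0 f.
have main L : nsq (S_full L (fc f) (fc g) k - fc (fun x => f x * g x) k) <=
    twopi ^- 2 * (2 * JN f * (2 * twopi * (M / L.+1%:R))).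
  rewrite SE -[- fc _ _]mulN1r -fcZ; last exact: csq_cI1M.
  rewrite -fcD; [|exact: csq_cI1M|by apply: cI1Z; exact: csq_cI1M].
  rewrite fcE (CI_ext (g := fun x => (f x * E k x) * h L x)); last by move=> x; rewrite /h; ring.
  rewrite nsqM nsqC exprVn ler_wpM2l ?invr_ge0 ?sqr_ge0//.
  apply: le_trans (CI_cs (csqME k sf) (sh L)) _.
  rewrite (_ : JN (fun x => f x * E k x) = JN f); last by apply: J_ext => x; rewrite nsq_cE.
  rewrite ler_wpM2l//; first by rewrite mulr_ge0.
  exact: (riesz_fischerC (csq_cI1 (sh L)) (hb L)).2.
move=> e e0.
pose C := twopi ^- 2 * (2 * JN f * (2 * twopi * M)).
exists (Num.bound (C / e)) => L LL; apply: le_trans (main L) _.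
rewrite (_ : _ * _ = C / L.+1%:R); last by rewrite /C; ring.
rewrite ler_pdivrMr ?ltr0n// -ler_pdivrMl// mulrC.
have C0 : 0 <= C / e.
  apply: divr_ge0; last exact: ltW.
  rewrite /C mulr_ge0// ?invr_ge0 ?sqr_ge0//; apply: mulr_ge0; first by rewrite mulr_ge0.
  by apply: mulr_ge0 => //; apply: mulr_ge0 => //; exact: ltW.
apply: ltW; apply: lt_le_trans (archi_boundP C0) _.
by rewrite ler_nat (leq_trans LL).
Qed.

Lemma window_opp (F : int -> R[i]) L : \sum_(j <- window L) F (- j) = \sum_(j <- window L) F j.
Proof.
rewrite -(big_map -%R xpredT F); apply: perm_big; apply: uniq_perm.
- by rewrite (map_inj_uniq (@oppr_inj int)) window_uniq.
- exact: window_uniq.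
- by move=> j; rewrite -[j in LHS]opprK (mem_map (@oppr_inj int)) !mem_window normrN.
Qed.

Lemma fc_conj f : cI1 f -> fc (fun x => conjc (f x)) = fun k => conjc (fc f (- k)).
Proof. by move=> hf; apply/funext => k; exact: fcJ. Qed.

Lemma fc_nsq f m (M : R) : cI1 f -> l2bound jb (fc f) M ->
  clim (fun L => W_full L (fc f) (fc f) m) (fc (rc (fun x => nsq (f x))) m).
Proof.
move=> i_f fM; have [sf _] := riesz_fischerC i_f (l2bound_jb fM).
have iJ := csq_cI1 (csqJ sf).
have JM : l2bound jb (fc (fun x => conjc (f x))) M.
  rewrite fc_conj// => r ur; rewrite -[X in _ <= X]addr0 addr0.
  under eq_bigr do rewrite nsqJ -jbN.
  have := fM [seq - k | k <- r]; rewrite big_map; apply.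
  by rewrite (map_inj_uniq (@oppr_inj int)).
have := fc_mul m sf iJ JM.
rewrite (_ : (fun x => f x * conjc (f x)) = rc (fun x => nsq (f x))); last first.
  by apply/funext => x; rewrite nsq_mulJ.
rewrite (_ : (fun L => S_full L _ _ m) = fun L => W_full L (fc f) (fc f) m)//.
apply/funext => L; rewrite /S_full /W_full -window_opp; apply: eq_bigr => j _.
by rewrite fcJ// opprK addrC.
Qed.

End Parseval.

(** * Test functions and mode equations *)

Section NiceFunctions.
Context {R : realType} {V : normedModType R}.
Implicit Types (f g h : V -> R) (p v : V).

(** A class containing the test functions needed and stable under directional derivatives. Its
    members being differentiable, iterated derivatives of every order are handled by one
    induction. *)
Inductive nice : (V -> R) -> Prop :=
| nice_cst c : nice (fun=> c)
| nice_lin (l : {linear V -> R^o}) (c : R -> R) : continuous l -> smoothR c -> nice (fun p => c (l p))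
| niceD f g : nice f -> nice g -> nice (fun p => f p + g p)
| niceM f g : nice f -> nice g -> nice (fun p => f p * g p).

Lemma smoothR_differentiable (c : R -> R) x : smoothR c -> differentiable (c : R^o -> R^o) x.
Proof. by move=> sc; apply/derivable1_diffP; exact: smoothR_derivable. Qed.

Lemma linear_comp (l : {linear V -> R^o}) (c : R -> R) p v : continuous l -> smoothR c ->
  differentiable (fun q => c (l q) : R^o) p /\ 'D_v (fun q => c (l q) : R^o) p = l v * derive1 c (l p).
Proof.
move=> cl sc; have dl := linear_differentiable p cl.
have dc := smoothR_differentiable (l p) sc.
have d := differentiable_comp dl dc; split; first exact: d.
by rewrite deriveE//; rewrite (diff_comp dl dc)/= diff_lin// diff1E.
Qed.

Lemma nice_differentiable f p : nice f -> differentiable (f : V -> R^o) p.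
Proof.
elim=> [c|l c cl sc|g h _ IH1 _ IH2|g h _ IH1 _ IH2].
- exact: differentiable_cst.
- exact: (linear_comp p 0 cl sc).1.
- exact: differentiableD.
- exact: differentiableM.
Qed.

Lemma nice_derivable f p v : nice f -> derivable (f : V -> R^o) p v.
Proof. by move=> nf; apply: diff_derivable; exact: nice_differentiable. Qed.

Lemma deriveD_nice f g v : nice f -> nice g ->
  'D_v (fun p => f p + g p : R^o) = (fun p => 'D_v (f : V -> R^o) p + 'D_v (g : V -> R^o) p).
Proof. by move=> nf ng; apply/funext => p; apply: deriveD; exact: nice_derivable. Qed.

Lemma deriveM_nice f g v : nice f -> nice g ->
  'D_v (fun p => f p * g p : R^o) =
  (fun p => f p * 'D_v (g : V -> R^o) p + g p * 'D_v (f : V -> R^o) p).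
Proof. by move=> nf ng; apply/funext => p; apply: deriveM; exact: nice_derivable. Qed.

Lemma nice_derive f v : nice f -> nice ('D_v (f : V -> R^o)).
Proof.
elim=> [c|l c cl sc|g h ng IH1 nh IH2|g h ng IH1 nh IH2].
- rewrite (_ : 'D_v _ = fun=> 0); first exact: nice_cst.
  by apply/funext => p; exact: derive_cst.
- rewrite (_ : 'D_v _ = fun p => l v * derive1 c (l p)).
    by apply: niceM; [exact: nice_cst|exact: (nice_lin cl (smoothR_derive1 sc))].
  by apply/funext => p; exact: (linear_comp p v cl sc).2.
- by rewrite deriveD_nice//; exact: niceD.
- by rewrite deriveM_nice//; apply: niceD; apply: niceM.
Qed.

Lemma smooth_nice (f g : V -> R) : nice f -> nice g -> smooth (fun p => (f p +i* g p)%C).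
Proof.
move=> nf ng vs p.
have [f' [g' [-> nf' ng']]] : exists f' g', [/\
   foldr (@cderive R V) (fun p => (f p +i* g p)%C) vs = (fun p => (f' p +i* g' p)%C), nice f' & nice g'].
  elim: vs => [|v vs [f' [g' [/= -> nf' ng']]]]; first by exists f, g.
  by exists ('D_v (f' : V -> R^o)), ('D_v (g' : V -> R^o)); split=> //; exact: nice_derive.
split.
- exact/differentiable_continuous/(nice_differentiable p nf').
- exact/differentiable_continuous/(nice_differentiable p ng').
- by move=> w; exact: nice_derivable.
- by move=> w; exact: nice_derivable.
Qed.

End NiceFunctions.

Section SpaceTimeTests.
Context {R : realType}.
Local Notation V2 := (R * R)%type.

Lemma nice_fst (c : R -> R) : smoothR c -> nice (fun p : V2 => c p.1).
Proof.
move=> sc; apply: (@nice_lin R V2 (fst : {linear V2 -> R^o})) => //.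
by move=> p; exact: cvg_fst.
Qed.

Lemma nice_snd (c : R -> R) : smoothR c -> nice (fun p : V2 => c p.2).
Proof.
move=> sc; apply: (@nice_lin R V2 (snd : {linear V2 -> R^o})) => //.
by move=> p; exact: cvg_snd.
Qed.

Lemma nice_id (c : R -> R) : smoothR c -> nice (c : R^o -> R).
Proof.
move=> sc; apply: (@nice_lin R R^o (idfun : {linear R^o -> R^o}) c) => // x.
exact: cvg_id.
Qed.

Lemma derive_prod_fst (a b : R -> R) (v : V2) : smoothR a -> smoothR b ->
  'D_v (fun p : V2 => a p.1 * b p.2 : R^o) =
  (fun p => v.1 * (derive1 a p.1 * b p.2) + v.2 * (a p.1 * derive1 b p.2)).
Proof.
move=> sa sb; rewrite deriveM_nice; [|exact: nice_fst|exact: nice_snd].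
apply/funext => p.
have c1 : continuous (fst : V2 -> R^o) by move=> q; exact: cvg_fst.
have c2 : continuous (snd : V2 -> R^o) by move=> q; exact: cvg_snd.
have [_ ->] := @linear_comp R V2 (fst : {linear V2 -> R^o}) a p v c1 sa.
have [_ ->] := @linear_comp R V2 (snd : {linear V2 -> R^o}) b p v c2 sb.
by rewrite /=; ring.
Qed.

Lemma testT_E k : testT (@E R k).
Proof.
split.
  move=> x; apply: complexP; rewrite ?ReEk ?ImEk mulrDr; have [h1 h2] := @trig_periodic R k.
    by rewrite cosD h1 h2; ring.
  by rewrite sinD h1 h2; ring.
apply: (@smooth_nice R R^o (fun x => cos (k%:~R * x)) (fun x => - sin (k%:~R * x))).
  exact: (nice_id (smoothR_cos k%:~R)).
apply: nice_id; rewrite (_ : (fun x => - sin _) = (fun x => -1 * sin (k%:~R * x))).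
  exact/smoothRZ/smoothR_sin.
by apply/funext => x; rewrite mulN1r.
Qed.

Definition Phi (c : R -> R) k (p : V2) : R[i] := (c p.1)%:C%C * E k p.2.

Lemma PhiE c k : Phi c k = fun p => (c p.1 * cos (k%:~R * p.2) +i* (c p.1 * (- 1 * sin (k%:~R * p.2))))%C.
Proof.
by apply/funext => p; apply: complexP; rewrite /Phi !ReIm/=; ring.
Qed.

Lemma smoothR_msin k : smoothR (fun x : R => -1 * sin (k%:~R * x)).
Proof. exact/smoothRZ/smoothR_sin. Qed.

Lemma smooth_Phi c k : smoothR c -> smooth (Phi c k).
Proof.
move=> sc; rewrite PhiE; apply: smooth_nice; apply: niceM.
- exact: nice_fst.
- exact: (nice_snd (smoothR_cos k%:~R)).
- exact: nice_fst.
- exact: (nice_snd (smoothR_msin k)).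
Qed.

Lemma testST_Phi T c k : testR T c -> testST T (Phi c k).
Proof.
move=> [sc [a [b [a0 bT h]]]]; split; first exact: smooth_Phi.
  by move=> t x; rewrite /Phi/= (testT_E k).1.
by exists a, b; split=> // t x /h; rewrite /Phi/= => ->; rewrite mul0r.
Qed.

Lemma derive1_trig (k x : R) : derive1 (fun x => cos (k * x)) x = - (k * sin (k * x)) /\
  derive1 (fun x => -1 * sin (k * x)) x = - (k * cos (k * x)).
Proof.
have d : is_derive x 1 (fun x => k * x) k.
  by apply: is_derive_eq; rewrite [_ *: _]mulr1.
split; apply: derive1P; apply: is_derive_eq.
  by rewrite mulNr mulrC.
by rewrite [_ *: _]mulN1r mulrC.
Qed.

Lemma cderive_prod (a b d : R -> R) (v : V2) : smoothR a -> smoothR b -> smoothR d ->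
  cderive v (fun p : V2 => (a p.1 * b p.2 +i* (a p.1 * d p.2))%C) =
  (fun p => ((v.1 * (derive1 a p.1 * b p.2) + v.2 * (a p.1 * derive1 b p.2)) +i*
             (v.1 * (derive1 a p.1 * d p.2) + v.2 * (a p.1 * derive1 d p.2)))%C).
Proof.
move=> sa sb sd; apply/funext => p; apply: complexP.
  exact: (f_equal (fun h => h p) (derive_prod_fst v sa sb)).
exact: (f_equal (fun h => h p) (derive_prod_fst v sa sd)).
Qed.

Lemma cderive_t c k : smoothR c -> cderive ((1, 0) : V2) (Phi c k) = Phi (derive1 c) k.
Proof.
move=> sc; rewrite !PhiE (@cderive_prod c (fun x => cos (k%:~R * x)) (fun x => -1 * sin (k%:~R * x)))//; [|exact: smoothR_cos|exact: smoothR_msin].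
by apply/funext => p; rewrite /= !mul0r !mul1r !addr0.
Qed.

Lemma cderive_xx c k : smoothR c ->
  cderive ((0, 1) : V2) (cderive ((0, 1) : V2) (Phi c k)) = fun p => (- (k * k)%:~R%:C%C) * Phi c k p.
Proof.
move=> sc; rewrite PhiE (@cderive_prod c (fun x => cos (k%:~R * x)) (fun x => -1 * sin (k%:~R * x)))//; [|exact: smoothR_cos|exact: smoothR_msin].
rewrite (_ : (fun p => _) = fun p : V2 =>
  (c p.1 * (- k%:~R * sin (k%:~R * p.2)) +i* (c p.1 * (- k%:~R * cos (k%:~R * p.2))))%C); last first.
  apply/funext => p; have [-> ->] := derive1_trig k%:~R p.2.
  by apply: complexP; rewrite /=; ring.
rewrite (@cderive_prod c (fun x => - k%:~R * sin (k%:~R * x)) (fun x => - k%:~R * cos (k%:~R * x)))//;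
  [|exact/smoothRZ/smoothR_sin|exact/smoothRZ/smoothR_cos].
have dZ (a : R) (b : R -> R) x : smoothR b -> derive1 (fun x => a * b x) x = a * derive1 b x.
  by move=> sb; rewrite !derive1E deriveZ//; exact: smoothR_derivable.
apply/funext => p; rewrite !dZ; [|exact: smoothR_cos|exact: smoothR_sin].
rewrite intrM.
have [-> h] := derive1_trig k%:~R p.2.
have -> : derive1 (fun x : R => sin (k%:~R * x)) p.2 = k%:~R * cos (k%:~R * p.2).
  by apply: oppr_inj; rewrite -h dZ ?mulN1r//; exact: smoothR_sin.
by apply: complexP; rewrite ?cReM ?cImM ?cReN ?cImN /=; ring.
Qed.
End SpaceTimeTests.

Section ModeEquations.
Context {R : realType}.
Local Notation mu := (@lebesgue_measure R).
Local Notation twopi := (pi *+ 2 : R).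
Implicit Types (T t : R) (chi : R -> R) (f g h : R -> R[i]).

Lemma is_derive_const0 (T : R) (f : R -> R) : {within `[0, T], continuous f} ->
  (forall t, 0 < t < T -> is_derive t 1 f 0) -> forall t, 0 <= t <= T -> f t = f 0.
Proof.
move=> cf df t /andP[t0 tT].
have [||c _] := @MVT_segment R f (fun=> 0) 0 t t0.
- by move=> x; rewrite in_itv/= => /andP[x0 xt]; apply: df; rewrite x0 (lt_le_trans xt).
- by apply: continuous_subspaceW cf => x /=; rewrite !in_itv/= => /andP[-> xt]; exact: le_trans tT.
by rewrite mul0r => /eqP; rewrite subr_eq0 => /eqP.
Qed.

Lemma by_parts (T : R) (f g c : R -> R) : 0 < T -> {within `[0, T], continuous f} ->
  {within `[0, T], continuous g} -> (forall t, 0 < t < T -> is_derive t 1 f (g t)) ->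
  smoothR c -> c 0 = 0 -> c T = 0 ->
  \int[mu]_(t in `[0, T]) (f t * derive1 c t) + \int[mu]_(t in `[0, T]) (g t * c t) = 0.
Proof.
move=> T0 cf cg df sc c0 cT.
have cc := @smoothR_within R 0 T _ sc; have cd := @smoothR_within R 0 T _ (smoothR_derive1 sc).
have h1 := withinM cf cd; have h2 := withinM cg cc.
rewrite -RintegralD//; [|exact: within_integrable..].
have ch : {within `[0, T], continuous (fun t => f t * derive1 c t + g t * c t)}.
  by move=> x; apply: cvgD; [exact: h1|exact: h2].
have dF t : 0 < t < T -> is_derive t 1 (fun t => f t * c t) (f t * derive1 c t + g t * c t).
  move=> /df dft; have [c' dc _] := smoothR_derive sc.
  apply: (is_derive_eq (is_deriveM dft (dc t))).
  by rewrite (derive1P (dc t)) /=; congr (_ + _); rewrite [RHS]mulrC.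
have := @continuous_FTC2 R _ (fun t => f t * c t) 0 T T0 ch.
rewrite /Rintegral => ->; first by rewrite c0 cT !mulr0 -EFinB subrr.
- have cF := withinM cf cc.
  have [_ l r] := (continuous_within_itvP _ T0).1 cF; split=> // t.
  by rewrite in_itv/= => /dF [].
- by move=> t; rewrite in_itv/= => /dF h; rewrite (derive1P h).
Qed.

Lemma testR_ends T chi : 0 < T -> testR T chi ->
  [/\ chi 0 = 0, chi T = 0, derive1 chi 0 = 0 & derive1 chi T = 0].
Proof.
move=> T0 [_ [a [b [a0 bT z]]]]; split.
- by apply: z; lra.
- by apply: z; lra.
- apply: derive1P; apply: (near_eq_is_derive (f := cst 0)) => //; near=> y.
  have : y < a by near: y; exact: lt_nbhsl.
  by move=> ya; apply/esym/z; lra.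
- apply: derive1P; apply: (near_eq_is_derive (f := cst 0)) => //; near=> y.
  have : b < y by near: y; exact: lt_nbhsr.
  by move=> ya; apply/esym/z; lra.
Unshelve. all: by end_near. Qed.

Definition pairing T h chi : R[i] := cintegral mu `[0, T] (fun t => (chi t)%:C%C * h t).

Lemma pairingE T h chi : pairing T h chi =
  (\int[mu]_(t in `[0, T]) (complex.Re (h t) * chi t) +i*
   \int[mu]_(t in `[0, T]) (complex.Im (h t) * chi t))%C.
Proof.
by apply: complexP; rewrite /pairing /cintegral/=; apply: eq_Rintegral => t _;
  rewrite ?cReM ?cImM/= mul0r ?subr0 ?addr0 mulrC.
Qed.

Lemma pairingD T f g chi : ccont 0 T f -> ccont 0 T g -> smoothR chi ->
  pairing T (fun t => f t + g t) chi = pairing T f chi + pairing T g chi.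
Proof.
move=> [f1 f2] [g1 g2] sc; have cc := @smoothR_within R 0 T _ sc.
apply: complexP; rewrite !pairingE ?cReD ?cImD /= -RintegralD//;
  try (by apply: within_integrable; apply: withinM).
by apply: eq_Rintegral => t _; rewrite cReD mulrDl.
by apply: eq_Rintegral => t _; rewrite cImD mulrDl.
Qed.

Lemma pairingZ T f (c : R[i]) chi : ccont 0 T f -> smoothR chi ->
  pairing T (fun t => c * f t) chi = c * pairing T f chi.
Proof.
move=> [f1 f2] sc; have cc := @smoothR_within R 0 T _ sc.
have w1 := withinM f1 cc; have w2 := withinM f2 cc.
have i1 := within_integrable w1; have i2 := within_integrable w2.
have iZ (r : R) (a : R -> R) : {within `[0, T], continuous a} ->
    mu.-integrable `[0, T] (EFin \o (fun x => r * a x)).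
  by move=> ca; apply: within_integrable; exact: (withinM (smoothR_within (smoothR_cst r)) ca).
apply: complexP; rewrite !pairingE ?cReM ?cImM /= -!RintegralZl// -?RintegralB -?RintegralD//;
  first [exact: (iZ _ _ w1)|exact: (iZ _ _ w2)|idtac].
- by apply: eq_Rintegral => t _; rewrite cReM; ring.
- by apply: eq_Rintegral => t _; rewrite cImM; ring.
Qed.

Lemma du_bois_complex T f g : 0 < T -> ccont 0 T f -> ccont 0 T g ->
  (forall chi, testR T chi -> pairing T f (derive1 chi) + pairing T g chi = 0) ->
  forall t, 0 < t < T -> cder f t (g t).
Proof.
move=> T0 [f1 f2] [g1 g2] h t tT; split.
- apply: (du_bois_reymond T0 f1 g1) => // chi /h/(f_equal (@complex.Re R)).
  by rewrite !pairingE.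
- apply: (du_bois_reymond T0 f2 g2) => // chi /h/(f_equal (@complex.Im R)).
  by rewrite !pairingE.
Qed.

Lemma by_parts_complex T f g chi : 0 < T -> ccont 0 T f -> ccont 0 T g ->
  (forall t, 0 < t < T -> cder f t (g t)) -> smoothR chi -> chi 0 = 0 -> chi T = 0 ->
  pairing T f (derive1 chi) + pairing T g chi = 0.
Proof.
move=> T0 [f1 f2] [g1 g2] d sc c0 cT; rewrite !pairingE; apply: complexP => /=.
  by apply: by_parts => // t /d[].
by apply: by_parts => // t /d[].
Qed.

Lemma distST_Phi T (u : R -> R -> R[i]) chi k : (forall t, 0 <= t <= T -> cI1 (u t)) ->
  distST_of T u (Phi chi k) = pairing T (fun t => twopi%:C%C * fc (u t) k) chi.
Proof.
move=> hu; have H t : t \in (`[0, T]%classic : set R) ->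
    dist_of (u t) (fun x => Phi chi k (t, x)) = (chi t)%:C%C * (twopi%:C%C * fc (u t) k).
  rewrite inE/= in_itv/= => /hu ut; rewrite -CI_fc -CIZ; last exact: cI1ME.
  by apply: CI_ext => x; rewrite /Phi/= mulrCA.
by apply: complexP; apply: eq_Rintegral => t /H ->.
Qed.

End ModeEquations.

(** * Sobolev norms *)

Section Sobolev.
Context {R : realType}.
Local Notation jb := (@jb R).
Implicit Types (T t s e M : R) (F : R -> functionalT (R := R)) (f : R -> int -> R[i]).

Definition bessel_weight s (k : int) : R := (1 + (k%:~R : R) ^+ 2) `^ s.

Lemma bessel_weight_gt0 s k : 0 < bessel_weight s k.
Proof. by rewrite powR_gt0// ltr_pwDl// sqr_ge0. Qed.

Lemma Hnorm_bound s (f : functionalT (R := R)) (c : R) : 0 <= c -> (Hnorm s f <= c%:E)%E ->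
  l2bound (bessel_weight s) (fourier_coef f) (c ^+ 2).
Proof.
move=> c0 Hc r ur; set S := (\sum_(k <- r) _)%R.
have S0 : 0 <= S.
  by apply: sumr_ge0 => k _; apply: mulr_ge0; [exact: ltW (bessel_weight_gt0 s k)|exact: nsq_ge0].
rewrite -(@ler_sqrt R) ?sqr_ge0// sqrtr_sqr ger0_norm// -powR12_sqrt// -lee_fin -poweR_EFin.
apply: le_trans Hc; apply: gt0_ler_poweR => //; rewrite ?in_itv/= ?leey ?andbT ?lee_fin//.
  by apply: esum_ge0 => k _; rewrite lee_fin; apply: mulr_ge0; [exact: ltW (bessel_weight_gt0 s k)|exact: sqr_ge0].
apply: esum_ge; exists [set` r]; first by split; [exact: finite_seq|move=> x _].
rewrite -fsbig_seq// /S -sumEFin; apply: lee_sum => k _.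
by rewrite lee_fin nsqE.
Qed.

Lemma cvg0_near (A : set R) t (G : R -> \bar R) (e : R) :
  G t' @[t' --> within A (nbhs t)] --> 0%E -> 0 < e ->
  exists2 d, 0 < d & forall t', A t' -> `|t' - t| < d -> (G t' <= e%:E)%E.
Proof.
move=> hG e0; have h : nbhs (0%E : \bar R) [set x | (x < e%:E)%E].
  by apply: open_nbhs_nbhs; split; [exact: open_ereal_lt_ereal|rewrite /= lte_fin].
have /nbhs_ballP[d /= d0 hd] := hG _ h.
exists d => // t' At' tt'; apply: ltW; apply: hd => //.
by rewrite /ball/= distrC.
Qed.

(** Continuity into the weighted [l^2] space, written with bounds on squared norms; the first clause
    says that the values lie in that space. *)
Definition l2_continuous T (om : int -> R) f := forall t, 0 <= t <= T ->
  (exists M, l2bound om (f t) M) /\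
  forall e, 0 < e -> exists2 d, 0 < d & forall t', 0 <= t' <= T -> `|t' - t| < d ->
    l2bound om (fun k => f t' k - f t k) e.

Lemma l2_continuous_le T (om om' : int -> R) f : (forall k, om' k <= om k) ->
  l2_continuous T om f -> l2_continuous T om' f.
Proof.
move=> hom hf t /hf[[M hM] ht].
have W a A : l2bound om a A -> l2bound om' a A.
  by move=> aA r /aA; apply: le_trans; apply: ler_sum => k _; rewrite ler_wpM2r ?nsq_ge0.
split; first by exists M; exact: W.
by move=> e /ht[d d0 hd]; exists d => // t' t'T /(hd _ t'T); exact: W.
Qed.

Lemma l2_continuousZ T (om : int -> R) (c : R) f : 0 < c ->
  l2_continuous T om f -> l2_continuous T (fun k => c * om k) f.
Proof.
move=> c0 hf t /hf[[M hM] ht].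
have W a A : l2bound om a A -> l2bound (fun k => c * om k) a (c * A).
  move=> aA r /aA h; under eq_bigr do rewrite -mulrA.
  by rewrite -mulr_sumr ler_pM2l.
split; first by exists (c * M); exact: W.
move=> e e0; have [d d0 hd] := ht (e / c) ltac:(by rewrite divr_gt0).
exists d => // t' t'T /(hd _ t'T)/W; rewrite mulrCA divff ?gt_eqF// mulr1.
by [].
Qed.

(** Compactness of [[0, T]] in its near-covering form, with the bound [M] running along the filter
    at infinity. *)
Lemma locally_bounded T (P : R -> R -> Prop) : (forall M M' s, M <= M' -> P M s -> P M' s) ->
  (forall t, 0 <= t <= T -> exists M, exists2 d, 0 < d &
     forall t', 0 <= t' <= T -> `|t' - t| < d -> P M t') ->
  exists M, forall t, 0 <= t <= T -> P M t.
Proof.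
move=> mono loc.
have /compact_near_coveringP cov := @segment_compact R 0 T.
have [|M [_ hM]] := cov R +oo%R (fun M t => 0 <= t <= T -> P M t) _ _.
  move=> t; rewrite /= in_itv/= => /loc[M [d d0 hd]].
  exists (ball t d, [set x | M < x]) => /=; first by split; [exact: nbhsx_ballx|apply: nbhs_pinfty_gt; exact: num_real].
  move=> [t' M'] [/= tt' MM'] t'T; apply: (mono M); first exact: ltW.
  by apply: hd => //; rewrite distrC.
exists (M + 1) => t tT; apply: (hM (M + 1)); last by [].
  by rewrite /= ltrDl.
by rewrite /= in_itv.
Qed.

Lemma l2_continuous_bounded T (om : int -> R) f : (forall k, 0 <= om k) -> l2_continuous T om f ->
  exists M, forall t, 0 <= t <= T -> l2bound om (f t) M.
Proof.
move=> om0 hf; apply: (@locally_bounded T (fun M t => l2bound om (f t) M)).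
  by move=> M M' s MM'; exact: l2boundW.
move=> t /hf[[M hM] ht]; have [d d0 hd] := ht 1 ltr01.
exists (2 * 1 + 2 * M); exists d => // t' t'T /(hd _ t'T) h.
have := l2boundD om0 h hM.
by rewrite (_ : (fun k => _) = f t')//; apply/funext => k; rewrite subrK.
Qed.

Lemma ccontP T (f : R -> R[i]) :
  (forall t e, 0 <= t <= T -> 0 < e -> exists2 d, 0 < d & forall t', 0 <= t' <= T -> `|t' - t| < d ->
    nsq (f t' - f t) <= e ^+ 2) -> ccont 0 T f.
Proof.
move=> h.
have H (p : R[i] -> R) : (forall z w, p (z - w) = p z - p w) -> (forall z, p z ^+ 2 <= nsq z) ->
    {within `[0, T], continuous (fun t => p (f t))}.
  move=> pB pn; apply/subspace_continuousP => t; rewrite /= in_itv/= => tT.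
  apply/cvgrPdist_le => e e0; have [d d0 hd] := h t e tT e0.
  exists d => // t' tt'; rewrite /= in_itv/= => t'T.
  rewrite distrC -pB -(@ler_pXn2r R 2) ?nnegrE ?(ltW e0)//.
  rewrite real_normK ?num_real//; apply: le_trans (pn _) _; apply: hd => //.
  by rewrite distrC.
split; apply: H => z; rewrite ?ReIm// /nsq; first by move=> w; rewrite !ReIm.
- by rewrite lerDl sqr_ge0.
- by move=> w; rewrite !ReIm.
- by rewrite lerDr sqr_ge0.
Qed.

Lemma l2_continuous_ccont T (om : int -> R) f k : 0 < om k -> l2_continuous T om f ->
  ccont 0 T (fun t => f t k).
Proof.
move=> om0 hf; apply: ccontP => t e tT e0; have [_ ht] := hf t tT.
have [d d0 hd] := ht (om k * e ^+ 2) ltac:(by rewrite mulr_gt0// exprn_gt0).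
exists d => // t' t'T /(hd _ t'T)/(_ [:: k] isT).
by rewrite big_seq1 ler_pM2l.
Qed.

Lemma Hs_l2_continuous s T F : (forall t, 0 <= t <= T -> Hs s (F t)) ->
  (forall t, 0 <= t <= T -> Hdist s (F t') (F t) @[t' --> within `[0, T]%classic (nbhs t)] --> 0%E) ->
  l2_continuous T (bessel_weight s) (fun t => fourier_coef (F t)).
Proof.
move=> hF cF t tT; split.
  have [_ fin] := hF t tT; exists (fine (Hnorm s (F t)) ^+ 2).
  have H0 : (0 <= Hnorm s (F t))%E by exact: poweR_ge0.
  by apply: Hnorm_bound; rewrite ?fine_ge0// fineK// ge0_fin_numE.
move=> e e0; have [|d d0 hd] := cvg0_near (cF t tT) (e := Num.sqrt e); first by rewrite sqrtr_gt0.
exists d => // t' t'T tt'; have := hd t'; rewrite /= in_itv/= => /(_ t'T tt').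
move/(Hnorm_bound (sqrtr_ge0 e)); rewrite sqr_sqrtr ?(ltW e0)//.
rewrite (_ : fourier_coef _ = fun k => fourier_coef (F t') k - fourier_coef (F t) k)//.
by apply/funext => k; rewrite /fourier_coef mulrBr.
Qed.

Lemma jb_bessel_weight k : jb k <= 2 * bessel_weight 2^-1 k.
Proof.
rewrite /bessel_weight powR12_sqrt; last by rewrite addr_ge0// sqr_ge0.
have h : `|k%:~R : R| <= Num.sqrt (1 + k%:~R ^+ 2).
  by rewrite -sqrtr_sqr ler_sqrt ?lerDr// addr_ge0// sqr_ge0.
have h1 : 1 <= Num.sqrt (1 + (k%:~R : R) ^+ 2).
  by rewrite -{1}(@sqrtr1 R) ler_sqrt ?lerDl ?sqr_ge0// addr_ge0// sqr_ge0.
by rewrite /jb intr_norm; lra.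
Qed.

Lemma bessel_weightN1 k : bessel_weight (-1) k = (1 + (k%:~R : R) ^+ 2)^-1.
Proof. by rewrite /bessel_weight powR_inv1// addr_ge0// sqr_ge0. Qed.

End Sobolev.

Section Coefficients.
Context {R : realType}.
Local Notation jb := (@jb R).
Local Notation tau := (@torus_measure R).
Local Notation twopi := (pi *+ 2 : R).
Implicit Types (T t e M : R) (u : R -> R -> R[i]) (N : R -> R -> R).

Lemma cderP (f : R -> R[i]) t (l : R[i]) :
  (forall e, 0 < e -> exists2 d, 0 < d & forall t', t' != t -> `|t' - t| < d ->
    nsq (((t' - t)^-1)%:C%C * (f t' - f t) - l) <= e ^+ 2) -> cder f t l.
Proof.
move=> h.
have H (p : R[i] -> R) : (forall z w, p (z - w) = p z - p w) ->
    (forall (c : R) z, p (c%:C%C * z) = c * p z) -> (forall z, p z ^+ 2 <= nsq z) ->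
    is_derive t 1 (fun t => p (f t)) (p l).
  move=> pB pZ pn.
  have lim : h^-1 *: ((((fun t => p (f t)) \o shift t) (h *: (1 : R^o))) - p (f t)) @[h --> (0 : R)^'] --> p l.
    apply/cvgrPdist_le => e e0; have [d d0 hd] := h e e0.
    exists d => // x /= xd x0.
    rewrite distrC [_ *: (1 : R^o)]mulr1 -(@ler_pXn2r R 2) ?nnegrE ?(ltW e0)//.
    rewrite real_normK ?num_real// -pB [_ *: _](esym (pZ _ _)) -pB.
    apply: le_trans (pn _) _; have := hd (x + t); rewrite addrK; apply.
      by rewrite -subr_eq0 addrK.
    by move: xd; rewrite /ball_/= sub0r normrN.
  by apply: DeriveDef; [apply/cvg_ex; exists (p l); exact: lim|apply: cvg_lim => //; exact: lim].
split; apply: H => z; rewrite /nsq.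
- by move=> w; rewrite !ReIm.
- by move=> w; rewrite cReM /= mul0r subr0.
- by rewrite lerDl sqr_ge0.
- by move=> w; rewrite !ReIm.
- by move=> w; rewrite cImM /= mul0r addr0.
- by rewrite lerDr sqr_ge0.
Qed.

Lemma derivative_Hs_cder s T (F F' : R -> functionalT (R := R)) k t : derivative_Hs s T F F' ->
  0 < t < T -> cder (fun t => fourier_coef (F t) k) t (fourier_coef (F' t) k).
Proof.
move=> dF tT; apply: cderP => e e0; case/andP: (tT) => t0 tT'.
have w0 := @bessel_weight_gt0 R s k.
have e'0 : 0 < Num.sqrt (bessel_weight s k) * e by rewrite mulr_gt0// sqrtr_gt0.
have /cvg0_near/(_ e'0)[d d0 hd] := dF t ltac:(by rewrite /= in_itv/= !ltW).
exists (Num.min d (Num.min t (T - t))); first by rewrite !lt_min d0 t0 subr_gt0.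
move=> t' t't; rewrite !lt_min => /and3P[h1 h2 h3].
have t'T : 0 <= t' <= T by move: h2 h3; rewrite !ltr_norml; lra.
have : (`[0, T]%classic `\ t) t' by split; [rewrite /= in_itv|exact/eqP].
move=> /hd/(_ h1)/(Hnorm_bound (ltW e'0))/(_ [:: k] isT).
rewrite big_seq1 exprMn sqr_sqrtr ?(ltW w0)// ler_pM2l// => h; apply: le_trans h.
by rewrite /fourier_coef le_eqVlt; apply/orP; left; apply/eqP; congr nsq; ring.
Qed.

Lemma L1C_cI1 (f : R -> R[i]) : L1C f -> cI1 f.
Proof. by case=> _ /Lfun1_integrable a /Lfun1_integrable b; split. Qed.

Lemma L2_sq (f : R -> R) : L2 f -> sq f.
Proof.
case=> _ hf; split; last exact: Lfun2_integrable_sqr.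
by move: hf; rewrite inE => /andP[]; rewrite inE.
Qed.

Lemma Lnorm2_J (f : R -> R) e : sq f -> 0 <= e ->
  ('N[tau]_2%:E [(fun x => (f x)%:E)] <= e%:E)%E -> J (fun x => f x ^+ 2) <= e ^+ 2.
Proof.
move=> sf e0; rewrite unlock.
rewrite (_ : (\int[tau]_x _)%E = (J (fun x => f x ^+ 2))%:E); last first.
  rewrite -J_EFin; last exact: sf.2.
  by apply: eq_integral => x _; rewrite abse_EFin poweR_EFin powR_mulrn// real_normK ?num_real.
rewrite poweR_EFin lee_fin powR12_sqrt ?J_sq_ge0// => h.
by rewrite -(sqr_sqrtr (J_sq_ge0 f)) ler_pXn2r ?nnegrE ?sqrtr_ge0.
Qed.

Lemma L2_l2_continuous T N : continuous_L2 T N -> l2_continuous T (fun=> 1) (fun t => fc (rc (N t))).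
Proof.
move=> [hN cN] t tT; have tp := @two_pi_gt0 R.
have sN s : 0 <= s <= T -> sq (N s) by move=> sT; apply: L2_sq; apply: hN; rewrite /= in_itv.
have B (f : R -> R) (A : R) : sq f -> J (fun x => f x ^+ 2) <= A -> l2bound (fun=> 1) (fc (rc f)) (A / twopi).
  move=> sf JA r ur; under eq_bigr do rewrite mul1r.
  rewrite ler_pdivlMr// mulrC; apply: le_trans (bessel (csq_rc sf) ur) _.
  by rewrite JN_rc.
split; first by exists (J (fun x => N t x ^+ 2) / twopi); apply: B => //; exact: sN.
move=> e e0; have ct := cN t ltac:(by rewrite /= in_itv).
have e'0 : 0 < Num.sqrt (twopi * e) by rewrite sqrtr_gt0 mulr_gt0.
have [d d0 hd] := cvg0_near ct e'0.
exists d => // t' t'T tt'; have s' := sqB (sN t' t'T) (sN t tT).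
have := Lnorm2_J s' (ltW e'0) (hd t' ltac:(by rewrite /= in_itv) tt').
rewrite sqr_sqrtr; last by rewrite mulr_ge0// ltW.
move=> /(B _ _ s'); rewrite mulrAC divff ?gt_eqF// mul1r.
rewrite (_ : fc _ = fun k => fc (rc (N t')) k - fc (rc (N t)) k)//; apply/funext => k.
have i1 := cI1_rc (sq_I1 (sN _ t'T)); have i2 := cI1_rc (sq_I1 (sN _ tT)).
rewrite -[- fc _ _]mulN1r -fcZ// -fcD//; last exact: cI1Z.
by congr (_ * _); apply: CI_ext => x; congr (_ * _); apply: complexP; rewrite /rc !ReIm/=; ring.
Qed.

(** A uniform limit of continuous functions. It supplies the continuity in time of the coefficients
    of [N u] and [|u|^2], which are reached only as limits of truncated convolutions. *)
Lemma ccont_limit T (f : nat -> R -> R[i]) (l : R -> R[i]) (C : R) : 0 <= C ->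
  (forall L, ccont 0 T (f L)) ->
  (forall L t, 0 <= t <= T -> nsq (f L t - l t) <= C / L.+1%:R) -> ccont 0 T l.
Proof.
move=> C0 cf fl.
have H (p : R[i] -> R) : (forall z w, p (z - w) = p z - p w) -> (forall z, p z ^+ 2 <= nsq z) ->
    (forall L, {within `[0, T], continuous (fun t => p (f L t))}) ->
    {within `[0, T], continuous (fun t => p (l t))}.
  move=> pB pn cp; apply/subspace_continuousP => t tT.
  have tT' : 0 <= t <= T by move: tT; rewrite /= in_itv.
  apply/cvgrPdist_le => e e0; have e3 : 0 < e / 3 by rewrite divr_gt0.
  pose L := Num.bound (C / (e / 3) ^+ 2).
  have hL s : 0 <= s <= T -> `|p (f L s) - p (l s)| <= e / 3.
    move=> sT; rewrite -pB -(@ler_pXn2r R 2) ?nnegrE ?(ltW e3)//.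
    rewrite real_normK ?num_real//; apply: le_trans (pn _) _; apply: le_trans (fl L s sT) _.
    rewrite ler_pdivrMr ?ltr0n// -ler_pdivrMl ?exprn_gt0// mulrC ltW//.
    apply: (lt_le_trans (archi_boundP _)); first by rewrite divr_ge0// sqr_ge0.
    by rewrite ler_nat.
  have /subspace_continuousP/(_ t tT)/cvgrPdist_le/(_ _ e3) := cp L.
  move=> [d /= d0 hd]; exists d => // s ts sT.
  have sT' : 0 <= s <= T by move: sT; rewrite /= in_itv.
  have := hd s ts sT; have := hL s sT'; have := hL t tT'.
  by rewrite !ler_norml /from_subspace; move: (p _) (p _) (p _) (p _) => a1 a2 a3 a4; clear; lra.
split; apply: H => z; rewrite /nsq.
- by move=> w; rewrite !ReIm.
- by rewrite lerDl sqr_ge0.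
- exact: (cf z).1.
- by move=> w; rewrite !ReIm.
- by rewrite lerDr sqr_ge0.
- exact: (cf z).2.
Qed.

End Coefficients.

(** * From a solution to its mode system *)

Section SolutionModes.
Context {R : realType}.
Local Notation jb := (@jb R).
Local Notation twopi := (pi *+ 2 : R).
Variables (T : R) (u : R -> R -> R[i]) (N : R -> R -> R) (Nt : R -> functionalT (R := R)).
Hypotheses (T0 : 0 < T) (Hu : continuous_Hs_fun 2^-1 T u) (HN : continuous_L2 T N)
  (HNt : C1_HsR (-1) T (fun t => dist_of (to_complex (N t))) Nt)
  (HS : schrodinger_eq T u N) (HW : wave_eq T u N).

Definition uhat k t := fc (u t) k.
Definition Nhat k t := fc (rc (N t)) k.
Definition Nthat k t := fourier_coef (Nt t) k.
Definition Fhat k t := fc (fun x => (N t x)%:C%C * u t x) k.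
Definition Ghat k t := fc (rc (fun x => nsq (u t x))) k.

Let inT t : 0 <= t <= T -> `[0, T]%classic t.
Proof. by rewrite /= in_itv. Qed.

Let i_u t : 0 <= t <= T -> cI1 (u t).
Proof. by move=> /inT/(Hu.1)[/L1C_cI1]. Qed.

Let s_N t : 0 <= t <= T -> sq (N t).
Proof. by move=> /inT/(HN.1)/L2_sq. Qed.

Let l2_u : l2_continuous T jb (fun t => fc (u t)).
Proof.
apply: (l2_continuous_le (@jb_bessel_weight R)).
apply: (l2_continuousZ (ltr0Sn R 1)); apply: (@Hs_l2_continuous R 2^-1 T (fun t => dist_of (u t))) => t /inT tT.
  by have [] := Hu.1 t tT.
exact: Hu.2.
Qed.

Let l2_N : l2_continuous T (fun=> 1) (fun t => fc (rc (N t))).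
Proof. exact: L2_l2_continuous. Qed.

Let l2_Nt : l2_continuous T (bessel_weight (-1)) (fun t => fourier_coef (Nt t)).
Proof.
have [_ [h1 h2] _] := HNt.
by apply: Hs_l2_continuous => t /inT tT; [exact: (h1 t tT).1|exact: (h2 t tT)].
Qed.

Let bounds : exists M, forall t, 0 <= t <= T -> [/\ l2bound jb (uhat ^~ t) M,
  l2bound (fun=> 1) (Nhat ^~ t) M & l2bound (bessel_weight (-1)) (Nthat ^~ t) M].
Proof.
have [A hA] := l2_continuous_bounded (fun k => ltW (@jb_gt0 R k)) l2_u.
have [B hB] := l2_continuous_bounded (fun=> ler01) l2_N.
have [C hC] := l2_continuous_bounded (fun k => ltW (@bessel_weight_gt0 R (-1) k)) l2_Nt.
exists (Num.max A (Num.max B C)) => t tT; split.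
- by apply: l2boundW (hA t tT); rewrite le_max lexx.
- by apply: l2boundW (hB t tT); rewrite !le_max lexx orbT.
- by apply: l2boundW (hC t tT); rewrite !le_max lexx !orbT.
Qed.

(** By definition [u t] is merely integrable; its coefficients are square summable, and the converse
    of Bessel's inequality makes it square integrable. The integrability of [N u] and [|u|^2] rests
    on this. *)
Let s_u t : 0 <= t <= T -> csq (u t).
Proof.
move=> tT; have [M h] := bounds; have [hM _ _] := h t tT.
exact: (riesz_fischerC (i_u tT) (l2bound_jb hM)).1.
Qed.

Let c_u k : ccont 0 T (uhat k).
Proof. exact: (l2_continuous_ccont (@jb_gt0 R k) l2_u). Qed.

Let c_N k : ccont 0 T (Nhat k).
Proof. exact: (l2_continuous_ccont (k := k) (@ltr01 R) l2_N). Qed.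

Let c_Nt k : ccont 0 T (Nthat k).
Proof. exact: (l2_continuous_ccont (@bessel_weight_gt0 R (-1) k) l2_Nt). Qed.

Let lim_F k t : 0 <= t <= T -> clim (fun L => S_full L (Nhat ^~ t) (uhat ^~ t) k) (Fhat k t).
Proof.
move=> tT; have [M h] := bounds; have [hM _ _] := h t tT.
exact: (fc_mul k (csq_rc (s_N tT)) (i_u tT) hM).
Qed.

Let lim_G m t : 0 <= t <= T -> clim (fun L => W_full L (uhat ^~ t) (uhat ^~ t) m) (Ghat m t).
Proof.
move=> tT; have [M h] := bounds; have [hM _ _] := h t tT.
exact: (fc_nsq m (i_u tT) hM).
Qed.

Let c_F k : ccont 0 T (Fhat k).
Proof.
have [M h] := bounds.
have M0 : 0 <= M by have [/l2bound_ge0] := h 0 ltac:(by rewrite lexx ltW).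
apply: (@ccont_limit R T (fun L t => S_full L (Nhat ^~ t) (uhat ^~ t) k) _ (2 * M * M)).
- by rewrite !mulr_ge0.
- by move=> L; apply: ccont_sum => j _; exact: ccontM.
move=> L t tT; have [hu hN _] := h t tT.
exact: (conv_tail L (l2bound_shift k hN) hu (lim_F k tT)).
Qed.

Let c_G m : ccont 0 T (Ghat m).
Proof.
have [M h] := bounds.
have M0 : 0 <= M by have [/l2bound_ge0] := h 0 ltac:(by rewrite lexx ltW).
apply: (@ccont_limit R T (fun L t => W_full L (uhat ^~ t) (uhat ^~ t) m) _ (2 * M * M)).
- by rewrite !mulr_ge0.
- by move=> L; apply: ccont_sum => j _; apply: ccontM => //; exact: ccontJ.
move=> L t tT; have [hu _ _] := h t tT.
exact: (conv_tail L (l2bound_shiftD m (l2bound_jb hu)) (l2bound_conj hu) (lim_G m tT)).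
Qed.

Let ccontZ c f : ccont 0 T f -> ccont 0 T (fun t => c * f t).
Proof. by move=> cf; apply: ccontM => //; exact: ccont_cst. Qed.

Let twopi0 : twopi%:C%C != 0 :> R[i] := twopi_neq0.

Let ii : 'i%C * 'i%C = -1 :> R[i].
Proof. by apply: complexP; rewrite /=; ring. Qed.

Let pairing_scale h (c : R) chi : ccont 0 T h -> smoothR chi ->
  pairing T h (fun t => c * chi t) = c%:C%C * pairing T h chi.
Proof.
move=> ch sc; rewrite -pairingZ//; congr (cintegral _ _ _); apply/funext => t.
by rewrite rmorphM/=; ring.
Qed.

Let distST_hat (w : R -> R -> R[i]) chi k : (forall t, 0 <= t <= T -> cI1 (w t)) ->
  ccont 0 T (fun t => fc (w t) k) -> smoothR chi ->
  distST_of T w (Phi chi k) = twopi%:C%C * pairing T (fun t => fc (w t) k) chi.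
Proof. by move=> iw cw sc; rewrite distST_Phi// pairingZ. Qed.

Let Phi_scale (c : R) chi k : (fun p => c%:C%C * Phi chi k p) = Phi (fun t => c * chi t) k.
Proof. by apply/funext => p; rewrite /Phi mulrA -rmorphM. Qed.

Let kkN k : - (k * k)%:~R%:C%C = (- (k * k)%:~R)%:C%C :> R[i].
Proof. by rewrite rmorphN. Qed.

Let i_Nu t : 0 <= t <= T -> cI1 (fun x => (N t x)%:C%C * u t x).
Proof. by move=> tT; apply: csq_cI1M; [exact: csq_rc (s_N tT)|exact: s_u]. Qed.

Let i_N t : 0 <= t <= T -> cI1 (rc (N t)).
Proof. by move=> tT; apply: cI1_rc; apply: sq_I1; exact: s_N. Qed.

Let i_uu t : 0 <= t <= T -> cI1 (rc (fun x => nsq (u t x))).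
Proof. by move=> tT; apply: cI1_rc; apply: I1_nsq; exact: s_u. Qed.

(** The test function [Phi chi k] reduces the equation to a scalar weak one in time. All its terms
    are continuous, so the du Bois-Reymond lemma makes it classical. *)
Lemma du_uhat k t : 0 < t < T ->
  cder (uhat k) t (- ('i%C * (k * k)%:~R%:C%C * uhat k t) - 'i%C * Fhat k t).
Proof.
move: t; apply: (du_bois_complex T0 (c_u k)).
  apply: ccontB; last exact: ccontZ.
  by apply: ccontN; exact: ccontZ.
move=> chi hchi; have sc := hchi.1; have sd := smoothR_derive1 sc.
rewrite (_ : (fun t => _ - _) = fun t => (- ('i%C * (k * k)%:~R%:C%C)) * uhat k t + (- 'i%C) * Fhat k t); last first.
  by apply/funext => t; ring.
rewrite pairingD//; try exact: ccontZ.
rewrite (pairingZ _ (c_u k) sc) (pairingZ _ (c_F k) sc).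
have := HS (testST_Phi k hchi); rewrite /dt /dx opprK cderive_t// cderive_xx//.
rewrite kkN Phi_scale (distST_hat i_u (c_u k) sd) (distST_hat i_u (c_u k) (smoothRZ _ sc)).
rewrite (distST_hat i_Nu (c_F k) sc) (pairing_scale _ (c_u k) sc) -kkN.
set P' := pairing _ _ _; set P := pairing _ _ _; set Q := pairing _ _ _ => e.
apply: (mulfI twopi0); rewrite mulr0 -[RHS](mulr0 'i%C) -(subrr (twopi%:C%C * Q)) -{1}e.
have -> : 'i%C * ('i%C * - (twopi%:C%C * P') + twopi%:C%C * (- (k * k)%:~R%:C%C * P) - twopi%:C%C * Q)
  = - ('i%C * 'i%C) * (twopi%:C%C * P') - 'i%C * (twopi%:C%C * ((k * k)%:~R%:C%C * P)) - 'i%C * (twopi%:C%C * Q).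
  by ring.
by rewrite ii; ring.
Qed.

Let wave_test (A B : functionalST (R := R)) (phi ptt pxx : R * R -> R[i]) :
  cderive ((1, 0) : R * R) (cderive ((1, 0) : R * R) phi) = ptt ->
  cderive ((0, 1) : R * R) (cderive ((0, 1) : R * R) phi) = pxx ->
  dt (dt A) phi - dx (dx A) phi = dx (dx B) phi -> A ptt - A pxx = B pxx.
Proof.
have E (x y z : R[i]) : - - x - - - y = - - z -> x - y = z by rewrite !opprK.
by move=> <- <-; exact: E.
Qed.

Lemma dN_hat k t : 0 < t < T -> cder (Nhat k) t (Nthat k t).
Proof. by move=> tT; have [_ _ d] := HNt; exact: (derivative_Hs_cder k d tT). Qed.

(** The weak wave equation pairs the coefficient of [N] with the second derivative of [chi]. As
    [Nthat] is already known to be the derivative of [Nhat], one integration by parts turns this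
    into a first-order weak equation for [Nthat]. *)
Lemma dNt_hat k t : 0 < t < T -> cder (Nthat k) t (- ((k * k)%:~R%:C%C * (Nhat k t + Ghat k t))).
Proof.
move: t; apply: (du_bois_complex T0 (c_Nt k)).
  by apply: ccontN; apply: ccontZ; exact: ccontD.
move=> chi hchi; have sc := hchi.1; have sd := smoothR_derive1 sc.
have [c0 cT d0 dT] := testR_ends T0 hchi.
have bp := by_parts_complex T0 (c_N k) (c_Nt k) (dN_hat k) sd d0 dT.
rewrite (_ : (fun t => - _) = fun t => (- (k * k)%:~R%:C%C) * (Nhat k t + Ghat k t)); last first.
  by apply/funext => t; ring.
rewrite (pairingZ _ (ccontD (c_N k) (c_G k)) sc) pairingD//.
have ett := etrans (f_equal (cderive ((1, 0) : R * R)) (cderive_t k sc)) (cderive_t k sd).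
have exx := cderive_xx k sc; rewrite kkN Phi_scale in exx.
have := wave_test ett exx (HW (testST_Phi k hchi)).
rewrite (distST_hat i_N (c_N k) (smoothR_derive1 sd)) (distST_hat i_N (c_N k) (smoothRZ _ sc)).
have -> : (fun t x => (ComplexField.Normc.normc (u t x) ^+ 2)%:C%C) = fun t => rc (fun x => nsq (u t x)).
  by apply/funext => t; apply/funext => x; rewrite nsqE.
rewrite (distST_hat i_uu (c_G k) (smoothRZ _ sc)) (pairing_scale _ (c_N k) sc) (pairing_scale _ (c_G k) sc) -kkN.
move: bp; rewrite -/(Nhat k).
set P'' := pairing _ _ _; set P' := pairing _ _ _; set P := pairing _ _ _; set Q := pairing _ _ _.
move=> /eqP; rewrite addrC addr_eq0 => /eqP -> e.
apply: (mulfI twopi0); rewrite mulr0 -[RHS]oppr0 -(subrr (twopi%:C%C * (- (k * k)%:~R%:C%C * Q))) -{1}e.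
by ring.
Qed.

(** At [k = 0] the inverse has its default value 0, so both half-waves reduce to the zero mode of
    [N] and their mean is the coefficient of [N] at every mode. *)
Definition ahat sg k t := Nhat k t + 'i%C * (sg%:~R / k%:~R : R)%:C%C * Nthat k t.

Lemma ahat0 sg t : ahat sg 0 t = Nhat 0 t.
Proof. by rewrite /ahat invr0 mulr0 rmorph0 mulr0 mul0r addr0. Qed.

Lemma avg_ahat m t : (1 / 2 : R)%:C%C * (ahat 1 m t + ahat (-1) m t) = Nhat m t.
Proof. by rewrite /ahat; apply: complexP; rewrite ?ReIm/= ?mulrNz; lra. Qed.

Lemma solution_modes : exists M, mode_system T M uhat ahat Fhat Ghat.
Proof.
have [M hM] := bounds.
have M0 : 0 <= M by have [/l2bound_ge0] := hM 0 ltac:(by rewrite lexx ltW).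
exists (6 * M); split.
- exact: c_u.
- by move=> sg k _; apply: ccontD => //; exact: ccontZ.
- exact: du_uhat.
- move=> sg m t sg1 m0 tT.
  have mR : (m%:~R : R) != 0 by rewrite intr_eq0.
  apply: cder_eq (cderD (dN_hat m tT) (cderZ _ (dNt_hat m tT))).
  have s2 : (sg%:~R : R) ^+ 2 = 1 by rewrite -real_normK ?num_real// -intr_norm sg1 expr1n.
  rewrite /ahat !intrM; move: (Nhat m t) (Nthat m t) (Ghat m t) s2 mR.
  move: (sg%:~R) (m%:~R) => s' m' [n1 n2] [d1 d2] [g1 g2] s2 mR.
  apply: complexP; rewrite ?ReIm/=.
    rewrite [RHS](_ : _ = s' ^+ 2 * d1 + s' * m' * (n2 + g2)); last by field.
    by rewrite s2; field.
  rewrite [RHS](_ : _ = s' ^+ 2 * d2 - s' * m' * (n1 + g1)); last by field.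
  by rewrite s2; field.
- move=> k t tT; rewrite (_ : (fun L => _) = (fun L => S_full L (Nhat ^~ t) (uhat ^~ t) k)).
    exact: lim_F.
  by apply/funext => L; apply: eq_bigr => j _; rewrite avg_ahat.
- exact: lim_G.
- by move=> t tT; have [h _ _] := hM t tT; apply: l2boundW h; lra.
- move=> sg t sg1 tT; have [_ hN hNt] := hM t tT.
  (* The coefficient of [Nthat] has squared modulus [1 / k^2], at most twice the [H^(-1)] weight
     [1 / (1 + k^2)] for nonzero [k]; hence the bound [2 M] for that part. *)
  rewrite (_ : 6 * M = 2 * M + 2 * (2 * M)); last by ring.
  apply: (l2boundD (fun=> ler01) hN) => r ur; apply: (@le_trans _ _ (2 * \sum_(k <- r) bessel_weight (-1) k * nsq (Nthat k t))).
    rewrite mulr_sumr; apply: ler_sum => k _; rewrite mul1r (nsqM _ (Nthat k t)) (nsqM ('i%C)) nsq_i mul1r nsqC [leRHS]mulrA.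
    apply: ler_wpM2r; first exact: nsq_ge0.
    rewrite bessel_weightN1 exprMn -[sg%:~R ^+ 2]real_normK ?num_real// -intr_norm sg1 expr1n mul1r.
    have [->|k0] := eqVneq k 0; first by rewrite invr0 !expr0n/= addr0 invr1; lra.
    have k1 : 1 <= (k%:~R : R) ^+ 2.
      by rewrite -real_normK ?num_real// -intr_norm exprn_ege1// ler1z -gtz0_ge1 normr_gt0.
    rewrite exprVn ler_pdivlMr ?ltr_pwDl ?(le_trans ler01 k1)//.
    rewrite mulrDr mulr1 mulVf ?gt_eqF ?(lt_le_trans ltr01 k1)//.
    have : ((k%:~R : R) ^+ 2)^-1 <= 1 by rewrite invf_le1// (lt_le_trans ltr01 k1).
    lra.
  by rewrite ler_pM2l//; exact: hNt.
Qed.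

(** At [k = 0] the factor [k^2] removes both the linear and the nonlinear term, so [Nthat 0] is
    constant and the initial data determine the zero mode. *)
Lemma Nhat0_affine t : 0 <= t <= T -> Nhat 0 t = Nhat 0 0 + t%:C%C * Nthat 0 0.
Proof.
have const f : ccont 0 T f -> (forall t, 0 < t < T -> cder f t 0) ->
    forall t, 0 <= t <= T -> f t = f 0.
  move=> [f1 f2] df s sT; apply: complexP.
    by apply: (is_derive_const0 f1) => // r /df[].
  by apply: (is_derive_const0 f2) => // r /df[].
move=> tT.
have hNt s : 0 <= s <= T -> Nthat 0 s = Nthat 0 0.
  apply: const => // r rT; apply: cder_eq (dNt_hat 0 rT).
  by rewrite mulr0 mulr0z rmorph0 mul0r oppr0.
have cid : ccont 0 T (fun s : R => s%:C%C).
  by split; apply: continuous_subspaceT => x; [exact: cvg_id|exact: cvg_cst].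
have did (s : R) : cder (fun s : R => s%:C%C) s 1 by split; [exact: is_derive_id|exact: is_derive_cst].
have := const (fun s => Nhat 0 s - (Nthat 0 0) * s%:C%C) _ _ t tT.
rewrite rmorph0 mulr0 subr0 => <-.
- by rewrite [_%:C%C * _]mulrC subrK.
- by apply: ccontB => //; exact: ccontZ.
- move=> s sT; apply: cder_eq; last exact: (cderB (dN_hat 0 sT) (cderZ _ (did s))).
  by rewrite mulr1 hNt ?subrr//; case/andP: sT => *; rewrite !ltW.
Qed.

Lemma solution_integrable t : 0 <= t <= T -> cI1 (u t) /\ cI1 (rc (N t)).
Proof. by move=> tT; split; [exact: i_u|exact: i_N]. Qed.

End SolutionModes.

(** * Comparison of two solutions *)

Lemma mode_systemW {R : realType} (T M M' : R) u a F G : M <= M' ->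
  mode_system T M u a F G -> mode_system T M' u a F G.
Proof.
move=> MM' [h1 h2 h3 h4 h5 h6 h7 h8]; split=> //.
  by move=> t /h7; exact: l2boundW.
by move=> sg t sg1 /(h8 _ _ sg1); exact: l2boundW.
Qed.

Lemma ae_torusS {R : realType} (P Q S : R -> Prop) : (forall x, P x -> Q x -> S x) ->
  {ae torus_measure, forall x : R, P x} -> {ae torus_measure, forall x : R, Q x} ->
  {ae torus_measure, forall x : R, S x}.
Proof. exact: (@filterS2 _ _ (ae_filter_ringOfSetsType (@torus_measure R))). Qed.

Lemma fc_ae {R : realType} (f g : R -> R[i]) : cI1 f -> cI1 g -> ae_eqT f g -> fc f = fc g.
Proof.
move=> hf hg fg; apply/funext => k; rewrite !fcE; congr (_ * _).
have [f1 f2] := cI1ME k hf; have [g1 g2] := cI1ME k hg.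
have H (p : R[i] -> R) : I1 (fun x => p (f x * E k x)) -> I1 (fun x => p (g x * E k x)) ->
    J (fun x => p (f x * E k x)) = J (fun x => p (g x * E k x)).
  move=> i1 i2; rewrite /J /Rintegral; congr fine; apply: ae_eq_integral => //.
  - by apply/measurable_EFinP; exact: I1_mf i1.
  - by apply/measurable_EFinP; exact: I1_mf i2.
  - by apply: (ae_torusS _ fg fg) => x ->.
by rewrite !CIE; congr (_ +i* _)%C; exact: H.
Qed.

Theorem theorem6p1 (R : realType) (T : R) (u0 : R -> R[i]) (N0 : R -> R)
    (N1 : (R -> R[i]) -> R[i]) :
  0 < T ->
  Hs_fun 2^-1 u0 -> L2 N0 -> HsR (- 1) N1 ->
  forall (u v : R -> R -> R[i]) (N M : R -> R -> R),
    zakharov_solution T u0 N0 N1 u N ->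
    zakharov_solution T u0 N0 N1 v M ->
    forall t : R, 0 <= t <= T -> ae_eqT (u t) (v t) /\ ae_eqT (N t) (M t).
Proof.
move=> T0 _ _ _ u v N M [Hu HN [Nt [HNt Nt0]] [u0E N0E] [HSu HWu]].
move=> [Hv HM [Mt [HMt Mt0]] [v0E M0E] [HSv HWv]] t tT.
have [A hA] := solution_modes T0 Hu HN HNt HSu HWu.
have [B hB] := solution_modes T0 Hv HM HMt HSv HWv.
(* The comparison of mode systems requires the same bound for both solutions. *)
have {}hA := mode_systemW (ltac:(by rewrite le_max lexx) : A <= Num.max A B) hA.
have {}hB := mode_systemW (ltac:(by rewrite le_max lexx orbT) : B <= Num.max A B) hB.
have iu := solution_integrable Hu HN; have iv := solution_integrable Hv HM.
have z0 : 0 <= (0 : R) <= T by rewrite lexx ltW.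
have e_u k : uhat u k 0 = uhat v k 0.
  rewrite /uhat (fc_ae (iu 0 z0).1 (iv 0 z0).1)//.
  by apply: (ae_torusS _ u0E v0E) => x -> ->.
have e_N k : Nhat N k 0 = Nhat M k 0.
  rewrite /Nhat (fc_ae (iu 0 z0).2 (iv 0 z0).2)//.
  by apply: (ae_torusS _ N0E M0E) => x; rewrite /rc => -> ->.
have e_Nt k : Nthat Nt k 0 = Nthat Mt k 0.
  by rewrite /Nthat /fourier_coef (Nt0 _ (testT_E k)) (Mt0 _ (testT_E k)).
have [||eu ea] := modes_unique hA hB _ T0 _ tT.
- by move=> sg s _ sT; rewrite !ahat0 (Nhat0_affine T0 Hu HN HNt HWu sT)
    (Nhat0_affine T0 Hv HM HMt HWv sT) e_N e_Nt.
- by split=> // sg k _; rewrite /ahat e_N e_Nt.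
split; first exact: fourier_unique (iu t tT).1 (iv t tT).1 eu.
(* The coefficients of [N] are recovered as means of the two half-waves. Uniqueness for complex
   functions gives equality of the embedded real ones, whose real parts are then compared. *)
have eN : ae_eqT (rc (N t)) (rc (M t)).
  apply: fourier_unique (iu t tT).2 (iv t tT).2 _ => k.
  by rewrite -/(Nhat N k t) -/(Nhat M k t) -(avg_ahat N Nt) -(avg_ahat M Mt) !ea.
by apply: (ae_torusS _ eN eN) => x [].
Qed.
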